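(* Let $f$ be a conservative twist map of $\mathbb{A}$ and let $\mu$ be a Borel probability measure, invariant and ergodic for $f$, with support in some irrational Aubry-Mather set. Then (i) either the Lyapunov exponents of $\mu$ are zero and $\mathrm{supp}\,\mu$ is $C^1$-regular $\mu$-almost everywhere (i.e. at $\mu$-almost every point); (ii) or $\mu$ is hyperbolic and $\mathrm{supp}\,\mu$ is $C^1$-irregular $\mu$-almost everywhere.
   Context: $\mathbb{T}=\mathbb{R}/\mathbb{Z}$, $\mathbb{A}=\mathbb{T}\times\mathbb{R}$ with coordinates $(\theta,r)$, $p:\mathbb{R}^2\to\mathbb{A}$ is the universal covering, $\pi(\theta,r)=\theta$ (on $\mathbb{A}$ and on $\mathbb{R}^2$), $\lambda=r\,d\theta$. A conservative twist map is a $C^1$-diffeomorphism $f:\mathbb{A}\to\mathbb{A}$ that is isotopic to the identity, such that there is $\varepsilon>0$ with $\varepsilon<D(\pi\circ f)(x)(0,1)<1/\varepsilon$ for all $x\in\mathbb{A}$ (positive twist), and such that $f^*\lambda-\lambda$ is exact. Let $F:\mathbb{R}^2\to\mathbb{R}^2$ be a lift of $f$. A set $E\subset\mathbb{R}^2$ is $F$-ordered if it is invariant by $F$ and by all translations $(\theta,r)\mapsto(\theta+k,r)$, $k\in\mathbb{Z}$, and if for all $x,x'\in E$, $\pi(x)<\pi(x')\Rightarrow\pi\circ F(x)<\pi\circ F(x')$. An Aubry-Mather set for $F$ is a (non-empty) closed $F$-ordered set $E$; its projection $p(E)\subset\mathbb{A}$ is also called an Aubry-Mather set, and here $\mathrm{supp}\,\mu\subset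 p(E)$. For such $E$ there is an increasing homeomorphism $H:\mathbb{R}\to\mathbb{R}$ with $H(t+1)=H(t)+1$ and $H\circ\pi=\pi\circ F$ on $E$; the rotation number of $E$ is $\rho(E)=\lim_{n\to\infty}\frac{H^n(t)-t}{n}$ (independent of $t$ and $H$). $E$ is irrational if $\rho(E)\notin\mathbb{Q}$. For $M\subset\mathbb{A}$ and $x\in M$, the paratangent cone $P_M(x)\subset T_x\mathbb{A}$ is the set of limits $v=\lim_{n\to\infty}\frac{x_n-y_n}{\tau_n}$ where $(x_n),(y_n)$ are sequences in $M$ converging to $x$, $(\tau_n)$ is a sequence of positive reals converging to $0$, and $x_n-y_n\in\mathbb{R}^2$ refers to the unique lift lying in $[-\frac12,\frac12[^2$ (for $n$ large). $M$ is $C^1$-regular at $x$ if there is a line $D\subset T_x\mathbb{A}$ with $P_M(x)\subset D$; otherwise $M$ is $C^1$-irregular at $x$. An ergodic measure is hyperbolic if it has two Lyapunov exponents $\lambda_1<0<\lambda_2$. *)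

(* Defs.v *)
From HB Require Import structures.
From mathcomp Require Import all_boot all_order all_algebra.
From mathcomp Require Import all_classical all_reals all_analysis.
Set Implicit Arguments.
Unset Strict Implicit.
Unset Printing Implicit Defensive.
Import Order.TTheory GRing.Theory Num.Theory.
Import numFieldNormedType.Exports.
Local Open Scope classical_set_scope.
Local Open Scope ring_scope.

(* The quotient group R/Z, with the quotient topology. *)
Definition circle (R : realType) : Type :=
  Quotient.quot (GRing.ZmodClosed.clone R Num.int_num_subdef _).
HB.instance Definition _ (R : realType) := GRing.Zmodule.on (circle R).
HB.instance Definition _ (R : realType) := EqQuotient.on (circle R).

Section CircleTopology.
Variable R : realType.
Local Open Scope quotient_scope.

Definition circle_open (U : set (circle R)) := open (\pi_(circle R) @^-1` U).

Fact circle_openT : circle_open setT.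
Proof. exact: openT. Qed.

Fact circle_openI (U V : set (circle R)) :
  circle_open U -> circle_open V -> circle_open (U `&` V).
Proof. exact: openI. Qed.

Fact circle_open_bigcup (I : Type) (U : I -> set (circle R)) :
  (forall i, circle_open (U i)) -> circle_open (\bigcup_i U i).
Proof. by move=> oU; apply: bigcup_open => i _; exact: oU. Qed.

(* The topology cannot be copied from quotient_topology: its choice structure
   is not the one underlying the group structure. *)
HB.instance Definition _ := isOpenTopological.Build (circle R)
  circle_openT circle_openI circle_open_bigcup.
HB.instance Definition _ := isPointed.Build (circle R) 0.

End CircleTopology.

Notation plane R := (R * R)%type.
Notation annulus R := (circle R * R)%type.
Notation borel_annulus R := (g_sigma_algebraType (@open (annulus R))).

Definition covering (R : realType) (x : plane R) : annulus R :=
  (\pi_(circle R)%qT x.1, x.2).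

Definition homeomorphism (T U : topologicalType) (h : T -> U) : Prop :=
  continuous h /\
  exists g : U -> T, [/\ continuous g, cancel h g & cancel g h].

Section TwistMaps.
Variable R : realType.
Implicit Types (f : annulus R -> annulus R) (F : plane R -> plane R).

Definition is_lift f F : Prop :=
  continuous F /\ forall x, covering (F x) = f (covering x).

Definition plane_C1 F : Prop :=
  (forall x, differentiable F x) /\ (forall v, continuous (fun x => 'd F x v)).

(* The covering is a local diffeomorphism with which T_a A is identified with
   R^2, so regularity and derivatives are read on lifts. *)
Definition annulus_C1 f : Prop := exists2 F, is_lift f F & plane_C1 F.

(* Two lifts of f differ by an integer translation of the first coordinate, so
   neither the lift nor the representative of a matters: see tangentE. *)
Definition tangent f (a : annulus R) : plane R -> plane R :=
  'd (get (is_lift f)) (repr a.1, a.2).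

Lemma covering_eqP (x y : plane R) :
  covering x = covering y <-> x.1 - y.1 \in Num.int /\ x.2 = y.2.
Proof.
have E : (x.1 - y.1 \in Num.int) = (x.1 == y.1 %[mod circle R])%qT.
  exact: (@Quotient.idealrBE R (GRing.ZmodClosed.clone R Num.int_num_subdef _)).
rewrite E; split; first by move=> [e ->]; rewrite /covering e.
by case=> /eqP e e2; rewrite /covering e e2.
Qed.

Lemma int_valued_cst (g : R -> R) : continuous g ->
  (forall t, g t \in Num.int) -> g 0 = g 1.
Proof.
move=> cg ig; apply/eqP; rewrite -subr_eq0; apply/negPn/negP => ne.
pose m := Num.min (g 0) (g 1).
have mint : m \in Num.int by rewrite /m minEle; case: ifP.
have dist : 1 <= `|g 0 - g 1|.
  have /intrP[k e] : g 0 - g 1 \in Num.int by rewrite rpredB.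
  move: ne; rewrite e intr_eq0 => k0; rewrite -intr_norm -[1]/(1%:~R) ler_int.
  by rewrite -gtz0_ge1 normr_gt0.
have : m <= m + 2^-1 <= Num.max (g 0) (g 1).
  rewrite lerDl invr_ge0 ler0n andTb.
  have : Num.max (g 0) (g 1) = m + `|g 0 - g 1|.
    rewrite /m; case: (leP (g 0) (g 1)) => h.
      by rewrite ler0_norm ?subr_le0 // opprB addrC subrK.
    by rewrite ger0_norm ?subr_ge0 ?ltW // addrC subrK.
  by move=> ->; rewrite lerD2l (le_trans _ dist) // invf_le1 ?ler1n ?ltr0n.
have cw : {within `[0, 1], continuous g} by exact: continuous_subspaceT.
move=> /(IVT ler01 cw) [c _ gc].
have : 2^-1 \in @Num.int R.
  have -> : 2^-1 = g c - m by rewrite gc addrC addKr.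
  exact: rpredB.
move=> /intrP [k e].
have : 0 < (k%:~R : R) < 1 by rewrite -e invr_gt0 ltr0n /= invf_lt1 ?ltr1n ?ltr0n.
by rewrite ltr0z -[1]/(1%:~R) ltr_int; case: k {e} => // -[].
Qed.

Lemma lift_uniq f F G : is_lift f F -> is_lift f G ->
  exists c : plane R, forall x, F x = G x + c.
Proof.
move=> [cF lF] [cG lG].
have int x : (F x).1 - (G x).1 \in Num.int /\ (F x).2 = (G x).2.
  by apply/covering_eqP; rewrite lF lG.
exists ((F 0).1 - (G 0).1, 0) => x.
pose g t := (F (t *: x)).1 - (G (t *: x)).1.
have cx : continuous (fun t : R => t *: x) by move=> t; apply: cvgZr_tmp; exact: cvg_id.
have cg : continuous g.
  move=> t; apply: cvgB.
    apply: continuous_comp; last exact: cvg_fst.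
    apply: (continuous_comp (cx t)); exact: cF.
  apply: continuous_comp; last exact: cvg_fst.
  apply: (continuous_comp (cx t)); exact: cG.
have := int_valued_cst cg (fun t => (int _).1).
rewrite /g scale0r scale1r => ->; move: (int x) => [_].
case: (F x) (G x) => [u v] [u' v'] /= ->.
by congr pair; rewrite /= ?addr0 // addrC subrK.
Qed.

Lemma tangentE f F (x : plane R) : is_lift f F -> differentiable F x ->
  tangent f (covering x) = 'd F x :> (_ -> _).
Proof.
move=> lF dF; rewrite /tangent; set G := get _; set y := (_, _).
have lG : is_lift f G by apply: (@getI _ (is_lift f)); exact: lF.
have cy : covering y = covering x.
  by rewrite /covering /y /= reprK.
pose F' z := F (z + (x - y)).
have lF' : is_lift f F'.
  split.
    have cs : continuous (fun z : plane R => z + (x - y)).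
      by move=> z; apply: cvgD; [exact: cvg_id | exact: cvg_cst].
    by move=> z; apply: (continuous_comp (cs z)); exact: lF.1.
  move=> z; rewrite lF.2; congr f; apply/covering_eqP.
  have /covering_eqP[i e] := cy.
  split; first by rewrite /= addrC addKr -opprB rpredN.
  have -> : (z + (x - y)).2 = z.2 + (x.2 - y.2) by [].
  by rewrite e subrr addr0.
have [c Gc] := lift_uniq lG lF'.
have -> : G = (F \o (id + cst (x - y))) + cst c by apply/funext => z; exact: Gc.
have d1 : is_diff y (id + cst (x - y)) (id + 0) := is_diffD (is_diff_id _) (is_diff_cst _ _).
have e1 : (id + cst (x - y)) y = x by rewrite !fctE addrC subrK.
have d2 : is_diff ((id + cst (x - y)) y) F ('d F x).
  by rewrite e1; apply: DiffDef.
have d3 := is_diffD (is_diff_comp d1 d2) (is_diff_cst c y).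
case: d3 => _ e.
apply: etrans; first exact: e.
apply/funext => v.
by transitivity ('d F x (v + 0) + 0); rewrite ?addr0.
Qed.

Definition inverse f : annulus R -> annulus R := pinv setT f.

Definition C1_diffeomorphism f : Prop :=
  [/\ bijective f, annulus_C1 f & annulus_C1 (inverse f)].

Definition isotopic_to_id f : Prop :=
  exists h : R * annulus R -> annulus R,
    [/\ {within `[0, 1]%classic `*` setT, continuous h},
        forall t, 0 <= t <= 1 -> homeomorphism (fun a => h (t, a)),
        forall a, h (0, a) = a &
        forall a, h (1, a) = f a].

Definition positive_twist f : Prop :=
  exists2 eps : R, 0 < eps &
    forall a, eps < (tangent f a (0, 1)).1 < eps^-1.

(* f^*lambda - lambda = dS, for lambda = r dtheta *)
Definition exact_symplectic f : Prop :=
  exists S : annulus R -> R, forall x,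
    differentiable (S \o @covering R) x /\
    forall v, 'd (S \o @covering R) x v =
      (f (covering x)).2 * (tangent f (covering x) v).1 - x.2 * v.1.

Definition conservative_twist_map f : Prop :=
  [/\ C1_diffeomorphism f, isotopic_to_id f, positive_twist f &
      exact_symplectic f].

Definition ordered_set F (E : set (plane R)) : Prop :=
  [/\ F @` E = E,
      forall (k : int) x, E x -> E (x.1 + k%:~R, x.2) &
      forall x y, E x -> E y -> x.1 < y.1 -> (F x).1 < (F y).1].

Definition aubry_mather F (E : set (plane R)) : Prop :=
  [/\ E !=set0, closed E & ordered_set F E].

Definition rotation_number F (E : set (plane R)) (rho : R) : Prop :=
  exists H : R -> R,
    [/\ homeomorphism H,
        {homo H : s t / s < t},
        forall t, H (t + 1) = H t + 1,
        forall x, E x -> H x.1 = (F x).1 &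
        forall t, (fun n : nat => (iter n H t - t) / n%:R) @ \oo --> rho].

Definition irrational_aubry_mather F (E : set (plane R)) : Prop :=
  aubry_mather F E /\ exists2 rho, rotation_number F E rho & irrational rho.

(* The condition that (d n) lifts x_n - y_n to [-1/2, 1/2[^2 can only be met
   for n large. *)
Definition paratangent_cone (M : set (annulus R)) (a : annulus R) :
    set (plane R) :=
  [set v | exists (x y : nat -> annulus R) (tau : nat -> R)
             (d : nat -> plane R),
    [/\ (forall n, M (x n)) /\ (forall n, M (y n)),
        (x @ \oo --> a) /\ (y @ \oo --> a),
        (forall n, 0 < tau n) /\ (tau @ \oo --> (0 : R)),
        \forall n \near \oo, [/\ covering (d n) = x n - y n,
          - 2^-1 <= (d n).1 < 2^-1 & - 2^-1 <= (d n).2 < 2^-1] &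
        (fun n => (tau n)^-1 *: d n) @ \oo --> v]].

Definition C1_regular_at (M : set (annulus R)) (a : annulus R) : Prop :=
  exists2 D : {vspace plane R}, \dim D = 1%N &
    forall v, paratangent_cone M a v -> v \in D.

Definition C1_irregular_at (M : set (annulus R)) (a : annulus R) : Prop :=
  ~ C1_regular_at M a.

Section Measures.
Variable mu : probability (borel_annulus R) R.

Definition invariant_measure f : Prop :=
  forall B : set (borel_annulus R), measurable B -> mu (f @^-1` B) = mu B.

Definition ergodic_measure f : Prop :=
  forall B : set (borel_annulus R), measurable B -> f @^-1` B = B ->
    mu B = 0%E \/ mu B = 1%E.

Definition measure_support : set (annulus R) :=
  [set a | forall U, open U -> U a -> (0 < mu U)%E].

Definition exponent_at f (a : annulus R) (v : plane R) (l : R) : Prop :=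
  (fun n : nat => n%:R^-1 * ln `|tangent (iter n f) a v|) @ \oo --> l.

(* s lists the distinct Lyapunov exponents of mu: at mu-almost every point the
   tangent plane is the direct sum of nonzero Oseledets spaces E_i, on which
   (1/n) log |Df^n v| tends to s_i as n tends to +oo and to -oo.
   The backward limit is written with the iterates of the inverse, whence the
   minus sign. *)
Definition lyapunov_exponents f (s : seq R) : Prop :=
  uniq s /\
  {ae mu, forall a, exists E : 'I_(size s) -> {vspace plane R},
    [/\ forall i, E i != 0%VS,
        (\sum_i E i)%VS = fullv,
        directv (\sum_i E i) &
        forall i v, v \in E i -> v != 0 ->
          exponent_at f a v s`_i /\ exponent_at (inverse f) a v (- s`_i)]}.

Definition zero_exponents f : Prop := lyapunov_exponents f [:: 0].

Definition hyperbolic_measure f : Prop :=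
  exists l1 l2 : R, [/\ l1 < 0, 0 < l2 & lyapunov_exponents f [:: l1; l2]].

End Measures.
End TwistMaps.

(* Main.v *)
(** Let M be the support of the measure and K its lift, on which the lift F of f is
    ordered. The positive twist of F and the negative twist of its inverse make K
    a Lipschitz graph, so that the paratangent cone of M at a point x is bounded by
    two slopes L(x) <= U(x), and M is C^1-regular at x if and only if L(x) = U(x).
    As F preserves order and area, its derivative maps the lines of slopes L and U
    at x to those at f(x). Let l and u be the integrals of the logarithms of the
    growth of F along these two line fields. By ergodicity, L = U almost everywhere
    or L < U almost everywhere.
    - If L < U almost everywhere, preservation of area makes the sum of the two
      growths a coboundary, so l + u = 0, and the twist condition gives l < u. Hence
      l < 0 < u are the Lyapunov exponents.
    - If L = U almost everywhere, then u = 0: if u were negative, the maximal ergodic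
      theorem would give a recurrent point with a neighborhood in K that the iterates
      of F contract, hence a periodic orbit of the circle map H induced by F, which
      has irrational rotation number; if u were positive, the same would hold for the
      inverse. As the derivatives of the iterates of F are triangular of determinant 1
      in the frame spanned by this line field and the vertical, all exponents vanish. *)

Require Import Defs.
From HB Require Import structures.
From mathcomp Require Import all_boot all_order all_algebra.
From mathcomp Require Import all_classical all_reals all_analysis.
From mathcomp Require Import measurable_realfun ring lra zify.
Set Implicit Arguments.
Unset Strict Implicit.
Unset Printing Implicit Defensive.
Import Order.TTheory GRing.Theory Num.Theory.
Import numFieldNormedType.Exports.
Local Open Scope classical_set_scope.
Local Open Scope ring_scope.

(** * Ergodic theorems for bounded functions *)

(** The slope fields are only measurable, so a negative integral of the logarithmic growth along
    them does not by itself contract neighborhoods of a uniform size. Contraction is therefore read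
    on difference quotients over pairs of points of K: the supremum [usup n] of their logarithms at
    scale 1/(n+1) controls one step of F within a fixed radius, its integral is shown to be
    nonnegative for every n, and n tends to infinity by dominated convergence. Where L = U, the
    limit is at most the logarithmic growth along the common line. The extreme slopes are encoded as
    upper limits of the same kind, which makes them measurable on the annulus. Estimates are stated
    for two systems, F and its inverse, with the same K and C; exchanging the two gives the backward
    statement. As the extreme slopes depend on K and C alone, both time directions share the line
    fields, and each vanishing integral is obtained from two opposite inequalities. *)

Section BoundedMeasurable.
Context d (T : measurableType d) (R : realType) (mu : probability T R).
Implicit Types (phi psi : T -> R).

Let mu_setT : (mu : {measure set T -> \bar R}) setT = 1%E.
Proof. exact: (probability_setT mu). Qed.

Definition bounded_measurable phi :=
  measurable_fun setT phi /\ exists C, forall x, `|phi x| <= C.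

Lemma bounded_measurable_integrable phi :
  bounded_measurable phi -> mu.-integrable setT (EFin \o phi).
Proof.
move=> [mphi [C hC]]; apply: measurable_bounded_integrable => //.
  by rewrite mu_setT ltry.
by exists C; split; [exact: num_real|move=> M CM x _; rewrite /= (le_trans (hC x)) ?ltW].
Qed.

Lemma bounded_measurable_cst c : bounded_measurable (fun=> c).
Proof. by split; [exact: measurable_cst|exists `|c|]. Qed.

Lemma bounded_measurableD phi psi : bounded_measurable phi ->
  bounded_measurable psi -> bounded_measurable (fun x => phi x + psi x).
Proof.
move=> [m1 [C1 h1]] [m2 [C2 h2]]; split; first exact: measurable_funD.
by exists (C1 + C2) => x; rewrite (le_trans (ler_normD _ _))// lerD.
Qed.

Lemma bounded_measurableN phi : bounded_measurable phi ->
  bounded_measurable (fun x => - phi x).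
Proof.
move=> [m1 [C1 h1]]; split; first exact: measurableT_comp.
by exists C1 => x; rewrite normrN.
Qed.

Lemma Rintegral_cst_probability (c : R) : \int[mu]_x c = c.
Proof. by rewrite Rintegral_cst// mu_setT/= mulr1. Qed.

Lemma Rintegral_dominated_cvg (h : nat -> T -> R) phi C :
  (forall n, measurable_fun setT (h n)) -> measurable_fun setT phi ->
  (forall n x, `|h n x| <= C) ->
  {ae mu, forall x, h ^~ x @ \oo --> phi x} ->
  (fun n => \int[mu]_x h n x) @ \oo --> \int[mu]_x phi x.
Proof.
move=> mh mphi hC hphi.
have /bounded_measurable_integrable iC := bounded_measurable_cst C.
have [] := @dominated_convergence _ T R mu setT measurableT
  (fun n => EFin \o h n) (EFin \o phi) (EFin \o (fun=> C)).
- by move=> n; exact/measurable_EFinP.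
- exact/measurable_EFinP.
- apply: filterS hphi => x hx _; apply: cvg_EFin hx.
  by near=> n.
- exact: iC.
- by apply: aeW => x n _; rewrite /= lee_fin.
move=> iphi _ cv; apply: fine_cvg; rewrite fineK//.
by have := integrable_fin_num measurableT iphi.
Unshelve. all: end_near. Qed.

End BoundedMeasurable.

Section BirkhoffSums.
Context (T : Type) (R : realType) (f : T -> T).
Implicit Types phi : T -> R.

Definition birkhoff_sum phi n x : R := \sum_(i < n) phi (iter i f x).

Lemma birkhoff_sumS phi n x :
  birkhoff_sum phi n.+1 x = phi x + birkhoff_sum phi n (f x).
Proof.
rewrite /birkhoff_sum big_ord_recl /=; congr (_ + _).
by apply: eq_bigr => i _; rewrite -iterS iterSr.
Qed.

Lemma birkhoff_sumSr phi n x :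
  birkhoff_sum phi n.+1 x = birkhoff_sum phi n x + phi (iter n f x).
Proof. by rewrite /birkhoff_sum big_ord_recr. Qed.

End BirkhoffSums.

Section ErgodicTheory.
Context d (T : measurableType d) (R : realType) (mu : probability T R).
Variable f : T -> T.
Hypothesis mf : measurable_fun setT f.
Hypothesis fmu : forall B, measurable B -> mu (f @^-1` B) = mu B.
Implicit Types (phi psi : T -> R).

Lemma measurable_iter n : measurable_fun setT (iter n f).
Proof.
elim: n => [|n ih]; first exact: measurable_id.
exact: (measurableT_comp mf ih).
Qed.

Lemma measurable_birkhoff_sum phi n : measurable_fun setT phi ->
  measurable_fun setT (birkhoff_sum f phi n).
Proof.
move=> mphi; apply: measurable_sum => i.
by apply: measurableT_comp => //; exact: measurable_iter.
Qed.

Lemma bounded_measurable_comp phi :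
  bounded_measurable phi -> bounded_measurable (phi \o f).
Proof.
move=> [m1 [C h]]; split; first exact: measurableT_comp.
by exists C => x; exact: h.
Qed.

Lemma Rintegral_invariant phi : bounded_measurable phi ->
  \int[mu]_x phi (f x) = \int[mu]_x phi x.
Proof.
move=> bphi; rewrite /Rintegral; congr fine.
have mphi : measurable_fun setT (EFin \o phi) by apply/measurable_EFinP; case: bphi.
have ibf : mu.-integrable (f @^-1` setT) ((EFin \o phi) \o f).
  exact: (bounded_measurable_integrable mu (bounded_measurable_comp bphi)).
rewrite -[LHS](integral_pushforward mf mphi ibf measurableT).
apply: eq_measure_integral => A mA _. 
exact: (fmu mA).
Qed.

(** If no point of A returned, the sets f^-i(A) would be pairwise disjoint and of the same positive
    measure, exceeding the total mass 1. *)
Lemma poincare_recurrence (A : set T) : measurable A -> (0 < mu A)%E ->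
  exists2 x, A x & exists2 m, (0 < m)%N & A (iter m f x).
Proof.
move=> mA A0; apply: contrapT => no.
pose B i := iter i f @^-1` A.
have mB i : measurable (B i) by rewrite -[B i]setTI; exact: measurable_iter.
have muB i : mu (B i) = mu A.
  elim: i => [//|i ih]; rewrite -ih -[RHS]fmu//; congr (mu _).
  by apply/seteqP; split => x; rewrite /B /= -iterS iterSr.
have tB : trivIset setT B.
  apply/trivIsetP => i j _ _; wlog ij : i j / (i < j)%N.
    move=> wl; rewrite neq_lt => /orP[] h; first by apply: wl => //; rewrite lt_eqF.
    by rewrite setIC; apply: wl => //; rewrite lt_eqF.
  move=> _; rewrite -subset0 => x [Bi Bj]; apply: no; exists (iter i f x) => //.
  by exists (j - i)%N; rewrite ?subn_gt0// -iterD subnK// ltnW.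
have le1 n : (\sum_(i < n) mu (B i) <= 1)%E.
  rewrite -measure_bigsetU//.
  by apply: probability_le1; exact: bigsetU_measurable.
have fA : mu A \is a fin_num by apply: fin_num_measure.
have := le1 (Num.bound (fine (mu A))^-1).
under eq_bigr do rewrite muB.
rewrite -(fineK fA) sumEFin sumr_const card_ord lee_fin leNgt => /negP; apply.
have p : 0 < fine (mu A) by rewrite fine_gt0// A0 ltey_eq fA.
rewrite -mulr_natl -ltr_pdivrMr// div1r.
by apply: archi_boundP; rewrite invr_ge0 ltW.
Qed.

(** This is the maximum of the Birkhoff sums of lengths 0 to n. The recursion through [f x] makes
    its comparison with its composite with f immediate. *)
Fixpoint max_birkhoff_sum phi n x : R :=
  if n is m.+1 then Num.max 0 (phi x + max_birkhoff_sum phi m (f x)) else 0.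

Lemma max_birkhoff_sum_ge0 phi n x : 0 <= max_birkhoff_sum phi n x.
Proof. by case: n => //= n; rewrite le_max lexx. Qed.

Lemma max_birkhoff_sum_nd phi n x :
  max_birkhoff_sum phi n x <= max_birkhoff_sum phi n.+1 x.
Proof.
elim: n x => [|n ih] x; first exact: max_birkhoff_sum_ge0.
rewrite [X in X <= _]/= [X in _ <= X]/= ge_max; apply/andP; split.
  by rewrite le_max lexx.
by rewrite le_max; apply/orP; right; rewrite lerD2l; exact: ih.
Qed.

Lemma birkhoff_sum_le_max phi n x :
  birkhoff_sum f phi n x <= max_birkhoff_sum phi n x.
Proof.
elim: n x => [|n ih] x; first by rewrite /birkhoff_sum big_ord0.
by rewrite birkhoff_sumS /= le_max lerD2l ih orbT.
Qed.

Lemma bounded_measurable_max_birkhoff_sum phi n :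
  bounded_measurable phi -> bounded_measurable (max_birkhoff_sum phi n).
Proof.
move=> bphi; elim: n => [|n ih]; first exact: bounded_measurable_cst.
have [m [C hC]] := bounded_measurableD bphi (bounded_measurable_comp ih).
split; first by apply: measurable_maxr => //; exact: measurable_cst.
exists C => x /=; rewrite ger0_norm ?le_max ?lexx// ge_max.
have := hC x; rewrite ler_norml => /andP[_ ->]; rewrite andbT.
exact: le_trans (hC x).
Qed.

(* Garsia's proof: with M_n the maximum of the first n Birkhoff sums and 0,
   phi 1_{M_n > 0} >= M_n - M_n o f, whose integral vanishes. *)
Lemma maximal_ergodic phi : bounded_measurable phi -> \int[mu]_x phi x < 0 ->
  (0 < mu [set x | forall n, (birkhoff_sum f phi n x <= 0)%R])%E.
Proof.
move=> bphi; have [mphi [C hC]] := bphi; apply: contraPT; rewrite -leNgt => A0.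
apply/negP; rewrite -leNgt.
pose A := [set x | forall n, birkhoff_sum f phi n x <= 0].
have mA : measurable A.
  rewrite [A](_ : _ = \bigcap_n (birkhoff_sum f phi n @^-1` `]-oo, 0])).
    apply: bigcapT_measurable => n.
    by rewrite -[X in measurable X]setTI; exact: measurable_birkhoff_sum.
  apply/seteqP; split => x /= h n; first by move=> _; rewrite /= in_itv/=.
  by have := h n I; rewrite /= in_itv.
have muA : mu A = 0%E by apply/eqP; rewrite -measure_le0.
pose M := max_birkhoff_sum phi.
have bM n : bounded_measurable (M n) by exact: bounded_measurable_max_birkhoff_sum.
pose E n := [set x | 0 < M n x].
have mE n : measurable (E n).
  rewrite [E n](_ : _ = setT `&` M n @^-1` `]0, +oo[).
    by have [h _] := bM n; exact: h.
  by rewrite setTI; apply/seteqP; split => x; rewrite /E /= in_itv/= andbT.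
pose h n x := phi x * \1_(E n) x.
have mh n : measurable_fun setT (h n).
  by apply: measurable_funM => //; exact: measurable_indic.
have hh n x : `|h n x| <= C.
  rewrite /h indicE; case: (_ \in _); rewrite ?mulr1// mulr0 normr0.
  exact: le_trans (hC x).
have h0 n : 0 <= \int[mu]_x h n x.
  have bh : bounded_measurable (h n) by split; [exact: mh|exists C].
  have bMf := bounded_measurable_comp (bM n).
  have -> : 0 = \int[mu]_x (M n x - M n (f x)).
    rewrite RintegralB ?(Rintegral_invariant (bM n)) ?subrr//.
    - exact: bounded_measurable_integrable.
    - exact: (bounded_measurable_integrable mu bMf).
  apply: le_Rintegral => //.
  - apply: (bounded_measurable_integrable mu (bounded_measurableD (bM n)
      (bounded_measurableN bMf))).
  - exact: bounded_measurable_integrable.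
  move=> x _; rewrite /h indicE.
  have [xE|xE] := boolP (x \in E n); last first.
    rewrite mulr0 subr_le0; apply: (@le_trans _ _ 0).
      by rewrite leNgt; apply/negP => p; move/negP: xE; apply; rewrite inE.
    exact: max_birkhoff_sum_ge0.
  rewrite mulr1; move: xE; rewrite inE /E /=.
  case: n {h mh hh bh bMf} => [|n]; first by rewrite /M /= ltxx.
  rewrite {1}/M /= => p.
  have e : M n.+1 x = phi x + M n (f x).
    by rewrite /M /=; move: p; rewrite lt_max ltxx /= => p; apply/max_idPr/ltW.
  by rewrite e lerBlDr lerD2l /M max_birkhoff_sum_nd.
(* As A is null, almost every x has some positive Birkhoff sum, hence lies in [E n] for all large n,
   where [h n x] is [phi x]. *)
have cv : (fun n => \int[mu]_x h n x) @ \oo --> \int[mu]_x phi x.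
  apply: (@Rintegral_dominated_cvg _ _ _ mu h phi C) => //.
  exists A; split => //; apply/subsetCP => x xA.
  have [n hn] : exists n, 0 < M n x.
    apply: contrapT => no; apply: xA => n.
    rewrite (le_trans (birkhoff_sum_le_max _ _ _))// leNgt; apply/negP => p.
    by apply: no; exists n.
  rewrite /setC/= => -[]; apply: cvg_near_cst; exists n => // m /= nm.
  rewrite /h indicE; suff : x \in E m by move=> ->; rewrite mulr1.
  rewrite inE /E /=; apply: lt_le_trans hn _.
  elim: m nm => [|m ih]; first by rewrite leqn0 => /eqP ->.
  rewrite leq_eqVlt => /predU1P[<-//|nm].
  exact: le_trans (ih nm) (max_birkhoff_sum_nd _ _ _).
rewrite -(cvg_lim _ cv)//; apply: limr_ge; first exact: cvgP cv.
by apply: nearW.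
Qed.

Hypothesis ergf : forall B, measurable B -> f @^-1` B = B -> mu B = 0%E \/ mu B = 1%E.

(** Subtracting J + e from phi makes the integral negative; the maximal theorem then gives a set of
    positive measure on which the sums of psi are bounded above, and ergodicity makes such a bound
    hold almost everywhere. *)
Lemma birkhoff_upper phi : bounded_measurable phi -> forall e, 0 < e ->
  {ae mu, forall x, exists C, forall n,
    birkhoff_sum f phi n x <= n%:R * (\int[mu]_x phi x + e) + C}.
Proof.
move=> bphi e e0; set J := \int[mu]_x phi x.
pose psi x := phi x + - (J + e).
have bpsi : bounded_measurable psi.
  by apply: bounded_measurableD => //; exact: bounded_measurable_cst.
have sumE n x : birkhoff_sum f psi n x = birkhoff_sum f phi n x - n%:R * (J + e).
  rewrite /birkhoff_sum big_split /=; congr (_ + _).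
  by rewrite sumr_const card_ord mulNrn -[(J + e) *+ n]mulr_natl.
have ipsi : \int[mu]_x psi x < 0.
  rewrite RintegralD//; last 2 first.
  - exact: bounded_measurable_integrable.
  - exact: (bounded_measurable_integrable mu (bounded_measurable_cst T (- (J + e)))).
  by rewrite Rintegral_cst_probability -/J opprD addrA subrr add0r oppr_lt0.
have A0 := maximal_ergodic bpsi ipsi.
(* Unlike the set given by the maximal theorem, B is invariant: passing from x to f x changes the
   sums by the fixed amount [psi x]. Natural bounds make it a countable union. *)
pose B := [set x | exists k : nat, forall n, birkhoff_sum f psi n x <= k%:R].
have mB : measurable B.
  rewrite [B](_ : _ = \bigcup_k \bigcap_n (birkhoff_sum f psi n @^-1` `]-oo, k%:R])).
    apply: bigcupT_measurable => k; apply: bigcapT_measurable => n.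
    rewrite -[X in measurable X]setTI; apply: measurable_birkhoff_sum => //.
    by case: bpsi.
  apply/seteqP; split => x /=.
    by move=> [k h]; exists k => // n _ /=; rewrite in_itv /=.
  by move=> [k _ h]; exists k => n; have := h n I; rewrite /= in_itv.
have up (y : R) : exists k : nat, y <= k%:R.
  by exists (Num.bound `|y|); exact: le_trans (ler_norm _) (ltW (archi_boundP (normr_ge0 y))).
have fB : f @^-1` B = B.
  apply/seteqP; split => x [k h].
    have [k' h'] := up (`|psi x| + k%:R); exists k' => -[|n].
      by rewrite /birkhoff_sum big_ord0.
    by rewrite birkhoff_sumS (le_trans _ h')// lerD// ler_norm.
  have [k' h'] := up (k%:R + `|psi x|); exists k' => n.
  have := h n.+1; rewrite birkhoff_sumS => hn.
  rewrite (le_trans _ h')//; have := ler_norm (- psi x); rewrite normrN; lra.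
have muB : mu B = 1%E.
  have [B0|//] := ergf mB fB; suff : (0 < mu B)%E by rewrite B0 ltxx.
  apply: lt_le_trans A0 _; apply: le_measure; rewrite ?inE//.
    rewrite [X in measurable X](_ : _ = \bigcap_n (birkhoff_sum f psi n @^-1` `]-oo, 0])).
      apply: bigcapT_measurable => n.
      rewrite -[X in measurable X]setTI; apply: measurable_birkhoff_sum => //.
      by case: bpsi.
    apply/seteqP; split => x /= h n; first by move=> _; rewrite /= in_itv/=.
    by have := h n I; rewrite /= in_itv.
  by move=> x h; exists 0%N.
exists (~` B); split; first exact: measurableC.
  by rewrite probability_setC// muB subee.
apply: subsetC => x [k h]; exists k%:R => n.
by have := h n; rewrite sumE lerBlDl.
Qed.

(** The upper bound is applied to phi and to its opposite, with the countably many tolerances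
    1/(k+1). *)
Theorem birkhoff phi : bounded_measurable phi ->
  {ae mu, forall x, (fun n => n%:R^-1 * birkhoff_sum f phi n x) @ \oo
    --> \int[mu]_x phi x}.
Proof.
move=> bphi; set J := \int[mu]_x phi x.
have bN := bounded_measurableN bphi.
have JN : \int[mu]_x (- phi x) = - J.
  have := @RintegralZl _ T R mu setT phi (-1) measurableT
    (bounded_measurable_integrable mu bphi).
  by rewrite mulN1r => <-; apply: eq_Rintegral => x _; rewrite mulN1r.
have sumN n x : birkhoff_sum f (fun x => - phi x) n x = - birkhoff_sum f phi n x.
  by rewrite /birkhoff_sum sumrN.
have H k : {ae mu, forall x, exists C, forall n,
    `|birkhoff_sum f phi n x - n%:R * J| <= n%:R * k.+1%:R^-1 + C}.
  have e0 : 0 < k.+1%:R^-1 :> R by rewrite invr_gt0.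
  have h1 := birkhoff_upper bphi e0.
  have h2 := birkhoff_upper bN e0.
  move: h1 h2; apply: filterS2 => x [C1 h1] [C2 h2].
  exists (`|C1| + `|C2|) => n; have := h1 n; have := h2 n.
  rewrite JN sumN -/J ler_norml !mulrDr mulrN; move: (n%:R * J) (n%:R * _) => u v a b.
  have := ler_norm C1; have := ler_norm C2.
  by have := normr_ge0 C1; have := normr_ge0 C2 => *; apply/andP; split; lra.
have := ae_foralln H; apply: filterS => x hx.
apply/cvgrPdist_le => e e0.
have [k hk] : exists k, k.+1%:R^-1 <= e / 2.
  exists (Num.bound (e / 2)^-1).
  rewrite invf_ple ?posrE ?divr_gt0//.
  apply: le_trans (ltW (archi_boundP _)) _; first by rewrite invr_ge0 divr_ge0// ltW.
  by rewrite ler_nat.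
have [C hC] := hx k.
exists (Num.bound (`|C| * (e / 2)^-1)).+1 => // n /= hn.
have n0 : 0 < n%:R :> R by rewrite ltr0n (leq_trans _ hn).
have := hC n; set s := birkhoff_sum f phi n x.
have -> : J - n%:R^-1 * s = - (n%:R^-1 * (s - n%:R * J)).
  by field; rewrite gt_eqF.
rewrite normrN normrM ger0_norm ?invr_ge0 ?(ltW n0)// => h.
rewrite ler_pdivrMl//; apply: le_trans h _.
have : `|C| <= n%:R * (e / 2).
  rewrite -ler_pdivrMr ?divr_gt0//.
  apply: le_trans (ltW (archi_boundP _)) _; first by rewrite mulr_ge0// invr_ge0 divr_ge0// ltW.
  by rewrite ler_nat ltnW.
have : n%:R * k.+1%:R^-1 <= n%:R * (e / 2) by rewrite ler_pM2l.
have := ler_norm C; move: (_ * k.+1%:R^-1) => u; rewrite mulrA; lra.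
Qed.

End ErgodicTheory.

(** * The covering of the annulus *)

Section CoveringTopology.
Variable R : realType.
Implicit Types (x y z : plane R) (a : annulus R) (k : int).

Definition box x (e : R) : set (plane R) :=
  [set y | `|y.1 - x.1| < e /\ `|y.2 - x.2| < e].

Definition deck k x : plane R := (x.1 + k%:~R, x.2).

Lemma covering_deck k x : covering (deck k x) = covering x.
Proof.
by apply/covering_eqP; split => //=; rewrite addrAC subrr add0r rpred_int_num.
Qed.

Lemma covering_eq_deck x y : covering x = covering y ->
  exists k, x = deck k y.
Proof.
move=> /covering_eqP[/intrP[k e1] e2]; exists k.
by case: x y e1 e2 => [x1 x2] [y1 y2] /= e1 ->; rewrite /deck /= -e1 addrC subrK.
Qed.

Lemma covering_surj a : exists x, covering x = a.
Proof. by exists (repr a.1, a.2); rewrite /covering /= reprK; case: a. Qed.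

Lemma coveringD x y : covering (x + y) = covering x + covering y.
Proof. by rewrite /covering /= Quotient.pi_add. Qed.

Lemma coveringB x y : covering (x - y) = covering x - covering y.
Proof. by apply/eqP; rewrite eq_sym subr_eq -coveringD subrK. Qed.

Lemma nbhs_box x (P : set (plane R)) :
  nbhs x P <-> exists2 e, 0 < e & box x e `<=` P.
Proof.
rewrite nbhs_ballP; split => -[e e0 h]; exists e => // y.
  by move=> [y1 y2]; apply: h; split; rewrite /ball/= distrC.
by move=> [y1 y2]; apply: h; split; rewrite distrC.
Qed.

Lemma box_center x e : 0 < e -> box x e x.
Proof. by move=> e0; split; rewrite subrr normr0. Qed.

Lemma open_box x e : open (box x e).
Proof.
rewrite openE => y [y1 y2]; apply/nbhs_box.
have h1 : 0 < e - `|y.1 - x.1| by rewrite subr_gt0.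
have h2 : 0 < e - `|y.2 - x.2| by rewrite subr_gt0.
exists (Num.min (e - `|y.1 - x.1|) (e - `|y.2 - x.2|)).
  by rewrite lt_min h1 h2.
move=> z [/=]; rewrite !lt_min => /andP[z1 _] /andP[_ z2]; split.
  have -> : z.1 - x.1 = (z.1 - y.1) + (y.1 - x.1) by ring.
  by rewrite (le_lt_trans (ler_normD _ _))// -ltrBrDr.
have -> : z.2 - x.2 = (z.2 - y.2) + (y.2 - x.2) by ring.
by rewrite (le_lt_trans (ler_normD _ _))// -ltrBrDr.
Qed.

Lemma box_sub x e e' : e <= e' -> box x e `<=` box x e'.
Proof. by move=> h y [y1 y2]; split; apply: lt_le_trans h. Qed.

Lemma covering_continuous : continuous (@covering R).
Proof.
move=> x.
apply: (@cvg_pair _ (circle R) R (nbhs x) (nbhs (\pi_(circle R)%qT x.1)) (nbhs x.2)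
  _ _ _ (fun y => \pi_(circle R)%qT y.1) snd); last exact: cvg_snd.
apply: (@continuous_comp _ _ _ (@fst R R) (\pi_(circle R)%qT) x); first exact: cvg_fst.
have /(_ x.1) : continuous (\pi_(circle R)%qT : R -> circle R) by apply/continuousP.
exact.
Qed.

(** The image of an interval in R/Z is open because its preimage is the union of its integer
    translates. *)
Lemma open_covering (U : set (plane R)) : open U -> open (@covering R @` U).
Proof.
move=> oU; rewrite openE => a [x Ux <-].
have /nbhs_box[e e0 h] : nbhs x U by rewrite openE in oU; exact: oU.
pose V : set (circle R) := \pi_(circle R)%qT @` [set t | `|t - x.1| < e].
have oV : open V.
  rewrite /open/= /circle_open openE => t [s hs st].
  have [k tE] : exists k : int, t = s + k%:~R.
    have [|k /(congr1 fst) /= e1] := @covering_eq_deck (t, 0) (s, 0); last by exists k.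
    by rewrite /covering /= st.
  apply/nbhs_ballP; exists (e - `|s - x.1|); first by rewrite /= subr_gt0.
  move=> u /=; rewrite /ball/= => hu; exists (u - k%:~R).
    rewrite /=.
    have -> : u - k%:~R - x.1 = - (t - u) + (s - x.1) by rewrite tE; ring.
    by rewrite (le_lt_trans (ler_normD _ _))// normrN -ltrBrDr.
  have := covering_deck (-k) (u, 0); rewrite /covering /deck /= => -[].
  by rewrite intrN.
exists (V, [set t | `|t - x.2| < e]).
  split => /=.
    rewrite openE in oV; apply: oV; exists x.1 => //.
    by rewrite /= subrr normr0.
  apply/nbhs_ballP; exists e => // t; rewrite /ball/=.
  by rewrite distrC.
move=> [c t] [/= [s hs <-] ht]; exists (s, t) => //.
by apply: h.
Qed.

Lemma open_annulusP (W : set (annulus R)) :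
  open W <-> open (@covering R @^-1` W).
Proof.
split; first by move: W; apply/continuousP; exact: covering_continuous.
move=> /open_covering; congr open.
apply/seteqP; split; first by move=> _ [x h <-].
by move=> a Wa; have [x xa] := covering_surj a; exists x => //; rewrite /preimage/= xa.
Qed.

Lemma continuous_annulusP (f : annulus R -> annulus R) (F : plane R -> plane R) :
  is_lift f F -> continuous f.
Proof.
move=> [cF lF]; apply/continuousP => A oA; apply/open_annulusP.
rewrite [X in open X](_ : _ = F @^-1` (@covering R @^-1` A)); last first.
  by apply/seteqP; split => x; rewrite /preimage/= lF.
move: cF => /continuousP; apply.
exact/open_annulusP.
Qed.

(** Openness of the covering provides lifts close to x, but they depend on the tolerance.
    Normalizing the lift of [u n] to lie in [-1/2, 1/2[ horizontally from x lets one sequence serve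
    every tolerance, since two lifts at horizontal distance below 1 coincide. *)
Lemma cvg_lift (u : nat -> annulus R) x : u @ \oo --> covering x ->
  exists z : nat -> plane R, (forall n, covering (z n) = u n) /\
   forall e, 0 < e -> \forall n \near \oo, box x e (z n).
Proof.
move=> ux.
have near_lift e : 0 < e -> \forall n \near \oo, exists2 w, covering w = u n & box x e w.
  move=> e0; have : nbhs (covering x) (@covering R @` box x e).
    apply: open_nbhs_nbhs; split; first exact/open_covering/open_box.
    by exists x => //; exact: box_center.
  by move=> /ux [N _ hN]; exists N => // n /hN [w bw wu]; exists w.
have /choice[z hz] : forall n, exists w, covering w = u n /\ - 2^-1 <= w.1 - x.1 < 2^-1.
  move=> n; have [w wu] := covering_surj (u n).
  pose k := Num.floor (w.1 - x.1 + 2^-1).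
  exists (deck (- k) w); rewrite covering_deck; split => //=.
  have /andP[h1 h2] := floor_itv (w.1 - x.1 + 2^-1).
  move: h1 h2; rewrite -/k intrD intrN; move: (k%:~R : R) => q; lra.
exists z; split=> [n|e e0]; first by case: (hz n).
pose e' := Num.min e 2^-1.
have e'0 : 0 < e' by rewrite lt_min e0 invr_gt0 ltr0n.
apply: filterS (near_lift _ e'0) => n [w wu bw].
have [zu zx] := hz n.
suff -> : z n = w by apply: box_sub bw; rewrite ge_min lexx.
have [k zk] : exists k, z n = deck k w by apply: covering_eq_deck; rewrite zu.
have : `|k%:~R : R| < 1.
  move: bw zx; rewrite zk /box/= !lt_min !ltr_norml => -[/andP[_ /andP[a b]] _] /andP[c d].
  apply/andP; split; lra.
rewrite -intr_norm -[X in _ < X]/(1%:~R) ltr_int => k1.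
have k0 : k = 0 by lia.
by rewrite zk k0 /deck addr0; case: w {wu bw zk}.
Qed.

End CoveringTopology.

(** * Calculus on the plane *)

Section PlaneCalculus.
Variable R : realType.
Implicit Types (g : plane R -> R) (F : plane R -> plane R) (x y z v : plane R).

Lemma is_derive_line g dg y v (t : R) : is_diff (y + t *: v) g dg ->
  is_derive t 1 (fun t => g (y + t *: v)) (dg v).
Proof.
move=> dg'.
have dl : is_diff t (fun s : R => y + s *: v) (fun s : R => 0 + s *: v).
  exact: (is_diffD (is_diff_cst y t) (is_diff_scalel t v)).
have dc := is_diff_comp dl dg'.
apply: DeriveDef; first by apply/derivable1_diffP; exact: ex_diff.
rewrite deriveE; last exact: ex_diff.
by rewrite (diff_val (df := dg \o (fun s : R => 0 + s *: v)))/= scale1r add0r.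
Qed.

Lemma mvt_line g dg y v : (forall x, is_diff x g (dg x)) ->
  exists2 c : R, 0 <= c <= 1 & g (y + v) - g y = dg (y + c *: v) v.
Proof.
move=> gdg; have dd (t : R) := is_derive_line (gdg (y + t *: v)).
have cont : continuous (fun t : R => g (y + t *: v)).
  by move=> t; apply/differentiable_continuous/derivable1_diffP; have [] := dd t.
have [c] := @MVT_segment R _ _ 0 1 ler01 (fun t _ => dd t) (continuous_subspaceT cont).
rewrite in_itv /= => hc; rewrite scale1r scale0r addr0 subr0 mulr1 => e.
by exists c.
Qed.

(** The mean value theorem is applied to the difference of the two restrictions, so that the same c
    serves both lines; this is what a second difference requires. *)
Lemma mvt_line2 g dg y z v : (forall x, is_diff x g (dg x)) ->
  exists2 c : R, 0 <= c <= 1 & (g (y + v) - g (z + v)) - (g y - g z) =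
    dg (y + c *: v) v - dg (z + c *: v) v.
Proof.
move=> gdg.
have dd (t : R) : is_derive t 1 (fun t : R => g (y + t *: v) - g (z + t *: v))
    (dg (y + t *: v) v - dg (z + t *: v) v).
  exact: (is_deriveB (is_derive_line (gdg _)) (is_derive_line (gdg _))).
have cont : continuous (fun t : R => g (y + t *: v) - g (z + t *: v)).
  by move=> t; apply/differentiable_continuous/derivable1_diffP; have [] := dd t.
have [c] := @MVT_segment R _ _ 0 1 ler01 (fun t _ => dd t) (continuous_subspaceT cont).
rewrite in_itv /= => hc; rewrite !scale1r !scale0r !addr0 subr0 mulr1 => e.
by exists c.
Qed.

Lemma diff_coord g x v :
  'd g x v = v.1 * 'd g x (1, 0) + v.2 * 'd g x (0, 1).
Proof.
have {1}-> : v = v.1 *: ((1, 0) : plane R) + v.2 *: ((0, 1) : plane R).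
  case: v => a b; congr pair => /=; rewrite scaler0 ?addr0 ?add0r; exact/esym/mulr1.
by rewrite linearD !linearZ.
Qed.

Definition partials g (gx gy : plane R -> R) :=
  [/\ forall x, differentiable g x, continuous gx, continuous gy &
      forall x v, 'd g x v = v.1 * gx x + v.2 * gy x].

(** The path goes horizontally, then vertically, so each partial derivative occurs on one leg only;
    the twist condition, which concerns the vertical derivative alone, can then be used on its
    own. *)
Lemma mvt_legs g gx gy y z : partials g gx gy ->
  exists c c' : R, [/\ 0 <= c <= 1, 0 <= c' <= 1 &
    g z - g y = (z.1 - y.1) * gx (y.1 + c * (z.1 - y.1), y.2)
              + (z.2 - y.2) * gy (z.1, y.2 + c' * (z.2 - y.2))].
Proof.
move=> [dg _ _ gE].
have gd x : is_diff x g (fun v => v.1 * gx x + v.2 * gy x).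
  by apply: DiffDef => //; apply/funext => v; exact: gE.
have [c hc e1] := mvt_line y (z.1 - y.1, 0) gd.
have [c' hc' e2] := mvt_line (z.1, y.2) (0, z.2 - y.2) gd.
exists c, c'; split => //.
have s1 : y + (z.1 - y.1, 0) = (z.1, y.2).
  by congr pair => /=; rewrite ?addr0// addrC subrK.
have s2 : (z.1, y.2) + (0, z.2 - y.2) = z :> plane R.
  by rewrite [RHS]surjective_pairing; congr pair => /=; rewrite ?addr0// addrC subrK.
rewrite s1 /= mul0r addr0 in e1.
rewrite s2 /= mul0r add0r in e2.
have sc (k : R) v : k *: v = (k * v.1, k * v.2) by [].
have p1 : y + c *: ((z.1 - y.1, 0) : plane R) = (y.1 + c * (z.1 - y.1), y.2).
  by rewrite sc; congr pair; rewrite /= mulr0 addr0.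
have p2 : (z.1, y.2) + c' *: ((0, z.2 - y.2) : plane R) = (z.1, y.2 + c' * (z.2 - y.2)).
  by rewrite sc; congr pair; rewrite /= mulr0 addr0.
rewrite p1 in e1; rewrite p2 in e2.
by rewrite -e1 -e2 [RHS]addrC addrA subrK.
Qed.

Lemma segment_lt (a b c e : R) : `|a| < e -> `|b| < e -> 0 <= c <= 1 ->
  `|a + c * (b - a)| < e.
Proof.
move=> ha hb /andP[c0 c1].
have -> : a + c * (b - a) = (1 - c) * a + c * b by ring.
apply: le_lt_trans (ler_normD _ _) _; rewrite !normrM (ger0_norm c0) ger0_norm ?subr_ge0//.
have [->|cn] := eqVneq c 0; first by rewrite subr0 mul1r mul0r addr0.
have cp : 0 < c by rewrite lt_neqAle eq_sym cn.
have h1 : (1 - c) * `|a| <= (1 - c) * e by rewrite ler_wpM2l ?subr_ge0// ltW.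
have h2 : c * `|b| < c * e by rewrite ltr_pM2l.
lra.
Qed.

Lemma continuous_box g x (e : R) : continuous g -> 0 < e ->
  exists2 d, 0 < d & forall y, box x d y -> `|g y - g x| < e.
Proof.
move=> cg e0; have /cvgrPdist_lt/(_ e e0)/nbhs_box[d d0 hd] := cg x.
by exists d => // y hy; rewrite (distrC (g y)); exact: hd.
Qed.

(** Strict differentiability: both points may move near x and the error is relative to their mutual
    distance, as the pairs of the paratangent cone demand. It follows from continuity of the partial
    derivatives. *)
Lemma strict_diff g gx gy x (e : R) : partials g gx gy -> 0 < e ->
  exists2 d, 0 < d & forall y z, box x d y -> box x d z ->
  `|g z - g y - ((z.1 - y.1) * gx x + (z.2 - y.2) * gy x)|
    <= e * (`|z.1 - y.1| + `|z.2 - y.2|).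
Proof.
move=> pg e0; have [dg cx cy gE] := pg.
have [d1 d10 h1] := continuous_box x cx e0.
have [d2 d20 h2] := continuous_box x cy e0.
exists (Num.min d1 d2); first by rewrite lt_min d10.
move=> y z; rewrite /box /= !lt_min.
move=> [/andP[y11 y12] /andP[y21 y22]] [/andP[z11 z12] /andP[z21 z22]].
have [c [c' [hc hc' ->]]] := mvt_legs y z pg.
set p := (_, y.2); set q := (z.1, _).
have b1 : `|gx p - gx x| < e.
  apply: h1; split => //=.
  have -> : y.1 + c * (z.1 - y.1) - x.1 = (y.1 - x.1) + c * ((z.1 - x.1) - (y.1 - x.1)) by ring.
  exact: segment_lt.
have b2 : `|gy q - gy x| < e.
  apply: h2; split => //=.
  have -> : y.2 + c' * (z.2 - y.2) - x.2 = (y.2 - x.2) + c' * ((z.2 - x.2) - (y.2 - x.2)) by ring.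
  exact: segment_lt.
move: b1 b2; move: (gx p) (gy q) (gx x) (gy x) => P Q X Y b1 b2.
have -> : (z.1 - y.1) * P + (z.2 - y.2) * Q - ((z.1 - y.1) * X + (z.2 - y.2) * Y) =
  (z.1 - y.1) * (P - X) + (z.2 - y.2) * (Q - Y) by ring.
apply: le_trans (ler_normD _ _) _; rewrite !normrM mulrDr.
by rewrite lerD// mulrC ler_wpM2r// ltW.
Qed.

Lemma is_diff_fst x : is_diff x (@fst R R) fst.
Proof.
have lin : linear (@fst R R) by [].
pose fM := GRing.isLinear.Build _ _ _ _ _ lin.
pose f : {linear _ -> _} := HB.pack (@fst R R) fM.
rewrite -[fst]/(f : _ -> _).
have cf : continuous f by move=> y; exact: cvg_fst.
by apply: DiffDef; [exact: linear_differentiable|rewrite diff_lin].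
Qed.

Lemma is_diff_snd x : is_diff x (@snd R R) snd.
Proof.
have lin : linear (@snd R R) by [].
pose fM := GRing.isLinear.Build _ _ _ _ _ lin.
pose f : {linear _ -> _} := HB.pack (@snd R R) fM.
rewrite -[snd]/(f : _ -> _).
have cf : continuous f by move=> y; exact: cvg_snd.
by apply: DiffDef; [exact: linear_differentiable|rewrite diff_lin].
Qed.

Lemma differentiable_fst F x : differentiable F x -> differentiable (fst \o F) x.
Proof. by move=> dF; apply: differentiable_comp => //; have [] := is_diff_fst (F x). Qed.

Lemma differentiable_snd F x : differentiable F x -> differentiable (snd \o F) x.
Proof. by move=> dF; apply: differentiable_comp => //; have [] := is_diff_snd (F x). Qed.

Lemma diff_fst F x v : differentiable F x -> 'd (fst \o F) x v = ('d F x v).1.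
Proof.
by move=> dF; have [d1 e1] := is_diff_fst (F x); rewrite diff_comp//= e1.
Qed.

Lemma diff_snd F x v : differentiable F x -> 'd (snd \o F) x v = ('d F x v).2.
Proof.
by move=> dF; have [d1 e1] := is_diff_snd (F x); rewrite diff_comp//= e1.
Qed.

Definition jacobian_entries F (a b c d : plane R -> R) :=
  [/\ forall x, differentiable F x, partials (fst \o F) a b &
      partials (snd \o F) c d].

Lemma jacobian_diff F a b c d : jacobian_entries F a b c d ->
  forall x v, 'd F x v = (v.1 * a x + v.2 * b x, v.1 * c x + v.2 * d x).
Proof.
move=> [dF [_ _ _ e1] [_ _ _ e2]] x v.
by rewrite [LHS]surjective_pairing -diff_fst// -diff_snd// e1 e2.
Qed.

Lemma jacobian_is_diff F a b c d : jacobian_entries F a b c d -> forall x,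
  is_diff x F (fun v => (v.1 * a x + v.2 * b x, v.1 * c x + v.2 * d x)).
Proof.
move=> J x; apply: DiffDef; first by case: J.
by apply/funext => v; exact: jacobian_diff.
Qed.

Lemma plane_C1_jacobian F : plane_C1 F -> exists a b c d, jacobian_entries F a b c d.
Proof.
move=> [dF cF].
exists (fun x => ('d F x (1, 0)).1), (fun x => ('d F x (0, 1)).1),
  (fun x => ('d F x (1, 0)).2), (fun x => ('d F x (0, 1)).2).
have c1 v : continuous (fun x => ('d F x v).1).
  by move=> x; apply: (continuous_comp (cF v x)); exact: cvg_fst.
have c2 v : continuous (fun x => ('d F x v).2).
  by move=> x; apply: (continuous_comp (cF v x)); exact: cvg_snd.
split => //; split => //.
- by move=> x; exact: differentiable_fst.
- by move=> x v; rewrite diff_coord !diff_fst.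
- by move=> x; exact: differentiable_snd.
- by move=> x v; rewrite diff_coord !diff_snd.
Qed.

End PlaneCalculus.

Section ExactSymplectic.
Variable R : realType.
Implicit Types (F : plane R -> plane R) (x y z v : plane R).

(* As [F] is only C^1, closedness of F^*lambda - lambda is read on the second
   difference of W = S - (F x).2 F_1 + x.2 theta, which vanishes to second order
   at [x] since dW = (F_2 - (F x).2) dF_1 - (r - x.2) dtheta. *)
Lemma exact_det1 F (S a b c d : plane R -> R) : jacobian_entries F a b c d ->
  (forall x, differentiable S x) ->
  (forall x v, 'd S x v = (F x).2 * (v.1 * a x + v.2 * b x) - x.2 * v.1) ->
  forall x, a x * d x - b x * c x = 1.
Proof.
move=> [dF pF1 pF2] dS dSE x.
have [dF1 ca cb F1E] := pF1.
pose W y := S y - ((F x).2 * (F y).1 - x.2 * y.1).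
pose dWv y v := ((F y).2 - (F x).2) * (v.1 * a y + v.2 * b y) - (y.2 - x.2) * v.1.
have dW y : is_diff y W (dWv y).
  have dF1y : is_diff y (fst \o F) ('d (fst \o F) y) by exact: DiffDef.
  have dSy : is_diff y S ('d S y) by exact: DiffDef.
  have [dd ee] := is_diffB dSy (is_diffB (is_diffZ (F x).2 dF1y) (is_diffZ x.2 (is_diff_fst y))).
  apply: DiffDef; first exact: dd.
  apply: etrans ee _; apply/funext => v.
  transitivity ('d S y v - ((F x).2 * ('d (fst \o F) y v) - x.2 * v.1)); first by [].
  rewrite dSE F1E /dWv; ring.
have errF (e : R) : 0 < e -> exists2 r, 0 < r & forall y, box x r y ->
   [/\ `|a y - a x| < e, `|b y - b x| < e &
    `|(F y).2 - (F x).2 - ((y.1 - x.1) * c x + (y.2 - x.2) * d x)|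
      <= e * (`|y.1 - x.1| + `|y.2 - x.2|)].
  move=> e0; have [r1 r10 hF] := strict_diff x pF2 e0.
  have [r2 r20 hA] := continuous_box x ca e0.
  have [r3 r30 hB] := continuous_box x cb e0.
  exists (Num.min r1 (Num.min r2 r3)); first by rewrite !lt_min r10 r20.
  move=> y hy; split.
  - by apply: hA; apply: box_sub hy; rewrite !ge_min lexx !orbT.
  - by apply: hB; apply: box_sub hy; rewrite !ge_min lexx !orbT.
  - apply: hF; first exact: box_center.
    by apply: box_sub hy; rewrite !ge_min lexx.
move: (a x) (b x) (c x) (d x) errF => A B C D errF.
pose K := 1 + `|A| + `|B| + `|C| + `|D|.
have K0 : 0 < K by rewrite /K -!addrA ltr_pwDl// !addr_ge0.
(* The constant 16 K is the sum of four errors 4 K (e h), one for each side of the square below,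
   divided by its side h. *)
suff main e : 0 < e -> e < 1 -> `|A * D - B * C - 1| <= 16 * K * e.
  apply/eqP; rewrite -subr_eq0 -normr_eq0; apply/eqP.
  apply: le_anti; rewrite normr_ge0 andbT; apply/ler_addgt0Pl => e e0; rewrite addr0.
  have p : 0 < 16 * K + e by rewrite addr_gt0 ?mulr_gt0.
  have q0 : 0 < e / (16 * K + e) by rewrite divr_gt0.
  have q1 : e / (16 * K + e) < 1 by rewrite ltr_pdivrMr// mul1r ltrDr mulr_gt0.
  apply: le_trans (main _ q0 q1) _.
  by rewrite mulrA ler_pdivrMr// mulrC ler_pM2l// lerDl ltW.
move=> e0 e1; have [r r0 hr] := errF _ e0.
pose h := r / 2.
have h0 : 0 < h by rewrite divr_gt0.
have uh (u : R) : 0 <= u <= 1 -> `|u * h| <= h.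
  move=> /andP[u0 u1]; have uh0 : 0 <= u * h by rewrite mulr_ge0// ltW.
  by rewrite ger0_norm// ler_piMl// ltW.
have hlt : h < r by rewrite /h; lra.
pose pt (u w : R) : plane R := (x.1 + u * h, x.2 + w * h).
have inb u w : 0 <= u <= 1 -> 0 <= w <= 1 -> box x r (pt u w).
  move=> hu hw; split; rewrite /pt /= addrAC subrr add0r.
    exact: le_lt_trans (uh _ hu) hlt.
  exact: le_lt_trans (uh _ hw) hlt.
(* To first order the product P Q is L X: P, the increment of F_2, is replaced by its linear part L,
   and Q, an entry of the first row, by its value X at x. *)
have err_mul (u w Q X P : R) : 0 <= u <= 1 -> 0 <= w <= 1 ->
    `|Q - X| < e -> `|X| <= K ->
    `|P - (u * h * C + w * h * D)| <= e * (`|u * h| + `|w * h|) ->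
    `|P * Q - (u * h * C + w * h * D) * X| <= 4 * K * (e * h).
  move=> hu hw hQ hX hP; set L := _ + _ * D in hP *.
  have hP' : `|P - L| <= 2 * (e * h).
    apply: le_trans hP _.
    rewrite (_ : 2 * (e * h) = e * (h + h)); last by ring.
    by rewrite ler_pM2l// lerD// uh.
  have hL : `|L| <= (K - 1) * h.
    have l1 : `|u * h * C| <= h * `|C| by rewrite normrM ler_wpM2r// uh.
    have l2 : `|w * h * D| <= h * `|D| by rewrite normrM ler_wpM2r// uh.
    apply: le_trans (ler_normD _ _) _; apply: le_trans (lerD l1 l2) _.
    rewrite -mulrDr mulrC ler_pM2r// /K.
    by have := normr_ge0 A; have := normr_ge0 B; lra.
  rewrite (_ : P * Q - L * X = (P - L) * (Q - X) + (P - L) * X + L * (Q - X)); last by ring.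
  have hQ' := ltW hQ.
  have t1 : `|(P - L) * (Q - X)| <= 2 * (e * h) * 1.
    by rewrite normrM; apply: ler_pM => //; apply: le_trans hQ' (ltW e1).
  have t2 : `|(P - L) * X| <= 2 * (e * h) * K by rewrite normrM; apply: ler_pM.
  have t3 : `|L * (Q - X)| <= (K - 1) * h * e by rewrite normrM; apply: ler_pM.
  apply: le_trans (ler_normD _ _) _.
  apply: le_trans (lerD (le_trans (ler_normD _ _) (lerD t1 t2)) t3) _.
  have K1 : 1 <= K by rewrite /K -!addrA lerDl !addr_ge0.
  have eh : 0 <= e * h by rewrite mulr_ge0 ?ltW.
  have ehK : e * h <= K * (e * h) by rewrite ler_peMl.
  rewrite (_ : (K - 1) * h * e = K * (e * h) - e * h); last by ring.
  rewrite (_ : 2 * (e * h) * K = 2 * (K * (e * h))); last by ring.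
  rewrite (_ : 4 * K * (e * h) = 4 * (K * (e * h))); last by ring.
  move: eh ehK; move: (K * (e * h)) (e * h) => Z Y eh ehK; lra.
have AK : `|A| <= K.
  by rewrite /K; have := normr_ge0 B; have := normr_ge0 C; have := normr_ge0 D; lra.
have BK : `|B| <= K.
  by rewrite /K; have := normr_ge0 A; have := normr_ge0 C; have := normr_ge0 D; lra.
have err1 u w : 0 <= u <= 1 -> 0 <= w <= 1 ->
    `|((F (pt u w)).2 - (F x).2) * a (pt u w) - (u * h * C + w * h * D) * A|
      <= 4 * K * (e * h).
  move=> hu hw; have [q1 _] := hr _ (inb _ _ hu hw).
  rewrite /pt /= ![_ + _ * h - _]addrAC !subrr !add0r => q2.
  exact: err_mul.
have err2 u w : 0 <= u <= 1 -> 0 <= w <= 1 ->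
    `|((F (pt u w)).2 - (F x).2) * b (pt u w) - (u * h * C + w * h * D) * B|
      <= 4 * K * (e * h).
  move=> hu hw; have [_ q1] := hr _ (inb _ _ hu hw).
  rewrite /pt /= ![_ + _ * h - _]addrAC !subrr !add0r => q2.
  exact: err_mul.
have u1 : 0 <= (1 : R) <= 1 by rewrite ler01 lexx.
have u0 : 0 <= (0 : R) <= 1 by rewrite lexx ler01.
(* The second difference of W over the square of side h at x is evaluated twice, from its horizontal
   sides and from its vertical ones; comparing the two yields the determinant. *)
have [s hs e1'] := mvt_line2 (x.1, x.2 + h) x (h, 0) dW.
have [t ht e2'] := mvt_line2 (x.1 + h, x.2) x (0, h) dW.
have eqD : (W ((x.1, x.2 + h) + (h, 0)) - W (x + (h, 0))) - (W (x.1, x.2 + h) - W x)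
   = (W ((x.1 + h, x.2) + (0, h)) - W (x + (0, h))) - (W (x.1 + h, x.2) - W x).
  have -> : (x.1, x.2 + h) + (h, 0) = (x.1 + h, x.2) + (0, h) :> plane R.
    by congr pair; rewrite /= addr0.
  have -> : x + (h, 0) = (x.1 + h, x.2) by congr pair; rewrite /= ?addr0.
  have -> : x + (0, h) = (x.1, x.2 + h) by congr pair; rewrite /= ?addr0.
  by move: (W _) (W _) (W _) (W _) => *; ring.
have {}eqD := etrans (esym e1') (etrans eqD e2').
have sc (k : R) (v : plane R) : k *: v = (k * v.1, k * v.2) by [].
have E1 : (x.1, x.2 + h) + s *: ((h, 0) : plane R) = pt s 1.
  by rewrite sc; congr pair; rewrite /= ?mulr0 ?addr0 ?mul1r.
have E2 : x + s *: ((h, 0) : plane R) = pt s 0.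
  by rewrite sc; congr pair; rewrite /= ?mulr0 ?addr0 ?mul0r ?addr0.
have E3 : (x.1 + h, x.2) + t *: ((0, h) : plane R) = pt 1 t.
  by rewrite sc; congr pair; rewrite /= ?mulr0 ?addr0 ?mul1r.
have E4 : x + t *: ((0, h) : plane R) = pt 0 t.
  by rewrite sc; congr pair; rewrite /= ?mulr0 ?addr0 ?mul0r ?addr0.
rewrite E1 E2 E3 E4 /dWv /= in eqD.
have := err1 _ _ hs u1; have := err1 _ _ hs u0.
have := err2 _ _ u1 ht; have := err2 _ _ u0 ht.
move: eqD; move: (((F (pt 0 t)).2 - _)) (((F (pt 1 t)).2 - _)) (((F (pt s 0)).2 - _)) (((F (pt s 1)).2 - _)).
move: (a (pt s 1)) (a (pt s 0)) (b (pt 1 t)) (b (pt 0 t)) => a1 a0 b1 b0 P1 P2 P3 P4.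
rewrite !mul0r !addr0 !add0r !mul1r subrr mul0r subr0 mulr0 !subr0.
move=> eqD h1 h2 h3 h4.
have {}eqD : P4 * a1 - P3 * a0 - h = P2 * b1 - P1 * b0.
  apply: (mulfI (lt0r_neq0 h0)).
  by rewrite (_ : h * (P2 * b1 - P1 * b0) = P2 * (h * b1) - P1 * (h * b0));
    [rewrite -eqD|]; ring.
have hE : h * (A * D - B * C - 1) =
    (P3 * a0 - s * h * C * A) - (P4 * a1 - (s * h * C + h * D) * A)
    + ((P2 * b1 - (h * C + t * h * D) * B) - (P1 * b0 - t * h * D * B)).
  move: eqD; move: (P4 * a1) (P3 * a0) (P2 * b1) (P1 * b0) => X1 X2 X3 X4 eqD.
  have -> : X3 = X1 - X2 - h + X4 by rewrite eqD subrK.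
  by ring.
rewrite -(ler_pM2l h0) -{1}(gtr0_norm h0) -normrM hE.
apply: le_trans (ler_normD _ _) _.
apply: le_trans (lerD (ler_normB _ _) (ler_normB _ _)) _.
apply: le_trans (lerD (lerD h3 h4) (lerD h2 h1)) _.
by rewrite le_eqVlt; apply/orP; left; apply/eqP; ring.
Qed.

End ExactSymplectic.

Lemma inverse_jacobian (R : realType) (F G : plane R -> plane R)
    (a b c d a' b' c' d' : plane R -> R) (x : plane R) :
  jacobian_entries F a b c d -> jacobian_entries G a' b' c' d' -> cancel F G ->
  a x * d x - b x * c x = 1 ->
  [/\ a' (F x) = d x, b' (F x) = - b x, c' (F x) = - c x & d' (F x) = a x].
Proof.
move=> jF jG FK det0.
have := is_diff_comp (jacobian_is_diff jF x) (jacobian_is_diff jG (F x)).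
have -> : G \o F = id by apply/funext => y; exact: FK.
move=> [_ d1]; have [_ d2] := is_diff_id x.
have comp v := congr1 (@^~ v) (etrans (esym d1) d2).
have := comp (1, 0); have := comp (0, 1).
rewrite /= => -[e1 e2] [e3 e4].
move: det0; move: (a' _) (b' _) (c' _) (d' _) (a x) (b x) (c x) (d x) e1 e2 e3 e4.
move=> p q r s A B C' D e1 e2 e3 e4 det.
rewrite !mul1r !mul0r !addr0 !add0r in e1 e2 e3 e4.
split.
- transitivity (p * (A * D - B * C')); first by rewrite det mulr1.
  transitivity (D * (A * p + C' * q) - C' * (B * p + D * q)); first by ring.
  by rewrite e1 e3; ring.
- transitivity (q * (A * D - B * C')); first by rewrite det mulr1.
  transitivity (A * (B * p + D * q) - B * (A * p + C' * q)); first by ring.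
  by rewrite e1 e3; ring.
- transitivity (r * (A * D - B * C')); first by rewrite det mulr1.
  transitivity (D * (A * r + C' * s) - C' * (B * r + D * s)); first by ring.
  by rewrite e2 e4; ring.
- transitivity (s * (A * D - B * C')); first by rewrite det mulr1.
  transitivity (A * (B * r + D * s) - B * (A * r + C' * s)); first by ring.
  by rewrite e2 e4; ring.
Qed.

(** * Upper limits over pairs of nearby points *)

Section BorelAnnulus.
Variable R : realType.

Lemma lsc_measurable (u : annulus R -> R) :
  (forall c, open [set p | c < u p]) ->
  measurable_fun setT (u : borel_annulus R -> R).
Proof.
move=> ou _; apply: (measurability _ (RGenOInfty.measurableE R)) => //.
move=> _ [_ [c ->] <-]; rewrite setTI.
apply: sub_sigma_algebra.
rewrite (_ : u @^-1` _ = [set p | c < u p]); first exact: ou.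
by apply/seteqP; split => p; rewrite /= in_itv/= andbT.
Qed.

Lemma continuous_lift_measurable (u : annulus R -> R) (U : plane R -> R) :
  continuous U -> (forall x, u (covering x) = U x) ->
  measurable_fun setT (u : borel_annulus R -> R).
Proof.
move=> cU uU; apply: lsc_measurable => c; apply/open_annulusP.
rewrite (_ : _ @^-1` _ = U @^-1` [set t | c < t]); last first.
  by apply/seteqP; split => x; rewrite /= uU.
by move/continuousP : cU; apply; exact: open_gt.
Qed.

Lemma continuous_annulus_measurable (f : annulus R -> annulus R) :
  continuous f ->
  measurable_fun setT (f : borel_annulus R -> borel_annulus R).
Proof.
move=> cf mT.
apply: (@measurability _ _ (borel_annulus R) (borel_annulus R) setT f (@open (annulus R))) => //.
move=> _ [U oU <-]; rewrite setTI; apply: sub_sigma_algebra.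
by move/continuousP : cf; exact.
Qed.

End BorelAnnulus.

Section UpperLimit.
Variables (R : realType) (K : set (plane R)) (B : R) (q : plane R -> plane R -> R).
Hypothesis B0 : 0 <= B.
Hypothesis qB : forall y z, K y -> K z -> y.1 < z.1 -> `|q y z| <= B.
Hypothesis q_deck : forall k y z, q (deck k y) (deck k z) = q y z.
Hypothesis K_deck : forall k y, K y -> K (deck k y).

Definition pairs_at (x : plane R) (e : R) : set (plane R * plane R) :=
  [set p | [/\ K p.1, K p.2, p.1.1 < p.2.1, box x e p.1 & box x e p.2]].

(* The value [- B] keeps the supremum meaningful away from [K]. *)
Definition values_at (a : annulus R) (n : nat) : set R :=
  [set t | t = - B \/ exists x p,
    [/\ covering x = a, pairs_at x n.+1%:R^-1 p & t = q p.1 p.2]].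

Definition usup n a : R := sup (values_at a n).
Definition ulim a : R := inf (range (usup ^~ a)).

Lemma values_at_sup a n : has_sup (values_at a n).
Proof.
split; first by exists (- B); left.
exists B => t [->|[x [p [_ [K1 K2 l _ _] ->]]]]; first by rewrite ge0_cp.
by apply: le_trans (ler_norm _) _; exact: qB.
Qed.

Lemma usup_geN n a : - B <= usup n a.
Proof. by apply: ub_le_sup; [case: (values_at_sup a n)|left]. Qed.

Lemma usup_le n a : usup n a <= B.
Proof.
apply: ge_sup; first by case: (values_at_sup a n).
move=> t [->|[x [p [_ [K1 K2 l _ _] ->]]]]; first by rewrite ge0_cp.
by apply: le_trans (ler_norm _) _; exact: qB.
Qed.

Lemma usup_bounded n a : `|usup n a| <= B.
Proof. by rewrite ler_norml usup_geN usup_le. Qed.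

Lemma usup_nonincreasing a : nonincreasing_seq (usup ^~ a).
Proof.
move=> n m nm; apply: ge_sup; first by case: (values_at_sup a m).
move=> t ht; apply: ub_le_sup; first by case: (values_at_sup a n).
case: ht => [->|[x [p [xa [K1 K2 l b1 b2] ->]]]]; first by left.
right; exists x, p; split => //.
have h : m.+1%:R^-1 <= n.+1%:R^-1 :> R by rewrite lef_pV2 ?posrE// ler_nat.
by split => //; apply: box_sub; eauto.
Qed.

(** At a fixed scale the supremum is lower semicontinuous: a pair with a value above c serves every
    point whose open box contains both of its members, so the superlevel sets are projections of
    open sets. *)
Lemma measurable_usup n : measurable_fun setT (usup n : borel_annulus R -> R).
Proof.
apply: lsc_measurable => c.
(* Below -B the default value alone puts every point in the superlevel set. *)
have [cB|cB] := ltP c (- B).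
  rewrite (_ : [set p | _] = setT); first exact: openT.
  by apply/seteqP; split => // a _; apply: lt_le_trans cB (usup_geN _ _).
pose O := \bigcup_(p in [set p | [/\ K p.1, K p.2, p.1.1 < p.2.1 & c < q p.1 p.2]])
  (box p.1 n.+1%:R^-1 `&` box p.2 n.+1%:R^-1).
have box_sym (x y : plane R) e : box x e y <-> box y e x.
  by rewrite /box /=; split => -[h1 h2]; split; rewrite distrC.
rewrite (_ : [set p | _] = @covering R @` O).
  by apply: open_covering; apply: bigcup_open => p _; apply: openI; exact: open_box.
apply/seteqP; split => a /=.
  move=> ca; have [t ht ct] := sup_gt (values_at_sup a n).1 ca.
  case: ht ct => [->|[x [p [xa [K1 K2 l b1 b2] ->]]]] ct.
    by move: cB; rewrite leNgt ct.
  exists x => //; exists p; first by split.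
  by split; apply/box_sym.
move=> [x [p [K1 K2 l cq] [b1 b2]] xa].
apply: lt_le_trans cq _; apply: ub_le_sup; first by case: (values_at_sup a n).
right; exists x, p; split => //; split => //; exact/box_sym.
Qed.

Lemma usup_cvg a : usup ^~ a @ \oo --> ulim a.
Proof.
apply: nonincreasing_cvgn; first exact: usup_nonincreasing.
by exists (- B) => _ [n _ <-]; exact: usup_geN.
Qed.

Lemma ulim_le_usup n a : ulim a <= usup n a.
Proof.
apply: inf_lbound; last by exists n.
by exists (- B) => _ [m _ <-]; exact: usup_geN.
Qed.

Lemma measurable_ulim : measurable_fun setT (ulim : borel_annulus R -> R).
Proof.
apply: (measurable_fun_cvg measurable_usup) => a _; exact: usup_cvg.
Qed.

Lemma ulim_bounded a : `|ulim a| <= B.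
Proof.
rewrite ler_norml (le_trans (ulim_le_usup 0 a) (usup_le _ _)) andbT.
by apply: lb_le_inf; [exists (usup 0 a), 0%N|move=> _ [n _ <-]; exact: usup_geN].
Qed.

Lemma le_usup n x y z : pairs_at x n.+1%:R^-1 (y, z) -> q y z <= usup n (covering x).
Proof.
move=> h; apply: ub_le_sup; first by case: (values_at_sup (covering x) n).
by right; exists x, (y, z).
Qed.

Lemma inv_nat_lt (e : R) : 0 < e -> exists n : nat, n.+1%:R^-1 < e.
Proof.
move=> e0; exists (Num.bound e^-1); rewrite invf_plt ?posrE//.
apply: (@lt_le_trans _ _ (Num.bound e^-1)%:R); last by rewrite ler_nat.
by apply: archi_boundP; rewrite invr_ge0 ltW.
Qed.

Lemma ulim_upper x (e : R) : 0 < e -> exists2 d, 0 < d &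
  forall y z, pairs_at x d (y, z) -> q y z <= ulim (covering x) + e.
Proof.
move=> e0; have /cvgrPdist_lt/(_ e e0)[n _ /(_ n (leqnn _)) hn] := @usup_cvg (covering x).
exists n.+1%:R^-1; first by rewrite invr_gt0.
move=> y z /le_usup h; apply: le_trans h _; rewrite -lerBlDl ltW//.
by apply: le_lt_trans hn; rewrite distrC ler_norm.
Qed.

Lemma pairs_at_deck k x e y z : pairs_at (deck k x) e (y, z) ->
  pairs_at x e (deck (- k) y, deck (- k) z).
Proof.
have E (w : plane R) : w.1 + (- k)%:~R - x.1 = w.1 - (x.1 + k%:~R).
  by rewrite intrN; ring.
move=> [/= K1 K2 l [b1 b1'] [b2 b2']]; split => /=; try exact: K_deck.
- by rewrite ltrD2r.
- by split; rewrite /= ?E.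
- by split; rewrite /= ?E.
Qed.

Lemma ulim_lower x : (forall d, 0 < d -> pairs_at x d !=set0) ->
  forall e d : R, 0 < e -> 0 < d ->
  exists y z, pairs_at x d (y, z) /\ ulim (covering x) - e < q y z.
Proof.
move=> ne e d e0 d0.
have [n nd] := inv_nat_lt d0.
have h : ulim (covering x) - e < usup n (covering x).
  by apply: lt_le_trans (ulim_le_usup n _); rewrite ltrBlDr ltrDl.
have [t ht et] := sup_gt (values_at_sup (covering x) n).1 h.
have sub y z : pairs_at x n.+1%:R^-1 (y, z) -> pairs_at x d (y, z).
  by move=> [K1 K2 l b1 b2]; split => //; apply: box_sub (ltW nd) _ _.
(* Either t is the default value -B, which no quotient undercuts, so that any pair will do, or t
   comes from a pair near another lift of the same point, which a deck translation carries back to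
   x. *)
case: ht et => [->|[x' [[y z] [xx' pyz ->]]]] et.
  have [[y z] [/= K1 K2 l b1 b2]] := ne _ d0.
  exists y, z; split; first by split.
  apply: lt_le_trans et _.
  have := qB K1 K2 l; rewrite ler_norml => /andP[hq _].
  by apply: le_trans hq.
have [k ek] := covering_eq_deck xx'; rewrite ek in pyz.
exists (deck (- k) y), (deck (- k) z); split; first exact/sub/pairs_at_deck.
by rewrite q_deck.
Qed.

End UpperLimit.

(** * Slopes of the paratangent cone *)

(* An F-ordered Lipschitz graph [K] over a circle map [H] without periodic points,
   with the derivative [[a, b], [c, d]] of [F]. Backward time is handled by the
   same statement for [G], [H'] in place of [F], [H]. *)
Record twist_system (R : realType) (f : annulus R -> annulus R)
    (F G : plane R -> plane R) (H : R -> R) (K : set (plane R)) (C : R)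
    (a b c d : plane R -> R) : Prop := TwistSystem {
  ts_lift : is_lift f F;
  ts_FK : cancel F G;
  ts_jac : jacobian_entries F a b c d;
  ts_det : forall x, a x * d x - b x * c x = 1;
  ts_deck : forall k x, F (deck k x) = deck k (F x);
  ts_K_deck : forall k x, K x -> K (deck k x);
  ts_K_F : forall x, K x -> K (F x);
  ts_C_ge1 : 1 <= C;
  ts_graph : forall x y, K x -> K y -> `|x.2 - y.2| <= C * `|x.1 - y.1|;
  ts_mono : forall x y, K x -> K y -> x.1 < y.1 -> (F x).1 < (F y).1;
  ts_lip : forall x y, K x -> K y -> `|(F x).1 - (F y).1| <= C * `|x.1 - y.1|;
  ts_b : forall x, K x -> `|b x| <= C;
  ts_pairs : forall x e, K x -> 0 < e -> pairs_at K x e !=set0;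
  ts_H_cont : continuous H;
  ts_H1 : forall t, H (t + 1) = H t + 1;
  ts_H : forall x, K x -> H x.1 = (F x).1;
  ts_aperiodic : forall m (k : int) t, (0 < m)%N -> iter m H t + k%:~R != t
}.

Section Slopes.
Variables (R : realType) (f g : annulus R -> annulus R) (F G : plane R -> plane R).
Variables (H H' : R -> R) (K : set (plane R)) (C : R) (a b c d : plane R -> R).
Variables (a' b' c' d' : plane R -> R).
Hypothesis TS : twist_system f F G H K C a b c d.
Hypothesis TS' : twist_system g G F H' K C a' b' c' d'.
Implicit Types (x y z : plane R) (m e : R).

Definition slope y z : R := (z.2 - y.2) / (z.1 - y.1).
(* The extreme slopes of the paratangent cone of [K]. *)
Definition upper_slope : annulus R -> R := ulim K C slope.
Definition lower_slope p : R := - ulim K C (fun y z => - slope y z) p.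

Let C1 : 1 <= C := ts_C_ge1 TS.
Let C0 : 0 < C. Proof. exact: lt_le_trans ltr01 C1. Qed.

Lemma slope_bounded y z : K y -> K z -> y.1 < z.1 -> `|slope y z| <= C.
Proof.
move=> Ky Kz yz; have zy : 0 < z.1 - y.1 by rewrite subr_gt0.
rewrite /slope normrM normfV ler_pdivrMr ?normr_gt0 ?gt_eqF//.
exact: (ts_graph TS).
Qed.

Lemma slope_deck k y z : slope (deck k y) (deck k z) = slope y z.
Proof. by rewrite /slope /deck /=; congr (_ / _); ring. Qed.

Let sB' y z : K y -> K z -> y.1 < z.1 -> `|- slope y z| <= C.
Proof. by rewrite normrN; exact: slope_bounded. Qed.

Let sd' k y z : - slope (deck k y) (deck k z) = - slope y z.
Proof. by rewrite slope_deck. Qed.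

Lemma measurable_upper_slope :
  measurable_fun setT (upper_slope : borel_annulus R -> R).
Proof. exact: (measurable_ulim (ltW C0) slope_bounded). Qed.

Lemma measurable_lower_slope :
  measurable_fun setT (lower_slope : borel_annulus R -> R).
Proof. apply: measurableT_comp => //; exact: (measurable_ulim (ltW C0) sB'). Qed.

Lemma upper_slope_bounded p : `|upper_slope p| <= C.
Proof. exact: (ulim_bounded (ltW C0) slope_bounded). Qed.

Lemma lower_slope_bounded p : `|lower_slope p| <= C.
Proof. rewrite normrN; exact: (ulim_bounded (ltW C0) sB'). Qed.

(** Such an m is the slope of a paratangent vector (1, m), see [limit_slope_paratangent]; tolerances
    on slope and position replace sequences. *)
Definition limit_slope x m := forall e dl, 0 < e -> 0 < dl ->
  exists y z, pairs_at K x dl (y, z) /\ `|slope y z - m| <= e.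

Lemma pairs_at_sub x e e' : e <= e' -> pairs_at K x e `<=` pairs_at K x e'.
Proof. by move=> h p [K1 K2 l b1 b2]; split => //; apply: box_sub h _ _. Qed.

Lemma slope_upper x e : 0 < e -> exists2 dl, 0 < dl & forall y z,
  pairs_at K x dl (y, z) -> slope y z <= upper_slope (covering x) + e.
Proof. exact: (ulim_upper (ltW C0) slope_bounded). Qed.

Lemma slope_lower x e : 0 < e -> exists2 dl, 0 < dl & forall y z,
  pairs_at K x dl (y, z) -> lower_slope (covering x) - e <= slope y z.
Proof.
move=> e0; have [dl dl0 h] := ulim_upper (ltW C0) sB' x e0.
by exists dl => // y z /h h'; rewrite /lower_slope; lra.
Qed.

(** As K has pairs at every scale around x, secants come arbitrarily close to the upper limit from
    below, while [slope_upper] bounds them from above near x. *)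
Lemma upper_slope_limit x : K x -> limit_slope x (upper_slope (covering x)).
Proof.
move=> Kx e dl e0 dl0.
have [d1 d10 h1] := slope_upper x e0.
have m0 : 0 < Num.min d1 dl by rewrite lt_min d10.
have [y [z [p h2]]] := ulim_lower (ltW C0) slope_bounded slope_deck (ts_K_deck TS)
  (fun e => ts_pairs TS (e := e) Kx) e0 m0.
exists y, z; split; first by apply: pairs_at_sub p; rewrite ge_min lexx orbT.
have /h1 h3 : pairs_at K x d1 (y, z) by apply: pairs_at_sub p; rewrite ge_min lexx.
rewrite ler_norml; move: h2 h3; rewrite -/upper_slope => h2 h3.
by apply/andP; split; lra.
Qed.

Lemma lower_slope_limit x : K x -> limit_slope x (lower_slope (covering x)).
Proof.
move=> Kx e dl e0 dl0.
have [d1 d10 h1] := slope_lower x e0.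
have m0 : 0 < Num.min d1 dl by rewrite lt_min d10.
have [y [z [p h2]]] := ulim_lower (ltW C0) sB' sd' (ts_K_deck TS)
  (fun e => ts_pairs TS (e := e) Kx) e0 m0.
exists y, z; split; first by apply: pairs_at_sub p; rewrite ge_min lexx orbT.
have /h1 h3 : pairs_at K x d1 (y, z) by apply: pairs_at_sub p; rewrite ge_min lexx.
rewrite ler_norml; move: h2 h3; rewrite /lower_slope => h2 h3.
by apply/andP; split; lra.
Qed.

Lemma limit_slope_between x m : limit_slope x m ->
  lower_slope (covering x) <= m <= upper_slope (covering x).
Proof.
move=> hm; apply/andP; split; apply/ler_addgt0Pl => e e0.
  have e20 : 0 < e / 2 by rewrite divr_gt0.
  have [d1 d10 h1] := slope_lower x e20.
  have [y [z [/h1 p]]] := hm _ _ e20 d10.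
  by rewrite ler_norml => /andP[h2 h3]; lra.
have e20 : 0 < e / 2 by rewrite divr_gt0.
have [d1 d10 h1] := slope_upper x e20.
have [y [z [/h1 p]]] := hm _ _ e20 d10.
by rewrite ler_norml => /andP[h2 h3]; lra.
Qed.

Lemma lower_le_upper_slope x : K x ->
  lower_slope (covering x) <= upper_slope (covering x).
Proof. by move=> /upper_slope_limit/limit_slope_between/andP[]. Qed.

Definition dquot y z : R := ((F z).1 - (F y).1) / (z.1 - y.1).

(** The lower bound is the Lipschitz estimate of the inverse, applied to the images of the two
    points. *)
Lemma dquot_ge y z : K y -> K z -> y.1 < z.1 -> C^-1 <= dquot y z.
Proof.
move=> Ky Kz yz; have zy : 0 < z.1 - y.1 by rewrite subr_gt0.
have Fzy : 0 < (F z).1 - (F y).1 by rewrite subr_gt0; exact: (ts_mono TS).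
rewrite /dquot ler_pdivlMr// mulrC ler_pdivrMr// mulrC.
have := ts_lip TS' (ts_K_F TS Kz) (ts_K_F TS Ky).
by rewrite !(ts_FK TS) !gtr0_norm.
Qed.

Lemma dquot_le y z : K y -> K z -> y.1 < z.1 -> dquot y z <= C.
Proof.
move=> Ky Kz yz; have zy : 0 < z.1 - y.1 by rewrite subr_gt0.
have Fzy : 0 < (F z).1 - (F y).1 by rewrite subr_gt0; exact: (ts_mono TS).
rewrite /dquot ler_pdivrMr//.
by have := ts_lip TS Kz Ky; rewrite !gtr0_norm.
Qed.

Lemma quotient_approx x e : 0 < e -> exists2 dl, 0 < dl & forall y z,
  pairs_at K x dl (y, z) ->
  `|dquot y z - (a x + b x * slope y z)| <= e /\
  `|((F z).2 - (F y).2) / (z.1 - y.1) - (c x + d x * slope y z)| <= e.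
Proof.
move=> e0; have [dF pF1 pF2] := ts_jac TS.
(* The error of strict differentiability is relative to the sum of the horizontal and vertical
   distances, which on K is at most 1 + C times the horizontal one. *)
have e'0 : 0 < e / (1 + C) by rewrite divr_gt0// addr_gt0.
have [d1 d10 h1] := strict_diff x pF1 e'0.
have [d2 d20 h2] := strict_diff x pF2 e'0.
exists (Num.min d1 d2); first by rewrite lt_min d10.
move=> y z [/= Ky Kz yz by_ bz].
have zy : 0 < z.1 - y.1 by rewrite subr_gt0.
have zy0 : z.1 - y.1 != 0 by rewrite gt_eqF.
have m1 : Num.min d1 d2 <= d1 by rewrite ge_min lexx.
have m2 : Num.min d1 d2 <= d2 by rewrite ge_min lexx orbT.
have sz : z.2 - y.2 = slope y z * (z.1 - y.1) by rewrite /slope divfK.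
have bound (v A B : R) : `|v - ((z.1 - y.1) * A + (z.2 - y.2) * B)| <=
    e / (1 + C) * (`|z.1 - y.1| + `|z.2 - y.2|) ->
    `|v / (z.1 - y.1) - (A + B * slope y z)| <= e.
  move=> hv.
  rewrite (_ : _ - _ = (v - ((z.1 - y.1) * A + (z.2 - y.2) * B)) / (z.1 - y.1)); last first.
    by rewrite sz; field.
  rewrite normrM normfV ler_pdivrMr ?normr_gt0//; apply: le_trans hv _.
  have := ts_graph TS Kz Ky.
  rewrite mulrAC ler_pdivrMr ?addr_gt0// => hg; rewrite -mulrA ler_pM2l//.
  by rewrite mulrDr mulr1 [_ * C]mulrC lerD2l.
split; apply: bound.
  exact: (h1 y z (box_sub m1 by_) (box_sub m1 bz)).
exact: (h2 y z (box_sub m2 by_) (box_sub m2 bz)).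
Qed.

Lemma pairs_at_image x e : 0 < e -> exists2 dl, 0 < dl & forall y z,
  pairs_at K x dl (y, z) -> pairs_at K (F x) e (F y, F z).
Proof.
move=> e0; have cF : continuous F := (ts_lift TS).1.
have /nbhs_box[dl dl0 h] : nbhs x (F @^-1` box (F x) e).
  by apply: cF; apply/nbhs_box; exists e.
exists dl => // y z [/= Ky Kz yz by_ bz]; split => /=.
- exact: (ts_K_F TS).
- exact: (ts_K_F TS).
- exact: (ts_mono TS).
- exact: h.
- exact: h.
Qed.

Lemma limit_quotient x m : limit_slope x m -> forall e dl, 0 < e -> 0 < dl ->
  exists y z, [/\ pairs_at K x dl (y, z), pairs_at K (F x) dl (F y, F z),
    `|dquot y z - (a x + b x * m)| <= e &
    `|((F z).2 - (F y).2) / (z.1 - y.1) - (c x + d x * m)| <= e].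
Proof.
move=> hm e dl e0 dl0.
have e20 : 0 < e / 2 by rewrite divr_gt0.
have [d1 d10 h1] := quotient_approx x e20.
have [d2 d20 h2] := pairs_at_image x dl0.
pose D := 1 + `|b x| + `|d x|.
have D0 : 0 < D by rewrite /D -addrA ltr_pwDl// addr_ge0.
have eD : 0 < e / 2 / D by rewrite divr_gt0.
have m0 : 0 < Num.min d1 (Num.min d2 dl) by rewrite !lt_min d10 d20.
have [y [z [p hs]]] := hm _ _ eD m0.
have p1 : pairs_at K x d1 (y, z) by apply: pairs_at_sub p; rewrite ge_min lexx.
have p2 : pairs_at K x d2 (y, z).
  by apply: pairs_at_sub p; rewrite !ge_min lexx !orbT.
have [q1 q2] := h1 _ _ p1.
have small (B : R) : `|B| <= D -> `|B * slope y z - B * m| <= e / 2.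
  move=> hB; rewrite -mulrBr normrM.
  by apply: le_trans (ler_pM _ _ hB hs) _ => //; rewrite mulrC divfK ?gt_eqF.
exists y, z; split => //.
- by apply: pairs_at_sub p; rewrite !ge_min lexx !orbT.
- exact: h2.
- have /small : `|b x| <= D by rewrite /D; have := normr_ge0 (d x); lra.
  by move: q1; rewrite !ler_norml => /andP[? ?] /andP[? ?]; apply/andP; split; lra.
- have /small : `|d x| <= D by rewrite /D; have := normr_ge0 (b x); lra.
  by move: q2; rewrite !ler_norml => /andP[? ?] /andP[? ?]; apply/andP; split; lra.
Qed.

Lemma limit_slope_growth x m : limit_slope x m -> C^-1 <= a x + b x * m <= C.
Proof.
move=> hm; apply/andP; split; apply/ler_addgt0Pl => e e0.
  have [y [z [[/= Ky Kz yz _ _] _ h _]]] := limit_quotient hm e0 ltr01.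
  have := dquot_ge Ky Kz yz; move: h; rewrite ler_norml => /andP[? ?]; lra.
have [y [z [[/= Ky Kz yz _ _] _ h _]]] := limit_quotient hm e0 ltr01.
have := dquot_le Ky Kz yz; move: h; rewrite ler_norml => /andP[? ?]; lra.
Qed.

(** The derivative of F acts on slopes by the Mobius map m -> (c + d m) / (a + b m), and F sends
    ordered pairs of K near x to ordered pairs near F x. *)
Lemma limit_slope_image x m : limit_slope x m ->
  limit_slope (F x) ((c x + d x * m) / (a x + b x * m)).
Proof.
move=> hm e dl e0 dl0.
have /andP[A1 A2] := limit_slope_growth hm.
set A := a x + b x * m in A1 A2 *; set N := c x + d x * m.
have A0 : 0 < A by apply: lt_le_trans A1; rewrite invr_gt0.
(* Both denominators are at least 1/C, whence the factor C * C; the numerator of the difference is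
   at most (C + |N|) times the common tolerance. *)
pose D := C * C * (C + `|N|).
have D0 : 0 < D by rewrite !mulr_gt0// ltr_pwDl.
have eD : 0 < e / D by rewrite divr_gt0.
have [y [z [[/= Ky Kz yz _ _] p h1 h2]]] := limit_quotient hm eD dl0.
exists (F y), (F z); split => //.
have X1 := dquot_ge Ky Kz yz.
have zy : 0 < z.1 - y.1 by rewrite subr_gt0.
have sE : slope (F y) (F z) = ((F z).2 - (F y).2) / (z.1 - y.1) / dquot y z.
  have Fzy : 0 < (F z).1 - (F y).1 by rewrite subr_gt0; exact: (ts_mono TS).
  by rewrite /slope /dquot; field; rewrite !gt_eqF.
rewrite sE; move: h1 h2 X1; rewrite -/A -/N; clearbody A N.
move: (dquot y z) (_ / (z.1 - y.1)) => X Y h1 h2 X1.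
have X0 : 0 < X by apply: lt_le_trans X1; rewrite invr_gt0.
rewrite (_ : Y / X - N / A = X^-1 * A^-1 * ((Y - N) * A - N * (X - A))); last first.
  by field; rewrite !gt_eqF.
rewrite normrM normrM !normfV (gtr0_norm A0) (gtr0_norm X0).
have i1 : X^-1 <= C by rewrite -[C]invrK lef_pV2// posrE ?invr_gt0.
have i2 : A^-1 <= C by rewrite -[C]invrK lef_pV2// posrE ?invr_gt0.
have i3 : X^-1 * A^-1 <= C * C.
  by apply: ler_pM => //; rewrite invr_ge0 ltW.
have i4 : `|(Y - N) * A - N * (X - A)| <= e / D * (C + `|N|).
  apply: le_trans (ler_normB _ _) _; rewrite !normrM (gtr0_norm A0) mulrDr.
  by apply: lerD; [apply: ler_pM => //; exact: ltW|rewrite mulrC ler_wpM2r].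
apply: le_trans (ler_pM _ _ i3 i4) _ => //.
  by rewrite mulr_ge0// invr_ge0 ltW.
by rewrite mulrCA -/D divfK ?gt_eqF.
Qed.

Lemma inverse_entries x : [/\ a' (F x) = d x, b' (F x) = - b x,
  c' (F x) = - c x & d' (F x) = a x].
Proof.
exact: (inverse_jacobian (ts_jac TS) (ts_jac TS') (ts_FK TS) (ts_det TS x)).
Qed.

End Slopes.

Section InvariantSlopes.
Variables (R : realType) (f g : annulus R -> annulus R) (F G : plane R -> plane R).
Variables (H H' : R -> R) (K : set (plane R)) (C : R) (a b c d : plane R -> R).
Variables (a' b' c' d' : plane R -> R).
Hypothesis TS : twist_system f F G H K C a b c d.
Hypothesis TS' : twist_system g G F H' K C a' b' c' d'.
Implicit Types (x y z : plane R) (m e : R).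

Local Notation up x := (upper_slope K C (covering x)).
Local Notation low x := (lower_slope K C (covering x)).

Let C0 : 0 < C. Proof. exact: lt_le_trans ltr01 (ts_C_ge1 TS). Qed.

Lemma growth_bounds x m : limit_slope K x m ->
  C^-1 <= a x + b x * m <= C /\ 0 < a x + b x * m.
Proof.
move=> h; have h' := limit_slope_growth TS TS' h; split => //.
by case/andP: h' => h' _; apply: lt_le_trans h'; rewrite invr_gt0.
Qed.

(** A Mobius map of determinant 1 is increasing where its denominator is positive, so a comparison
    made after the inverse map transfers to the map itself. *)
Lemma mobius_le (m m' A B Cc D : R) : A * D - B * Cc = 1 -> 0 < A + B * m ->
  0 < D - B * m' -> (- Cc + A * m') / (D - B * m') <= m ->
  m' <= (Cc + D * m) / (A + B * m).
Proof.
by move=> det A0 A'0; rewrite ler_pdivlMr// ler_pdivrMr// => h; lra.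
Qed.

Lemma mobius_ge (m m' A B Cc D : R) : A * D - B * Cc = 1 -> 0 < A + B * m ->
  0 < D - B * m' -> m <= (- Cc + A * m') / (D - B * m') ->
  (Cc + D * m) / (A + B * m) <= m'.
Proof.
by move=> det A0 A'0; rewrite ler_pdivrMr// ler_pdivlMr// => h; lra.
Qed.

Let image' x m : K x -> limit_slope K (F x) m ->
  0 < d x - b x * m /\ limit_slope K x ((- c x + a x * m) / (d x - b x * m)).
Proof.
move=> Kx hm.
have [e1 e2 e3 e4] := inverse_entries TS TS' x.
have /andP[h1 _] := limit_slope_growth TS' TS hm.
have h2 := limit_slope_image TS' TS hm.
rewrite e1 e2 in h1; rewrite e1 e2 e3 e4 (ts_FK TS) in h2.
rewrite mulNr in h1 h2; split => //.
by apply: lt_le_trans h1; rewrite invr_gt0.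
Qed.

(** The image of the extreme slope is a limit slope at F x, which gives one inequality. The other is
    the same fact for the inverse system, read back through the Mobius map. *)
Lemma upper_slope_image x : K x ->
  up (F x) = (c x + d x * up x) / (a x + b x * up x).
Proof.
move=> Kx; have hm := upper_slope_limit TS Kx.
have [_ A0] := growth_bounds hm.
apply/eqP; rewrite eq_le; apply/andP; split; last first.
  by have /(limit_slope_between TS)/andP[] := limit_slope_image TS TS' hm.
have [A'0 h] := image' Kx (upper_slope_limit TS (ts_K_F TS Kx)).
have /(limit_slope_between TS)/andP[_ h'] := h.
exact: mobius_le (ts_det TS x) A0 A'0 h'.
Qed.

Lemma lower_slope_image x : K x ->
  low (F x) = (c x + d x * low x) / (a x + b x * low x).
Proof.
move=> Kx; have hm := lower_slope_limit TS Kx.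
have [_ A0] := growth_bounds hm.
apply/eqP; rewrite eq_le; apply/andP; split.
  by have /(limit_slope_between TS)/andP[] := limit_slope_image TS TS' hm.
have [A'0 h] := image' Kx (lower_slope_limit TS (ts_K_F TS Kx)).
have /(limit_slope_between TS)/andP[h' _] := h.
exact: mobius_ge (ts_det TS x) A0 A'0 h'.
Qed.

(** The difference of two values of a Mobius map is the determinant times the difference of the
    arguments, divided by the product of the denominators. *)
Lemma slope_gap_image x : K x ->
  (up (F x) - low (F x)) * (a x + b x * up x) * (a x + b x * low x) = up x - low x.
Proof.
move=> Kx; rewrite upper_slope_image// lower_slope_image//.
have [_ A0] := growth_bounds (upper_slope_limit TS Kx).
have [_ B0] := growth_bounds (lower_slope_limit TS Kx).
transitivity ((up x - low x) * (a x * d x - b x * c x)).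
  by field; rewrite !gt_eqF.
by rewrite (ts_det TS) mulr1.
Qed.

Lemma slope_gap_eq0_image x : K x -> (up (F x) = low (F x)) <-> (up x = low x).
Proof.
move=> Kx; have E := slope_gap_image Kx.
have [_ A0] := growth_bounds (upper_slope_limit TS Kx).
have [_ B0] := growth_bounds (lower_slope_limit TS Kx).
split => /eqP; rewrite -subr_eq0 => /eqP e; apply/eqP; rewrite -subr_eq0.
  by rewrite -E e !mul0r.
by move/eqP: E; rewrite e !mulf_eq0 (gt_eqF A0) (gt_eqF B0) !orbF.
Qed.

Definition log_dquot y z : R := ln (dquot F y z).

Lemma log_dquot_bounded y z : K y -> K z -> y.1 < z.1 -> `|log_dquot y z| <= ln C.
Proof.
move=> Ky Kz yz.
have h1 := dquot_ge TS TS' Ky Kz yz; have h2 := dquot_le TS Ky Kz yz.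
have X0 : 0 < dquot F y z by apply: lt_le_trans h1; rewrite invr_gt0.
rewrite ler_norml /log_dquot -lnV ?posrE// !ler_ln ?posrE ?invr_gt0//.
by rewrite h1.
Qed.

Lemma log_dquot_deck k y z : log_dquot (deck k y) (deck k z) = log_dquot y z.
Proof.
rewrite /log_dquot /dquot !(ts_deck TS) /deck /=; congr (ln (_ / _)); ring.
Qed.

(** When the extreme slopes agree, all secants near x have slope close to s, so every difference
    quotient of F is close to a + b s. *)
Lemma ulim_log_dquot_le x : K x -> up x = low x ->
  ulim K (ln C) log_dquot (covering x) <= ln (a x + b x * up x).
Proof.
move=> Kx eqs; apply/ler_addgt0Pl => e e0.
have [_ A0] := growth_bounds (upper_slope_limit TS Kx).
set s := up x in eqs A0 *; set A := a x + b x * s in A0 *.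
have lnC : 0 <= ln C by rewrite ln_ge0// (ts_C_ge1 TS).
have e20 : 0 < e / 2 by rewrite divr_gt0.
(* A tolerance relative to A: quotients stay below A (1 + e/2), and ln(1 + e/2) <= e/2. *)
pose e1 := A * (e / 2).
have e10 : 0 < e1 by rewrite mulr_gt0.
have e120 : 0 < e1 / 2 by rewrite divr_gt0.
have eb0 : 0 < e1 / 2 / (1 + `|b x|) by rewrite divr_gt0// ltr_pwDl.
have [d1 d10 h1] := quotient_approx TS x e120.
have [d2 d20 h2] := slope_upper TS x eb0.
have [d3 d30 h3] := slope_lower TS x eb0.
have m0 : 0 < Num.min d1 (Num.min d2 d3) by rewrite !lt_min d10 d20.
have [y [z [p h4]]] := ulim_lower lnC log_dquot_bounded log_dquot_deck (ts_K_deck TS)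
  (fun e => ts_pairs TS (e := e) Kx) e20 m0.
have l1 : Num.min d1 (Num.min d2 d3) <= d1 by rewrite ge_min lexx.
have l2 : Num.min d1 (Num.min d2 d3) <= d2 by rewrite !ge_min lexx !orbT.
have l3 : Num.min d1 (Num.min d2 d3) <= d3 by rewrite !ge_min lexx !orbT.
have [h5 _] := h1 y z (pairs_at_sub l1 p).
have h6 := h2 y z (pairs_at_sub l2 p).
have h7 := h3 y z (pairs_at_sub l3 p).
move: p => [/= Ky Kz yz _ _].
have X0 : 0 < dquot F y z.
  by apply: lt_le_trans (dquot_ge TS TS' Ky Kz yz); rewrite invr_gt0.
have h8 : `|b x * slope y z - b x * s| <= e1 / 2.
  rewrite -mulrBr normrM.
  have : `|slope y z - s| <= e1 / 2 / (1 + `|b x|).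
    rewrite ler_norml; move: h6 h7; rewrite -/s -eqs => h6 h7.
    by apply/andP; split; lra.
  have bb : `|b x| <= 1 + `|b x| by rewrite lerDr.
  move=> h; apply: le_trans (ler_pM _ _ bb h) _ => //.
  by rewrite mulrC divfK// gt_eqF// ltr_pwDl.
have h9 : dquot F y z <= A * (1 + e / 2).
  rewrite mulrDr mulr1 -/e1; move: h5 h8; rewrite !ler_norml => /andP[_ h] /andP[_ h'].
  by rewrite /A; lra.
have h10 : log_dquot y z <= ln A + e / 2.
  apply: (@le_trans _ _ (ln (A * (1 + e / 2)))).
    by rewrite ler_ln// posrE// mulr_gt0// addr_gt0.
  have lnE : ln (A * (1 + e / 2)) = ln A + ln (1 + e / 2).
    by apply: lnM; rewrite posrE// addr_gt0.
  by rewrite lnE lerD2l le_ln1Dx// (lt_trans _ e20)// ltrN10.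
lra.
Qed.

End InvariantSlopes.

(** * Regularity of M as equality of the extreme slopes *)

Section Regularity.
Variables (R : realType) (f : annulus R -> annulus R) (F G : plane R -> plane R).
Variables (H : R -> R) (K : set (plane R)) (C : R) (a b c d : plane R -> R).
Hypothesis TS : twist_system f F G H K C a b c d.
Variable M : set (annulus R).
Hypothesis KM : forall x, K x <-> M (covering x).
Implicit Types (x y z : plane R) (m e : R).

Lemma paratangent_slope x v m : K x -> paratangent_cone M (covering x) v ->
  upper_slope K C (covering x) = m -> lower_slope K C (covering x) = m ->
  v.2 = m * v.1.
Proof.
move=> Kx [u [w [tau [dd [[Mu Mw] [cu cw] [tau0 ctau] hd cv]]]]] e1 e2.
have [y [yw hy]] := cvg_lift cw.
(* The differences tend to 0, being [tau n] times a convergent sequence. *)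
have cd : forall e : R, 0 < e -> \forall n \near \oo, `|(dd n).1| < e /\ `|(dd n).2| < e.
  have : (fun n => tau n *: ((tau n)^-1 *: dd n)) @ \oo --> (0 : R) *: v.
    by apply: cvgZ.
  rewrite scale0r => h e e0; have /cvgrPdist_lt/(_ e e0) := h.
  apply: filterS => n; rewrite sub0r normrN scalerA mulfV ?gt_eqF// scale1r.
  by rewrite prod_normE/= gt_max => /andP[].
suff key e : 0 < e -> \forall n \near \oo, `|(dd n).2 - m * (dd n).1| <= e * `|(dd n).1|.
  have h e : 0 < e -> `|v.2 - m * v.1| <= e * `|v.1|.
    move=> e0.
    have c1 : (fun n => (tau n)^-1 * (dd n).1) @ \oo --> v.1.
      exact: (cvg_comp _ _ cv (@cvg_fst _ _ _ _ _)).
    have c2 : (fun n => (tau n)^-1 * (dd n).2) @ \oo --> v.2.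
      exact: (cvg_comp _ _ cv (@cvg_snd _ _ _ _ _)).
    have c3 : (fun n => `|(tau n)^-1 * (dd n).2 - m * ((tau n)^-1 * (dd n).1)|) @ \oo
        --> `|v.2 - m * v.1|.
      by apply: cvg_norm; apply: cvgB => //; apply: cvgM => //; exact: cvg_cst.
    have c4 : (fun n => e * `|(tau n)^-1 * (dd n).1|) @ \oo --> e * `|v.1|.
      by apply: cvgM; [exact: cvg_cst|exact: cvg_norm].
    apply: (ler_cvg_to c3 c4); apply: filterS (key e e0) => n hn.
    rewrite (_ : _ - _ = (tau n)^-1 * ((dd n).2 - m * (dd n).1)); last by ring.
    by rewrite !normrM mulrCA ler_wpM2l.
  apply/eqP; rewrite -subr_eq0 -normr_eq0; apply/eqP/le_anti; rewrite normr_ge0 andbT.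
  apply/ler_addgt0Pl => e e0; rewrite addr0.
  have p0 : 0 < 1 + `|v.1| by rewrite ltr_pwDl.
  have /h h' : 0 < e / (1 + `|v.1|) by rewrite divr_gt0.
  apply: le_trans h' _; rewrite mulrAC ler_pdivrMr// ler_pM2l//.
  by rewrite lerDr.
move=> e0.
have [d1 d10 h1] := slope_upper TS x e0.
have [d2 d20 h2] := slope_lower TS x e0.
pose r := Num.min d1 d2.
have r0 : 0 < r by rewrite lt_min d10.
have r20 : 0 < r / 2 by rewrite divr_gt0.
have r1 : r <= d1 by rewrite ge_min lexx.
have r2 : r <= d2 by rewrite ge_min lexx orbT.
near=> n.
have [/= dE _ _] : [/\ covering (dd n) = u n - w n,
    - 2^-1 <= (dd n).1 < 2^-1 & - 2^-1 <= (dd n).2 < 2^-1] by near: n.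
have [dn1 dn2] : `|(dd n).1| < r / 2 /\ `|(dd n).2| < r / 2 by near: n; exact: cd.
have [y1 y2] : box x (r / 2) (y n) by near: n; exact: hy.
(* This is the lift of [u n] next to the lift [y n] of [w n], so the difference [dd n] is that of
   two points of K near x, in one order or the other. *)
set z := y n + dd n.
have Ky : K (y n) by apply/KM; rewrite yw.
have Kz : K z by apply/KM; rewrite /z coveringD yw dE addrC subrK.
have byr : box x r (y n) by apply: (@box_sub _ _ (r / 2)) => //; rewrite ler_pdivrMr// ler_pMr// ler1n.
have bzr : box x r z.
  split; rewrite /z /= addrAC; apply: le_lt_trans (ler_normD _ _) _.
    by rewrite [ltRHS]splitr ltrD.
  by rewrite [ltRHS]splitr ltrD.
have slope_ok (p q : plane R) : K p -> K q -> box x r p -> box x r q -> p.1 < q.1 ->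
    `|slope p q - m| <= e.
  move=> Kp Kq bp bq pq; have pr : pairs_at K x r (p, q) by [].
  have := h1 _ _ (pairs_at_sub r1 pr); have := h2 _ _ (pairs_at_sub r2 pr).
  by rewrite e1 e2 ler_norml => h h'; apply/andP; split; lra.
have zE1 : z.1 - (y n).1 = (dd n).1 by rewrite /z /= addrAC subrr add0r.
have zE2 : z.2 - (y n).2 = (dd n).2 by rewrite /z /= addrAC subrr add0r.
have sE (s t : R) : s != 0 -> `|t / s - m| <= e -> `|t - m * s| <= e * `|s|.
  move=> s0 h; rewrite (_ : t - m * s = (t / s - m) * s); last by field.
  by rewrite normrM ler_wpM2r.
(* In the first two cases the secant slope is within e of m. If the first coordinates agree, the
   Lipschitz graph property makes the whole difference vanish. *)
have [l|l|l] := ltgtP (y n).1 z.1.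
- apply: sE; first by rewrite -zE1 gt_eqF// subr_gt0.
  by have := slope_ok _ _ Ky Kz byr bzr l; rewrite /slope zE1 zE2.
- apply: sE; first by rewrite -zE1 lt_eqF// subr_lt0.
  have := slope_ok _ _ Kz Ky bzr byr l; rewrite /slope.
  rewrite -(opprB z.1) -(opprB z.2) zE1 zE2.
  by rewrite invrN mulrNN.
- have := ts_graph TS Kz Ky; rewrite zE1 zE2.
  have d0 : (dd n).1 = 0 by rewrite -zE1 l subrr.
  by rewrite d0 normr0 !mulr0 subr0.
Unshelve. all: end_near. Qed.

Lemma limit_slope_paratangent x m : limit_slope K x m ->
  paratangent_cone M (covering x) (1, m).
Proof.
move=> hm.
have i0 n : 0 < n.+1%:R^-1 :> R by rewrite invr_gt0.
have /choice[p hp] : forall n, exists p : plane R * plane R,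
    pairs_at K x n.+1%:R^-1 p /\ `|slope p.1 p.2 - m| <= n.+1%:R^-1.
  by move=> n; have [y [z h]] := hm _ _ (i0 n) (i0 n); exists (y, z).
have sm (e : R) : 0 < e -> \forall n \near \oo, n.+1%:R^-1 < e.
  move=> e0; have [N hN] := inv_nat_lt e0; exists N => // n /= Nn.
  apply: le_lt_trans hN; rewrite lef_pV2 ?posrE// ler_nat ltnS; exact: Nn.
have cvgK (q : nat -> plane R) : (forall n, box x n.+1%:R^-1 (q n)) ->
    (fun n => covering (q n)) @ \oo --> covering x.
  move=> hq; apply: (@cvg_comp _ _ _ q (@covering R) _ (nbhs x)); last exact: covering_continuous.
  apply/cvgrPdist_lt => e e0; apply: filterS (sm e e0) => n hn.
  have [q1 q2] := hq n; rewrite prod_normE /= gt_max.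
  by rewrite distrC (lt_trans q1 hn)/= distrC (lt_trans q2 hn).
have K12 n : [/\ K (p n).1, K (p n).2, (p n).1.1 < (p n).2.1,
  box x n.+1%:R^-1 (p n).1 & box x n.+1%:R^-1 (p n).2] by case: (hp n).
have pos n : 0 < (p n).2.1 - (p n).1.1 by rewrite subr_gt0; case: (K12 n).
have small n : (p n).2.1 - (p n).1.1 < n.+1%:R^-1 *+ 2.
  have [_ _ _ [b1 _] [b2 _]] := K12 n.
  by move: b1 b2; move: (n.+1%:R^-1) => q; rewrite !ltr_norml mulr2n => /andP[? ?] /andP[? ?]; lra.
have small2 n : `|(p n).2.2 - (p n).1.2| < n.+1%:R^-1 *+ 2.
  have [_ _ _ [_ b1] [_ b2]] := K12 n.
  move: b1 b2; move: (n.+1%:R^-1) => q; rewrite !ltr_norml mulr2n => /andP[? ?] /andP[? ?].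
  by apply/andP; split; lra.
(* Dividing by the horizontal distance makes the first coordinate exactly 1 and the second one the
   slope of the pair. *)
exists (fun n => covering (p n).2), (fun n => covering (p n).1),
  (fun n => (p n).2.1 - (p n).1.1), (fun n => (p n).2 - (p n).1); split.
- by split => n; apply/KM; case: (K12 n).
- by split; apply: cvgK => n; case: (K12 n).
- split => //; apply/cvgrPdist_lt => e e0.
  have e20 : 0 < e / 2 by rewrite divr_gt0.
  apply: filterS (sm _ e20) => n hn; rewrite sub0r normrN gtr0_norm//.
  apply: lt_trans (small n) _; move: hn; move: (n.+1%:R^-1) => q.
  by rewrite mulr2n => h; rewrite [ltRHS]splitr; apply: ltrD.
(* Both coordinates of the difference are below 2/(n+1), hence below 1/2 once 1/(n+1) < 1/4. *)
- have q0 : 0 < 4^-1 :> R by rewrite invr_gt0.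
  apply: filterS (sm _ q0) => n hn; split.
  + by rewrite coveringB.
  + have := small n; have := pos n; move: hn; move: (n.+1%:R^-1) => w hn.
    rewrite /= mulr2n => h1 h2.
    by apply/andP; split; lra.
  + have := small2 n; move: hn; move: (n.+1%:R^-1) => w hn.
    rewrite ltr_norml /= mulr2n => /andP[h1 h2].
    by apply/andP; split; lra.
apply/cvgrPdist_lt => e e0; apply: filterS (sm e e0) => n hn.
rewrite (_ : _ *: _ = ((1, slope (p n).1 (p n).2) : plane R)).
  have [_ h] := hp n; rewrite prod_normE /= gt_max subrr normr0 e0 /= distrC.
  exact: le_lt_trans hn.
congr pair; rewrite /slope /=.
  exact: (mulVf (lt0r_neq0 (pos n))).
exact: mulrC.
Qed.

(** The vectors (1, U) and (1, L) are paratangent, so a line containing the cone forces U = L;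
    conversely equal slopes confine the cone to one line. *)
Lemma C1_regularP x : K x -> C1_regular_at M (covering x) <->
  upper_slope K C (covering x) = lower_slope K C (covering x).
Proof.
move=> Kx; split.
  move=> [D dimD hD].
  have h1 := hD _ (limit_slope_paratangent (upper_slope_limit TS Kx)).
  have h2 := hD _ (limit_slope_paratangent (lower_slope_limit TS Kx)).
  move: h1 h2; set s := upper_slope _ _ _; set t := lower_slope _ _ _ => h1 h2.
  have n0 : ((1, s) : plane R) != 0 by apply/eqP => -[/eqP]; rewrite oner_eq0.
  have DE : (<[(1, s) : plane R]> = D)%VS.
    by apply/eqP; rewrite eqEdim -memvE h1 dimD dim_vline n0.
  move: h2; rewrite -DE => /vlineP[k [e1 e2]].
  have k1 : k = 1 by rewrite -[LHS]mulr1; exact/esym.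
  by rewrite e2 k1 scale1r.
move=> eqs; set s := upper_slope K C (covering x).
exists (<[(1, s) : plane R]>)%VS.
  by rewrite dim_vline; case: eqP => // -[/eqP]; rewrite oner_eq0.
move=> v hv; have := paratangent_slope Kx hv erefl (esym eqs).
rewrite -/s => e; apply/vlineP; exists v.1.
case: v e {hv} => v1 v2 /= ->; congr pair; first exact/esym/mulr1.
exact: mulrC.
Qed.

End Regularity.

(** * Absence of contraction *)

Section AperiodicCircleMaps.
Variables (R : realType) (H : R -> R).
Hypothesis cH : continuous H.
Hypothesis H1 : forall t, H (t + 1) = H t + 1.

Lemma lift_int (k : int) t : H (t + k%:~R) = H t + k%:~R.
Proof.
have nat_case (n : nat) s : H (s + n%:R) = H s + n%:R.
  elim: n s => [|n ih] s; first by rewrite !addr0.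
  by rewrite -natr1 addrA H1 ih addrA.
case: k => n; first exact: nat_case.
have := nat_case n.+1 (t + (Negz n)%:~R).
rewrite NegzE intrN -pmulrn subrK => ->; ring.
Qed.

Lemma iter_lift_int m (k : int) t : iter m H (t + k%:~R) = iter m H t + k%:~R.
Proof. by elim: m => //= m ->; rewrite lift_int. Qed.

Lemma continuous_iter m : continuous (iter m H).
Proof.
elim: m => [|m ih]; first by move=> t; exact: cvg_id.
by move=> t; apply: (@continuous_comp _ _ _ (iter m H) H); [exact: ih|exact: cH].
Qed.

(** The displacement is continuous and 1-periodic, so its absolute value attains a minimum, nonzero
    by hypothesis. *)
Lemma displacement_gap m (k : int) : (forall t, iter m H t + k%:~R != t) ->
  exists2 e : R, 0 < e & forall t, e <= `|iter m H t + k%:~R - t|.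
Proof.
move=> ap; pose psi t := `|iter m H t + k%:~R - t|.
have cpsi : continuous psi.
  move=> t; apply: cvg_norm; apply: cvgB; last exact: cvg_id.
  by apply: cvgD; [exact: continuous_iter|exact: cvg_cst].
have [s _ hs] := @EVT_min R psi 0 1 ler01 (continuous_subspaceT cpsi).
exists (psi s); first by rewrite normr_gt0 subr_eq0.
move=> t.
have -> : `|iter m H t + k%:~R - t| = psi (t - (Num.floor t)%:~R).
  by rewrite /psi -intrN iter_lift_int; congr `|_|; ring.
apply: hs; rewrite in_itv /=; have /andP[h1 h2] := floor_itv t.
by move: h1 h2; rewrite intrD; move: (_%:~R) => w h1 h2; apply/andP; split; lra.
Qed.

End AperiodicCircleMaps.

Section NoContraction.
Variables (R : realType) (f g : annulus R -> annulus R) (F G : plane R -> plane R).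
Variables (H H' : R -> R) (K : set (plane R)) (C : R) (a b c d : plane R -> R).
Variables (a' b' c' d' : plane R -> R).
Hypothesis TS : twist_system f F G H K C a b c d.
Hypothesis TS' : twist_system g G F H' K C a' b' c' d'.
Variable M : set (annulus R).
Hypothesis KM : forall x, K x <-> M (covering x).
Variable mu : probability (borel_annulus R) R.
Hypothesis mM : measurable (M : set (borel_annulus R)).
Hypothesis muM : mu (~` M) = 0%E.
Hypothesis fmu : invariant_measure mu f.

Local Notation q := (log_dquot F).
Local Notation phi n := (usup K (ln C) q n).

Let C0 : 0 < C. Proof. exact: lt_le_trans ltr01 (ts_C_ge1 TS). Qed.
Let lnC0 : 0 <= ln C. Proof. by rewrite ln_ge0// (ts_C_ge1 TS). Qed.

Lemma covering_iter n x : covering (iter n F x) = iter n f (covering x).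
Proof. by elim: n => //= n <-; exact: (ts_lift TS).2. Qed.

Lemma K_iter n x : K x -> K (iter n F x).
Proof. by move=> Kx; elim: n => //= n; exact: (ts_K_F TS). Qed.

Lemma deck_iter n k x : iter n F (deck k x) = deck k (iter n F x).
Proof. by elim: n => //= n ->; exact: (ts_deck TS). Qed.

Lemma H_iter n x : K x -> (iter n F x).1 = iter n H x.1.
Proof. by move=> Kx; elim: n => //= n <-; rewrite (ts_H TS)//; exact: K_iter. Qed.

Lemma measurable_f : measurable_fun setT (f : borel_annulus R -> borel_annulus R).
Proof. exact: (continuous_annulus_measurable (continuous_annulusP (ts_lift TS))). Qed.

Lemma bounded_measurable_usup n :
  bounded_measurable (phi n : borel_annulus R -> R).
Proof.
split; first exact: (measurable_usup lnC0 (log_dquot_bounded TS TS')).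
by exists (ln C) => p; exact: (usup_bounded lnC0 (log_dquot_bounded TS TS')).
Qed.

(** On the graph K a horizontal distance below 1/((n+1) C) keeps the vertical one below 1/(n+1), so
    the pair is among those over which [usup] at x is taken. The radius depends on n only, not on
    x. *)
Lemma one_step_contraction n x y : K x -> K y -> `|y.1 - x.1| < n.+1%:R^-1 / C ->
  `|(F y).1 - (F x).1| <= expR (phi n (covering x)) * `|y.1 - x.1|.
Proof.
move=> Kx Ky xy; pose dl : R := n.+1%:R^-1.
have dl0 : 0 < dl by rewrite invr_gt0.
have xy1 : `|y.1 - x.1| < dl.
  by apply: lt_le_trans xy _; rewrite ler_pdivrMr// ler_peMr ?(ts_C_ge1 TS)// ltW.
have xy2 : `|y.2 - x.2| < dl.
  by apply: le_lt_trans (ts_graph TS Ky Kx) _; rewrite mulrC -ltr_pdivlMr.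
have bx : box x dl x by exact: box_center.
have by_ : box x dl y by [].
have step p r : pairs_at K x dl (p, r) ->
    (F r).1 - (F p).1 <= expR (phi n (covering x)) * (r.1 - p.1).
  move=> h; have [/= Kp Kr pr _ _] := h.
  have rp : 0 < r.1 - p.1 by rewrite subr_gt0.
  rewrite -ler_pdivrMr// -/(dquot F p r).
  have X0 : 0 < dquot F p r.
    by apply: lt_le_trans (dquot_ge TS TS' Kp Kr pr); rewrite invr_gt0.
  rewrite -{1}[dquot F p r]lnK ?posrE// ler_expR.
  exact: (le_usup lnC0 (log_dquot_bounded TS TS') h).
have [l|l|l] := ltgtP x.1 y.1.
- rewrite !gtr0_norm ?subr_gt0//; first exact: step.
  exact: (ts_mono TS).
- rewrite distrC [X in _ <= _ * X]distrC !gtr0_norm ?subr_gt0//; first exact: step.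
  exact: (ts_mono TS).
- have := ts_graph TS Kx Ky; rewrite l subrr normr0 mulr0 normr_le0 subr_eq0 => /eqP e.
  have -> : x = y by case: (x) (y) l e => [? ?] [? ?] /= -> ->.
  by rewrite !subrr normr0 mulr0.
Qed.

(* A negative integral would make [F] contract a whole neighbourhood in [K] of
   some recurrent point, which would then be attracted by a periodic orbit of [H]. *)
Lemma no_contraction n : 0 <= \int[mu]_p phi n p.
Proof.
rewrite leNgt; apply/negP => J0; set J := \int[mu]_p phi n p in J0.
(* Half of the negative integral is kept as a rate of contraction; the other half keeps the integral
   of psi negative. *)
pose eta := - J / 2.
have eta0 : 0 < eta by rewrite divr_gt0// oppr_gt0.
pose psi p := phi n p + eta.
have bphi := bounded_measurable_usup n.
have bpsi : bounded_measurable (psi : borel_annulus R -> R).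
  exact: (bounded_measurableD bphi (bounded_measurable_cst _ eta)).
have Jpsi : \int[mu]_p psi p < 0.
  rewrite RintegralD//; last 2 first.
  - exact: bounded_measurable_integrable.
  - exact: (bounded_measurable_integrable mu (bounded_measurable_cst _ eta)).
  by rewrite Rintegral_cst_probability -/J /eta; lra.
have A0 := maximal_ergodic measurable_f fmu bpsi Jpsi.
set A := [set p | _] in A0.
have mA : measurable (A : set (borel_annulus R)).
  rewrite [A](_ : _ = \bigcap_n (birkhoff_sum f psi n @^-1` `]-oo, 0])).
    apply: bigcapT_measurable => k; rewrite -[X in measurable X]setTI.
    by apply: measurable_birkhoff_sum => //; [exact: measurable_f|case: bpsi].
  apply/seteqP; split => p /= h k; first by move=> _; rewrite /= in_itv/=.
  by have := h k I; rewrite /= in_itv.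
pose r := n.+1%:R^-1 / C.
have r0 : 0 < r by rewrite divr_gt0 ?invr_gt0.
have r20 : 0 < r / 2 by rewrite divr_gt0.
(* Strips of width r. Countably many cover the annulus, so one of them meets A and M in positive
   measure, and two lifts taken in the same strip are at horizontal distance below r. *)
pose V (j : nat) := @covering R @` [set x | `|x.1 - j%:R * (r / 2)| < r / 2].
have mV j : measurable (V j : set (borel_annulus R)).
  apply: sub_sigma_algebra; apply: open_covering.
  rewrite openE => x /= hx; apply/nbhs_box.
  exists (r / 2 - `|x.1 - j%:R * (r / 2)|); first by rewrite subr_gt0.
  move=> y [y1 _] /=.
  rewrite (_ : y.1 - _ = (y.1 - x.1) + (x.1 - j%:R * (r / 2))); last by ring.
  by apply: le_lt_trans (ler_normD _ _) _; rewrite -ltrBrDr.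
pose B j := A `&` V j `&` M.
have mB j : measurable (B j : set (borel_annulus R)).
  by apply: measurableI => //; exact: measurableI.
have [j Bj0] : exists j, (0 < mu (B j))%E.
  apply: contrapT => no.
  have B0 j : mu (B j) = 0%E.
    by apply/eqP; rewrite -measure_le0 leNgt; apply/negP => h; apply: no; exists j.
  suff : (mu A <= 0)%E by rewrite leNgt A0.
  have neg : mu.-negligible (~` M `|` \bigcup_j B j).
    apply: negligibleU.
      by exists (~` M); split => //; exact: measurableC.
    by apply: negligible_bigcup => j; exists (B j); split; [exact: mB|exact: B0|].
  have sub : A `<=` ~` M `|` \bigcup_j B j.
    move=> p Ap; have [Mp|] := pselect (M p); last by left.
    right; have [x xp] := covering_surj p.
    pose y := deck (- Num.floor x.1) x.
    have y0 : 0 <= y.1.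
      have /andP[h _] := floor_itv x.1.
      by rewrite /y /deck /= intrN subr_ge0.
    pose j := Num.trunc (y.1 / (r / 2)).
    exists j => //; split => //; split => //; exists y; last by rewrite covering_deck.
    have /andP[t1 t2] := truncn_itv (divr_ge0 y0 (ltW r20)).
    move: t1 t2; rewrite -/j ler_pdivlMr// ltr_pdivrMr// => t1 t2.
    rewrite /mkset ger0_norm ?subr_ge0// ltrBlDr; apply: lt_le_trans t2 _.
    by rewrite -[j.+1%:R]natr1 mulrDl mul1r addrC.
  have [N [mN N0 AN]] := negligibleS sub neg.
  rewrite -N0; apply: le_measure => //; exact/mem_set.
have [p [[Ap [x hx xp]] Mp] [m m0 [[_ [y hy yp]] Mq]]] :=
  poincare_recurrence measurable_f fmu (mB j) Bj0.
have Kx : K x by apply/KM; rewrite xp.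
have Ky : K y by apply/KM; rewrite yp.
have [k yE] : exists k, y = deck k (iter m F x).
  by apply: covering_eq_deck; rewrite yp covering_iter xp.
have xy : `|y.1 - x.1| < r.
  rewrite (_ : y.1 - x.1 = (y.1 - j%:R * (r / 2)) - (x.1 - j%:R * (r / 2))); last by ring.
  by apply: le_lt_trans (ler_normB _ _) _; rewrite [ltRHS]splitr; apply: ltrD.
have sumE i : birkhoff_sum f psi i p = birkhoff_sum f (phi n) i p + i%:R * eta.
  rewrite /birkhoff_sum big_split /=; congr (_ + _).
  by rewrite sumr_const card_ord -[eta *+ i]mulr_natl.
have sum_le i : birkhoff_sum f (phi n) i p <= - (i%:R * eta).
  by have := Ap i; rewrite /= sumE; lra.
(* The sums along p are nonpositive since p lies in A; the distance therefore never exceeds its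
   initial value, and the next step of contraction applies. *)
have contr i : `|(iter i F y).1 - (iter i F x).1|
    <= expR (birkhoff_sum f (phi n) i p) * `|y.1 - x.1|.
  elim: i => [|i ih]; first by rewrite /birkhoff_sum big_ord0 expR0 mul1r.
  rewrite !iterS.
  have lt_r : `|(iter i F y).1 - (iter i F x).1| < r.
    apply: le_lt_trans ih _; apply: le_lt_trans xy.
    rewrite ler_piMl// -[leRHS]expR0 ler_expR (le_trans (sum_le i))//.
    by rewrite oppr_le0 mulr_ge0// ltW.
  apply: le_trans (one_step_contraction (K_iter i Kx) (K_iter i Ky) lt_r) _.
  rewrite covering_iter xp birkhoff_sumSr [birkhoff_sum _ _ _ _ + _]addrC expRD -mulrA.
  by apply: ler_wpM2l => //; exact: expR_ge0.
(* With t the first coordinate of the i-th iterate of x, the horizontal distance of the two orbits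
   is |H^m t + k - t|. It is bounded away from 0, whereas [contr] makes it tend to 0. *)
have [e e0 he] := displacement_gap (ts_H_cont TS) (ts_H1 TS)
  (fun t => ts_aperiodic TS k t m0).
have low i : e <= r * (expR (i%:R * eta))^-1.
  apply: le_trans (he (iter i H x.1)) _.
  have -> : iter m H (iter i H x.1) + k%:~R - iter i H x.1 =
      (iter i F y).1 - (iter i F x).1.
    by rewrite yE deck_iter /deck /= -!iterD (H_iter (i + m))// H_iter// addnC.
  apply: le_trans (contr i) _; rewrite mulrC -expRN.
  apply: ler_pM; rewrite ?expR_ge0//; first exact: ltW.
  by rewrite ler_expR.
(* This choice gives e (i eta) > r, which contradicts [low] through exp(t) >= 1 + t. *)
pose i := Num.bound (r / (e * eta)).
have := low i; rewrite -ler_pdivrMr ?invr_gt0 ?expR_gt0// invrK.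
rewrite leNgt => /negP; apply.
have hi : r / (e * eta) < i%:R by apply: archi_boundP; rewrite ltW// divr_gt0// (mulr_gt0 e0 eta0).
have : r < e * (i%:R * eta).
  move: hi; rewrite (ltr_pdivrMr _ _ (mulr_gt0 e0 eta0)) => hi.
  by rewrite (_ : e * _ = i%:R * (e * eta)) //; ring.
have : e * (1 + i%:R * eta) <= e * expR (i%:R * eta).
  by rewrite ler_pM2l// expR_ge1Dx.
by rewrite mulrDr mulr1; lra.
Qed.

Lemma integral_log_growth_ge0 : 0 <= \int[mu]_p ulim K (ln C) q p.
Proof.
have bq := log_dquot_bounded TS TS'.
have cv := @Rintegral_dominated_cvg _ _ _ mu (fun n => phi n) (ulim K (ln C) q) (ln C)
  (fun n => (bounded_measurable_usup n).1) (measurable_ulim lnC0 bq)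
  (fun n p => usup_bounded lnC0 bq n p)
  (aeW mu (usup_cvg lnC0 bq)).
rewrite -(cvg_lim _ cv)//; apply: limr_ge; first exact: cvgP cv.
by apply: nearW => n; exact: no_contraction.
Qed.

End NoContraction.

(** * Lyapunov exponents *)

Lemma average_perturbation (R : realType) (u v : nat -> R) (l B : R) :
  (fun n => n%:R^-1 * u n) @ \oo --> l -> (forall n, `|v n - u n| <= B) ->
  (fun n => n%:R^-1 * v n) @ \oo --> l.
Proof.
move=> hu hB; apply/cvgrPdist_lt => e e0.
have e20 : 0 < e / 2 by rewrite divr_gt0.
have /cvgrPdist_lt/(_ _ e20)[N1 _ h1] := hu.
pose N2 := Num.bound (`|B| / (e / 2)).
exists (maxn N1 N2.+1) => // n /=; rewrite geq_max => /andP[n1 n2].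
have n0 : 0 < n%:R :> R by rewrite ltr0n (leq_trans _ n2).
have := h1 n n1; rewrite /= => hl.
have hv : `|n%:R^-1 * (v n - u n)| < e / 2.
  rewrite normrM gtr0_norm ?invr_gt0// ltr_pdivrMl//.
  apply: le_lt_trans (hB n) _; apply: le_lt_trans (ler_norm _) _.
  rewrite -ltr_pdivrMr//; apply: (@lt_le_trans _ _ N2%:R).
    by apply: archi_boundP; rewrite divr_ge0// ltW.
  by rewrite ler_nat ltnW.
rewrite (_ : l - _ = (l - n%:R^-1 * u n) - n%:R^-1 * (v n - u n)); last by ring.
by apply: le_lt_trans (ler_normB _ _) _; rewrite [ltRHS]splitr; apply: ltrD.
Qed.

Lemma scale_line (R : realType) (k t : R) : k *: ((1, t) : plane R) = (k, k * t).
Proof. by congr pair => /=; exact: mulr1. Qed.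

Section LineGrowth.
Variables (R : realType) (f g : annulus R -> annulus R) (F G : plane R -> plane R).
Variables (H H' : R -> R) (K : set (plane R)) (C : R) (a b c d : plane R -> R).
Variables (a' b' c' d' : plane R -> R).
Hypothesis TS : twist_system f F G H K C a b c d.
Hypothesis TS' : twist_system g G F H' K C a' b' c' d'.
Implicit Types (x y z v : plane R) (p : annulus R).

(* An invariant line field on [K], spanned by (1, s). *)
Variable s : annulus R -> R.
Hypothesis s_bounded : forall p, `|s p| <= C.
Hypothesis s_limit : forall x, K x -> limit_slope K x (s (covering x)).
Hypothesis s_image : forall x, K x -> s (covering (F x)) =
  (c x + d x * s (covering x)) / (a x + b x * s (covering x)).

Let C0 : 0 < C. Proof. exact: lt_le_trans ltr01 (ts_C_ge1 TS). Qed.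
Let lnC0 : 0 <= ln C. Proof. by rewrite ln_ge0// (ts_C_ge1 TS). Qed.

(* Outside of [K] the logarithm need not be bounded, whence the truncation. *)
Definition line_growth p : R := Num.max (- ln C) (Num.min (ln C)
  (ln ((tangent f p (1, 0)).1 + (tangent f p (0, 1)).1 * s p))).

Lemma tangent_entries x : (tangent f (covering x) (1, 0)).1 = a x /\
  (tangent f (covering x) (0, 1)).1 = b x.
Proof.
have dF : differentiable F x by case: (ts_jac TS).
rewrite (tangentE (ts_lift TS) dF) (jacobian_diff (ts_jac TS)) /=.
by rewrite !mul1r !mul0r addr0 (jacobian_diff (ts_jac TS)) /= mul0r mul1r add0r.
Qed.

Lemma line_growth_bounded p : `|line_growth p| <= ln C.
Proof.
by rewrite ler_norml /line_growth le_max lexx /= ge_max ge_min lexx ge0_cp.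
Qed.

Lemma line_growthE x : K x ->
  line_growth (covering x) = ln (a x + b x * s (covering x)).
Proof.
move=> Kx; rewrite /line_growth; have [-> ->] := tangent_entries x.
have [/andP[h1 h2] h0] := growth_bounds TS TS' (s_limit Kx).
rewrite min_r; last by rewrite ler_ln ?posrE.
by rewrite max_r// -lnV ?posrE// ler_ln ?posrE ?invr_gt0.
Qed.

Lemma exp_line_growth x : K x ->
  expR (line_growth (covering x)) = a x + b x * s (covering x).
Proof.
move=> Kx; rewrite line_growthE// lnK// posrE.
by have [] := growth_bounds TS TS' (s_limit Kx).
Qed.

Lemma measurable_line_growth :
  measurable_fun setT (s : borel_annulus R -> R) ->
  measurable_fun setT (line_growth : borel_annulus R -> R).
Proof.
move=> ms; have [_ [_ ca cb _] _] := ts_jac TS.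
have ma : measurable_fun setT
    ((fun p => (tangent f p (1, 0)).1) : borel_annulus R -> R).
  by apply: (continuous_lift_measurable ca) => x; have [] := tangent_entries x.
have mb : measurable_fun setT
    ((fun p => (tangent f p (0, 1)).1) : borel_annulus R -> R).
  by apply: (continuous_lift_measurable cb) => x; have [] := tangent_entries x.
apply: measurable_maxr; first exact: measurable_cst.
apply: measurable_minr; first exact: measurable_cst.
apply: measurableT_comp; first exact: measurable_ln.
by apply: measurable_funD => //; exact: measurable_funM.
Qed.

Fixpoint iter_diff n x v : plane R :=
  if n is m.+1 then let y := iter m F x in let w := iter_diff m x v in
    (w.1 * a y + w.2 * b y, w.1 * c y + w.2 * d y)
  else v.

Lemma is_diff_iter n x : is_diff x (iter n F) (iter_diff n x).
Proof.
elim: n => [|n ih]; first exact: is_diff_id.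
exact: (is_diff_comp ih (jacobian_is_diff (ts_jac TS) (iter n F x))).
Qed.

Lemma is_lift_iter n : is_lift (iter n f) (iter n F).
Proof.
split; last by move=> x; exact: (covering_iter TS).
move=> x; apply: differentiable_continuous.
by have [] := is_diff_iter n x.
Qed.

Lemma tangent_iter n x v : tangent (iter n f) (covering x) v = iter_diff n x v.
Proof.
have [h1 h2] := is_diff_iter n x.
by rewrite (tangentE (is_lift_iter n) h1) h2.
Qed.

Local Notation S n x := (birkhoff_sum f line_growth n (covering x)).

(** The off-diagonal entry of the derivative of the n-th iterate, from the frame at x to the frame
    at its image. *)
Fixpoint shear n x : R :=
  if n is m.+1 then expR (line_growth (covering (iter m F x))) * shear m x
    + b (iter m F x) * expR (- S m x) else 0.

(* In the frame (1, s), (0, 1), the derivatives of the iterates are triangular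
   with diagonal exp(S_n), exp(- S_n). *)
Lemma iter_diffE n x v : K x ->
  let w := v.2 - v.1 * s (covering x) in
  let t := v.1 * expR (S n x) + w * shear n x in
  iter_diff n x v = (t, t * s (covering (iter n F x)) + w * expR (- S n x)).
Proof.
move=> Kx /=; set w := v.2 - _.
elim: n => [|n ih].
  rewrite /birkhoff_sum big_ord0 oppr0 expR0 /= mulr0 addr0 !mulr1.
  by rewrite /w addrC subrK -surjective_pairing.
have Ky := K_iter TS n Kx.
have [_ A0] := growth_bounds TS TS' (s_limit Ky).
have A0' : a (iter n F x) + b (iter n F x) * s (covering (iter n F x)) != 0 by rewrite gt_eqF.
have shE : shear n.+1 x = (a (iter n F x) + b (iter n F x) * s (covering (iter n F x)))
    * shear n x + b (iter n F x) * expR (- S n x).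
  by rewrite -exp_line_growth.
rewrite [iter_diff _ _ _]/= ih shE [iter n.+1 F x]/= s_image//.
rewrite birkhoff_sumSr -(covering_iter TS) opprD !expRD [expR (- line_growth _)]expRN.
rewrite exp_line_growth//.
move: (ts_det TS (iter n F x)) A0'.
move: (a (iter n F x)) (b (iter n F x)) (c (iter n F x)) (d (iter n F x)) (s (covering (iter n F x))).
move: (expR (S n x)) (expR (- S n x)) (shear n x) => E E' q A B Cc D sn det A0' /=.
have DE : D * A = 1 + B * Cc by rewrite -det; ring.
congr pair; first by ring.
(* The vertical vector (0, 1) is sent to (B, D); its component along (1, s) is B, and determinant 1
   makes the remaining vertical component 1 / (A + B sn). *)
have key : (B * (Cc + D * sn) + 1) / (A + B * sn) = D.
  have -> : B * (Cc + D * sn) + 1 = D * (A + B * sn) by rewrite [RHS]mulrDr DE; ring.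
  by rewrite mulfK.
transitivity ((v.1 * E + w * q) * (Cc + D * sn)
    + w * E' * ((B * (Cc + D * sn) + 1) / (A + B * sn))).
  by rewrite key; ring.
by clearbody w; field.
Qed.

Lemma frame_norm_bounds p : 1 <= `|((1, s p) : plane R)| <= C.
Proof.
by rewrite prod_normE /= normr1 le_max lexx ge_max (ts_C_ge1 TS) s_bounded.
Qed.

(** On the invariant line the norm is |k| exp(S_n) times that of a vector (1, s), which lies between
    1 and C, so its logarithm differs from S_n by a bounded amount. *)
Lemma line_exponent x k l : K x -> k != 0 ->
  (fun n => n%:R^-1 * S n x) @ \oo --> l ->
  exponent_at f (covering x) (k *: ((1, s (covering x)) : plane R)) l.
Proof.
move=> Kx k0 hl; apply: (average_perturbation (B := `|ln `|k| | + ln C) hl) => n.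
rewrite scale_line tangent_iter iter_diffE//= subrr !mul0r !addr0.
set sn := s _; set E := expR _.
have -> : ((k * E, k * E * sn) : plane R) = (k * E) *: ((1, sn) : plane R).
  by rewrite scale_line.
have E0 : 0 < E by exact: expR_gt0.
have k0' : 0 < `|k| by rewrite normr_gt0.
have /andP[n1 n2] := frame_norm_bounds (covering (iter n F x)).
rewrite -/sn in n1 n2; move: n1 n2; set N := `|(1, sn)| => n1 n2.
have N0 : 0 < N by apply: lt_le_trans n1.
rewrite normrZ normrM (gtr0_norm E0) -/N.
have -> : ln (`|k| * E * N) = ln `|k| + S n x + ln N.
  by rewrite lnM ?posrE ?mulr_gt0// lnM ?posrE// /E expRK.
have lN0 : 0 <= ln N by rewrite ln_ge0.
have lN1 : ln N <= ln C by rewrite ler_ln ?posrE.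
rewrite (_ : _ - _ = ln `|k| + ln N); last by ring.
by apply: le_trans (ler_normD _ _) _; rewrite lerD2l ger0_norm.
Qed.

(** Off the line, the norm is bounded below through the vertical component w exp(-S_n) and above
    through the shear, a sum of n terms of subexponential size. *)
Lemma zero_exponent x v : K x -> v != 0 ->
  (fun n => n%:R^-1 * S n x) @ \oo --> (0 : R) ->
  exponent_at f (covering x) v 0.
Proof.
move=> Kx v0 h0; set w := v.2 - v.1 * s (covering x).
have [w0|w0] := eqVneq w 0.
  have v10 : v.1 != 0.
    apply: contra v0 => /eqP e1; apply/eqP; move: w0; rewrite /w e1 mul0r subr0.
    by case: v e1 {w} => ? ? /= -> ->.
  have -> : v = v.1 *: ((1, s (covering x)) : plane R).
    rewrite scale_line [LHS]surjective_pairing; congr pair.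
    by apply/eqP; rewrite -subr_eq0; apply/eqP.
  exact: line_exponent.
apply/cvgrPdist_le => e e0.
(* The upper bound spends four shares per iterate, three on [U n ^+ 3] and one on the factor n + 1;
   the fifth absorbs the constants for large n. *)
pose ep := e / 5.
have ep0 : 0 < ep by rewrite divr_gt0.
have /cvgrPdist_le/(_ _ ep0)[N _ hN] := h0.
(* T absorbs the sums of index below N, so that [hT] holds for every n. *)
pose T := \sum_(i < N) `|S i x|.
have T0 : 0 <= T by exact: sumr_ge0.
have hT n : `|S n x| <= ep * n%:R + T.
  have [nN|Nn] := ltnP n N.
    apply: ler_wpDl; first by rewrite mulr_ge0// ltW.
    by rewrite /T (bigD1 (Ordinal nN))//= lerDl sumr_ge0.
  apply: ler_wpDr => //; have [->|n0] := posnP n.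
    by rewrite /birkhoff_sum big_ord0 normr0 mulr0.
  have n0' : 0 < n%:R :> R by rewrite ltr0n.
  have := hN n Nn; rewrite /= sub0r normrN normrM gtr0_norm ?invr_gt0//.
  by rewrite ler_pdivrMl// mulrC.
have hb n : `|b (iter n F x)| <= C by exact: (ts_b TS (K_iter TS n Kx)).
pose U n := expR (ep * n%:R + T).
have U0 n : 0 < U n by exact: expR_gt0.
have U1 n : 1 <= U n by rewrite -expR0 ler_expR addr_ge0// mulr_ge0// ltW.
have ES n : expR (S n x) <= U n by rewrite ler_expR (le_trans (ler_norm _)).
have EN n : expR (- S n x) <= U n.
  by rewrite ler_expR (le_trans (ler_norm _))// normrN.
have Unm m n : (m <= n)%N -> U m <= U n.
  by move=> mn; rewrite ler_expR lerD2r ler_pM2l// ler_nat.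
(* Divided by exp(S_n), the recursion of the shear becomes additive: each step adds at most C
   exp(-S_n) exp(-S_(n+1)) in absolute value. *)
have hq n : `|shear n x| * expR (- S n x) <= n%:R * (C * U n ^+ 2).
  elim: n => [|n ih]; first by rewrite normr0 !mul0r.
  have Ky := K_iter TS n Kx.
  rewrite [shear n.+1 x]/=.
  apply: le_trans (ler_wpM2r (expR_ge0 _) (ler_normD _ _)) _.
  rewrite mulrDl -natr1 mulrDl mul1r; apply: lerD.
    rewrite normrM gtr0_norm ?expR_gt0// birkhoff_sumSr -(covering_iter TS) opprD expRD.
    rewrite [X in X <= _](_ : _ = `|shear n x| * expR (- S n x)); last first.
      by rewrite [expR (- line_growth _)]expRN; field; rewrite gt_eqF ?expR_gt0.
    have UU : U n ^+ 2 <= U n.+1 ^+ 2.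
      by have Un := Unm _ _ (leqnSn n); rewrite !expr2; apply: ler_pM; rewrite ?(ltW (U0 _)).
    by apply: le_trans ih _; rewrite ler_wpM2l// ler_pM2l.
  rewrite normrM (gtr0_norm (expR_gt0 _)) -mulrA.
  apply: ler_pM; [by []|by rewrite mulr_ge0 ?expR_ge0|exact: hb|].
  rewrite expr2; apply: ler_pM; rewrite ?expR_ge0//.
  exact: le_trans (EN n) (Unm _ _ (leqnSn n)).
have hq' n : `|shear n x| <= n%:R * (C * U n ^+ 3).
  have -> : `|shear n x| = `|shear n x| * expR (- S n x) * expR (S n x).
    by rewrite -mulrA [_ * expR (S n x)]mulrC expRxMexpNx_1 mulr1.
  rewrite exprSr !mulrA; apply: ler_pM; [|exact: expR_ge0| |exact: ES].
    by rewrite mulr_ge0 ?expR_ge0.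
  rewrite -!mulrA; exact: hq.
pose Q := `|v.1| + `|w| * C + `|w|.
have Q0 : 0 < Q.
  by rewrite /Q ltr_wpDl ?normr_gt0// addr_ge0// mulr_ge0// ltW.
have up n : `|iter_diff n x v| <= 2 * C * (Q * (n.+1%:R * U n ^+ 3)).
  have Un3 : U n <= U n ^+ 3 by rewrite -{1}[U n]expr1; apply: ler_weXn2l.
  have U30 : 0 <= U n ^+ 3 by rewrite exprn_ge0// ltW.
  have n1 : 1 <= n.+1%:R :> R by rewrite ler1n.
  have nU : U n <= n.+1%:R * U n ^+ 3.
    by apply: le_trans Un3 _; rewrite ler_peMl.
  have nU0 : 0 <= n.+1%:R * U n ^+ 3 by exact: mulr_ge0.
  have t1 : `|v.1 * expR (S n x) + w * shear n x| <= Q * (n.+1%:R * U n ^+ 3).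
    apply: le_trans (ler_normD _ _) _; rewrite !normrM (gtr0_norm (expR_gt0 _)).
    rewrite /Q !mulrDl; apply: ler_wpDr; first by rewrite mulr_ge0.
    apply: lerD.
      by apply: ler_pM; rewrite ?expR_ge0//; exact: le_trans (ES n) nU.
    rewrite -mulrA; apply: ler_wpM2l => //; apply: le_trans (hq' n) _.
    by rewrite mulrCA; apply: ler_wpM2l; rewrite ?(ltW C0)// ler_wpM2r// ler_nat.
  have t2 : `|w * expR (- S n x)| <= Q * (n.+1%:R * U n ^+ 3).
    rewrite normrM (gtr0_norm (expR_gt0 _)); apply: ler_pM; rewrite ?expR_ge0//.
      by rewrite /Q lerDr addr_ge0// mulr_ge0// ltW.
    exact: le_trans (EN n) nU.
  have C1 := ts_C_ge1 TS.
  rewrite iter_diffE//= -/w; move: t1 t2; set t := _ + w * _; set Z := Q * _.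
  move=> t1 t2; have Z0 : 0 <= Z by exact: le_trans t1.
  have CZ : Z <= C * Z by rewrite ler_peMl.
  rewrite prod_normE /= ge_max -mulrA; apply/andP; split.
    by apply: le_trans t1 _; lra.
  apply: le_trans (ler_normD _ _) _; rewrite [`|t * _|]normrM.
  have : `|t| * `|s (covering (iter n F x))| <= Z * C by apply: ler_pM.
  by rewrite [Z * C]mulrC; lra.
(* The vertical component w exp(-S_n) of the image vector is its second coordinate minus s times the
   first, hence at most 1 + C <= 2 C times its norm. *)
have low n : `|w| / (2 * C) * (U n)^-1 <= `|iter_diff n x v|.
  have C1 := ts_C_ge1 TS.
  have Dv : w * expR (- S n x) = (iter_diff n x v).2
      - (iter_diff n x v).1 * s (covering (iter n F x)).
    by rewrite iter_diffE//= -/w [RHS]addrC addKr.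
  have h1 : `|w| * (U n)^-1 <= `|w * expR (- S n x)|.
    rewrite normrM (gtr0_norm (expR_gt0 _)) ler_wpM2l// expRN lef_pV2 ?posrE ?expR_gt0//.
  rewrite mulrAC ler_pdivrMr ?mulr_gt0//; apply: le_trans h1 _; rewrite Dv.
  apply: le_trans (ler_normB _ _) _; rewrite normrM.
  have [m1 m2] : `|(iter_diff n x v).1| <= `|iter_diff n x v| /\
      `|(iter_diff n x v).2| <= `|iter_diff n x v|.
    by rewrite [`|iter_diff n x v|]prod_normE !le_max !lexx orbT.
  have : `|(iter_diff n x v).1| * `|s (covering (iter n F x))| <= `|iter_diff n x v| * C.
    by apply: ler_pM.
  have : `|iter_diff n x v| <= `|iter_diff n x v| * C by rewrite ler_peMr.
  move: m1 m2; move: (`|iter_diff n x v|) => Z; lra.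
have wC : 0 < `|w| / (2 * C) by rewrite divr_gt0 ?normr_gt0// mulr_gt0.
have D0 n : 0 < `|iter_diff n x v|.
  by apply: lt_le_trans (low n); rewrite mulr_gt0// invr_gt0.
have lnU n : ln (U n) = ep * n%:R + T by rewrite /U expRK.
(* The last factor comes from n + 1 <= exp(ep (n + 1)) / ep. *)
pose Q' := 2 * C * Q * (ep^-1 * expR ep).
have Q'0 : 0 < Q' by rewrite !mulr_gt0 ?invr_gt0 ?expR_gt0.
have up' n : ln `|iter_diff n x v| <= ln Q' + 3 * T + 4 * ep * n%:R.
  have h1 : n.+1%:R <= ep^-1 * expR ep * expR (ep * n%:R).
    rewrite -mulrA -expRD -[X in ep + X]/(ep * n%:R).
    rewrite (_ : ep + ep * n%:R = ep * n.+1%:R); last by rewrite -natr1; ring.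
    rewrite ler_pdivlMl//; apply: le_trans (expR_ge1Dx _).
    by rewrite lerDr.
  have h2 : `|iter_diff n x v| <= Q' * (expR (ep * n%:R) * U n ^+ 3).
    apply: le_trans (up n) _.
    rewrite (_ : Q' * _ = 2 * C * (Q * (ep^-1 * expR ep * expR (ep * n%:R) * U n ^+ 3))).
      have C20 : 0 < 2 * C by rewrite mulr_gt0.
      rewrite (ler_pM2l C20) (ler_pM2l Q0) ler_pM2r ?exprn_gt0//.
    by rewrite /Q'; ring.
  have EU0 : 0 < expR (ep * n%:R) * U n ^+ 3 by rewrite mulr_gt0 ?expR_gt0 ?exprn_gt0.
  have h3 : ln (expR (ep * n%:R) * U n ^+ 3) = ep * n%:R + 3 * (ep * n%:R + T).
    by rewrite lnM ?posrE ?expR_gt0 ?exprn_gt0// expRK lnXn// lnU -[(_ + T) *+ 3]mulr_natl.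
  apply: (@le_trans _ _ (ln (Q' * (expR (ep * n%:R) * U n ^+ 3)))).
    by rewrite ler_ln ?posrE// mulr_gt0.
  rewrite lnM ?posrE// h3.
  by lra.
have low' n : ln (`|w| / (2 * C)) - T - ep * n%:R <= ln `|iter_diff n x v|.
  apply: (@le_trans _ _ (ln (`|w| / (2 * C) * (U n)^-1))).
    have -> : ln (`|w| / (2 * C) / U n) = ln (`|w| / (2 * C)) - ln (U n).
      by apply: ln_div; rewrite posrE.
    by rewrite lnU; lra.
  by rewrite ler_ln ?posrE// mulr_gt0// invr_gt0.
move: low' up'; set Y1 := ln Q' + _; set Y2 := ln _ - T => low' up'; clearbody Y1 Y2.
pose N' := Num.bound ((`|Y1| + `|Y2|) / ep).
exists N'.+1 => // n /= hn.
have n0 : 0 < n%:R :> R by rewrite ltr0n (leq_trans _ hn).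
rewrite tangent_iter sub0r normrN normrM gtr0_norm ?invr_gt0// ler_pdivrMl//.
have hBn : `|Y1| + `|Y2| <= n%:R * ep.
  rewrite -ler_pdivrMr//; apply: (@le_trans _ _ N'%:R).
    by apply: ltW; apply: archi_boundP; rewrite divr_ge0 ?addr_ge0// ltW.
  by rewrite ler_nat ltnW.
have eE : n%:R * e = 5 * (n%:R * ep) by rewrite /ep; field.
have := up' n; have := low' n; rewrite -[4 * ep * _]mulrA [ep * n%:R]mulrC.
have := ler_norm Y1; have := ler_norm (- Y2); rewrite normrN.
have := normr_ge0 Y1; have := normr_ge0 Y2.
rewrite ler_norml eE; move: hBn.
move: (ln `|iter_diff n x v|) (`|Y1|) (`|Y2|) (n%:R * ep) => X B1 B2 Z *.
by apply/andP; split; lra.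
Qed.

End LineGrowth.

Section AlmostEverywhereIntegrals.
Context d (T : measurableType d) (R : realType) (mu : probability T R).
Implicit Types u v : T -> R.

Lemma ae_mono (P Q : T -> Prop) : (forall x, P x -> Q x) ->
  {ae mu, forall x, P x} -> {ae mu, forall x, Q x}.
Proof. by move=> PQ; apply: filterS. Qed.

Lemma ae_mono2 (P Q S : T -> Prop) : (forall x, P x -> Q x -> S x) ->
  {ae mu, forall x, P x} -> {ae mu, forall x, Q x} -> {ae mu, forall x, S x}.
Proof. by move=> PQ; apply: filterS2. Qed.

Lemma ae_cst (P : Prop) : {ae mu, forall x : T, P} -> P.
Proof.
move=> [N [mN N0 sN]]; apply: contrapT => no.
have : mu setT = 1%E by exact: (probability_setT mu).
have -> : setT = N by apply/seteqP; split => // x _; apply: sN.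
by rewrite N0 => /eqP; rewrite eq_sym onee_eq0.
Qed.

Lemma Rintegral_ae_eq u v : bounded_measurable u -> bounded_measurable v ->
  {ae mu, forall x, u x = v x} -> \int[mu]_x u x = \int[mu]_x v x.
Proof.
move=> [mu_ _] [mv _] h; rewrite /Rintegral; congr fine.
apply: ae_eq_integral => //; try exact/measurable_EFinP.
by apply: filterS h => x e _; rewrite e.
Qed.

Lemma Rintegral_ae_le u v : bounded_measurable u -> bounded_measurable v ->
  {ae mu, forall x, u x <= v x} -> \int[mu]_x u x <= \int[mu]_x v x.
Proof.
move=> bu bv h; have [m1 [C1 h1]] := bu; have [m2 [C2 h2]] := bv.
have bw : bounded_measurable (fun x => Num.max (u x) (v x)).
  split; first exact: measurable_maxr.
  exists (`|C1| + `|C2|) => x; have := h1 x; have := h2 x.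
  have := ler_norm C1; have := ler_norm C2; have := normr_ge0 C1; have := normr_ge0 C2.
  by case: (leP (u x) (v x)) => *; lra.
have -> : \int[mu]_x v x = \int[mu]_x Num.max (u x) (v x).
  by apply: Rintegral_ae_eq => //; apply: filterS h => x uv; rewrite max_r.
apply: le_Rintegral => //; try exact: bounded_measurable_integrable.
by move=> x _; rewrite le_max lexx.
Qed.

Lemma Rintegral_ae_gt0 u : bounded_measurable u ->
  {ae mu, forall x, 0 < u x} -> 0 < \int[mu]_x u x.
Proof.
move=> bu h; have [m1 [C1 h1]] := bu.
have u0 : 0 <= \int[mu]_x u x.
  rewrite -(Rintegral_cst_probability mu 0).
  apply: Rintegral_ae_le => //; first exact: bounded_measurable_cst.
  by apply: filterS h => x /ltW.
rewrite lt_neqAle u0 andbT; apply/eqP => u_eq0.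
pose B := [set x | 0 < u x].
have mB : measurable B.
  rewrite [B](_ : _ = setT `&` u @^-1` `]0, +oo[); first exact: m1.
  by rewrite setTI; apply/seteqP; split => x; rewrite /B /= in_itv/= andbT.
have iu : mu.-integrable setT (EFin \o u) by exact: bounded_measurable_integrable.
have : (\int[mu]_x `|(u x)%:E| = 0)%E.
  rewrite (_ : (\int[mu]_x `|(u x)%:E|)%E = (\int[mu]_x (u x)%:E)%E); last first.
    apply: ae_eq_integral => //; try exact/measurable_EFinP.
    - by apply: measurableT_comp => //; exact/measurable_EFinP.
    - by apply: filterS h => x ux _; rewrite gee0_abs// lee_fin ltW.
  rewrite -[LHS]fineK ?[X in X%:E](esym u_eq0)//.
  by have := integrable_fin_num measurableT iu.
have mEu : measurable_fun setT (EFin \o u) by exact/measurable_EFinP.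
move=> /(ae_eq_integral_abs mu measurableT mEu) h0.
apply: (@ae_cst False); move: h h0; apply: ae_mono2 => x ux /(_ I) [] e.
by rewrite e ltxx in ux.
Qed.

End AlmostEverywhereIntegrals.

Section SystemIntegrals.
Variables (R : realType) (f g : annulus R -> annulus R) (F G : plane R -> plane R).
Variables (H H' : R -> R) (K : set (plane R)) (C : R) (a b c d : plane R -> R).
Variables (a' b' c' d' : plane R -> R).
Hypothesis TS : twist_system f F G H K C a b c d.
Hypothesis TS' : twist_system g G F H' K C a' b' c' d'.
Variable M : set (annulus R).
Hypothesis KM : forall x, K x <-> M (covering x).
Variable mu : probability (borel_annulus R) R.
Hypothesis mM : measurable (M : set (borel_annulus R)).
Hypothesis muM : mu (~` M) = 0%E.
Hypothesis fmu : invariant_measure mu f.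
Hypothesis ergf : ergodic_measure mu f.

Local Notation sU := (upper_slope K C).
Local Notation sL := (lower_slope K C).
Local Notation lamU := (line_growth f C sU).
Local Notation lamL := (line_growth f C sL).

Let C0 : 0 < C. Proof. exact: lt_le_trans ltr01 (ts_C_ge1 TS). Qed.
Let lnC0 : 0 <= ln C. Proof. by rewrite ln_ge0// (ts_C_ge1 TS). Qed.

Lemma ae_covering_K : {ae mu, forall p : annulus R, exists2 x, K x & covering x = p}.
Proof.
exists (~` M); split => //; first exact: measurableC.
apply: subsetC => p Mp; have [x xp] := covering_surj p.
by exists x => //; apply/KM; rewrite xp.
Qed.

Lemma bounded_measurable_growth s :
  measurable_fun setT (s : borel_annulus R -> R) ->
  bounded_measurable (line_growth f C s : borel_annulus R -> R).
Proof.
move=> ms; split; first exact: (measurable_line_growth TS).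
by exists (ln C) => p; exact: (line_growth_bounded TS).
Qed.

Lemma birkhoff_growth s : measurable_fun setT (s : borel_annulus R -> R) ->
  {ae mu, forall p : annulus R,
    (fun n => n%:R^-1 * birkhoff_sum f (line_growth f C s) n p) @ \oo -->
    \int[mu]_p line_growth f C s p}.
Proof.
move=> ms.
exact: (birkhoff (measurable_f TS) fmu ergf (bounded_measurable_growth ms)).
Qed.

(** At F x the growth of the inverse is d - b s(F x), which determinant 1 turns into 1 / (a + b
    s(x)). *)
Lemma inverse_growth s x : (forall p, `|s p| <= C) ->
  (forall x, K x -> limit_slope K x (s (covering x))) ->
  (forall x, K x -> s (covering (F x)) =
    (c x + d x * s (covering x)) / (a x + b x * s (covering x))) ->
  K x -> line_growth g C s (f (covering x)) = - line_growth f C s (covering x).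
Proof.
move=> s1 s2 s3 Kx; rewrite -(ts_lift TS).2.
have KFx := ts_K_F TS Kx.
rewrite (line_growthE TS' TS s2 KFx) (line_growthE TS TS' s2 Kx) s3//.
have [e1 e2 _ _] := inverse_entries TS TS' x; rewrite e1 e2.
have [_ A0] := growth_bounds TS TS' (s2 _ Kx).
rewrite -lnV ?posrE//; congr ln.
apply: (mulIf (lt0r_neq0 A0)); rewrite mulVf ?gt_eqF//.
rewrite -[RHS](ts_det TS x); move: A0.
move: (a x) (b x) (c x) (d x) (s (covering x)) => A B Cc D sx A0.
by field; rewrite gt_eqF.
Qed.

Lemma integral_inverse_growth s :
  measurable_fun setT (s : borel_annulus R -> R) -> (forall p, `|s p| <= C) ->
  (forall x, K x -> limit_slope K x (s (covering x))) ->
  (forall x, K x -> s (covering (F x)) =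
    (c x + d x * s (covering x)) / (a x + b x * s (covering x))) ->
  bounded_measurable (line_growth g C s : borel_annulus R -> R) ->
  \int[mu]_p line_growth g C s p = - \int[mu]_p line_growth f C s p.
Proof.
move=> ms s1 s2 s3 bg.
have bf := bounded_measurable_growth ms.
apply: etrans (esym (Rintegral_invariant (measurable_f TS) fmu bg)) _.
have -> : - (\int[mu]_p line_growth f C s p) = \int[mu]_p (- line_growth f C s p).
  have := @RintegralZl _ _ R mu setT (line_growth f C s : borel_annulus R -> R) (-1)
    measurableT (bounded_measurable_integrable mu bf).
  by rewrite mulN1r => <-; apply: eq_Rintegral => x _; rewrite mulN1r.
apply: Rintegral_ae_eq.
- exact: (bounded_measurable_comp (measurable_f TS) bg).
- exact: bounded_measurableN.
apply: ae_mono ae_covering_K => p [x Kx <-]; exact: inverse_growth.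
Qed.

Lemma integral_upper_growth_ge0 : {ae mu, forall p : annulus R, sU p = sL p} ->
  0 <= \int[mu]_p lamU p.
Proof.
move=> h; apply: le_trans (integral_log_growth_ge0 TS TS' KM mM muM fmu) _.
have bq := log_dquot_bounded TS TS'.
apply: Rintegral_ae_le.
- split; first exact: (measurable_ulim lnC0 bq).
  by exists (ln C) => p; exact: (ulim_bounded lnC0 bq).
- exact: (bounded_measurable_growth (measurable_upper_slope TS)).
move: h ae_covering_K; apply: ae_mono2 => p e [x Kx xp].
have {}e : sU (covering x) = sL (covering x) by rewrite xp.
rewrite -xp (line_growthE TS TS' (upper_slope_limit TS) Kx).
exact: (ulim_log_dquot_le TS TS' Kx e).
Qed.

(* The gap [D] between the two slopes satisfies D(f p) exp(lamU p + lamL p) = D p,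
   and it is bounded above, so the Birkhoff sums of lamU + lamL are bounded below. *)
Lemma integral_growth_sum_ge0 : {ae mu, forall p : annulus R, sU p != sL p} ->
  0 <= \int[mu]_p lamU p + \int[mu]_p lamL p.
Proof.
move=> h.
have := birkhoff_growth (measurable_lower_slope TS).
move: (birkhoff_growth (measurable_upper_slope TS)) => hU hL.
apply: (@ae_cst _ _ _ mu).
have hUL := ae_mono2 (fun p u v => conj u v) hU hL.
have hK := ae_mono2 (fun p u v => conj u v) h ae_covering_K.
move: hUL hK; apply: ae_mono2 => p [cU cL] [gap [x Kx xp]].
pose D y := sU (covering y) - sL (covering y).
have D0 : 0 < D x.
  by rewrite subr_gt0 lt_neqAle eq_sym xp gap -xp (lower_le_upper_slope TS).
have DE n : D (iter n F x) * expR (birkhoff_sum f lamU n p + birkhoff_sum f lamL n p) = D x.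
  elim: n => [|n ih]; first by rewrite /birkhoff_sum !big_ord0 addr0 expR0 mulr1.
  have Ky := K_iter TS n Kx.
  rewrite !birkhoff_sumSr addrACA addrC !expRD -ih -xp -(covering_iter TS).
  rewrite (exp_line_growth TS TS' (upper_slope_limit TS))//.
  rewrite (exp_line_growth TS TS' (lower_slope_limit TS))//.
  rewrite -expRD mulrA; congr (_ * _).
  by rewrite mulrA; exact: (slope_gap_image TS TS' Ky).
(* Both slopes are at most C in absolute value, so the gap never exceeds 2 C. *)
have low n : ln (D x / (2 * C)) <= birkhoff_sum f lamU n p + birkhoff_sum f lamL n p.
  have := DE n; set S := _ + birkhoff_sum _ _ _ _ => e.
  have D2 : D (iter n F x) <= 2 * C.
    rewrite /D; have := upper_slope_bounded TS (covering (iter n F x)).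
    have := lower_slope_bounded TS (covering (iter n F x)).
    by rewrite !ler_norml => /andP[? ?] /andP[? ?]; lra.
  rewrite -[S]expRK ler_ln ?posrE ?expR_gt0 ?divr_gt0 ?mulr_gt0//.
  by rewrite ler_pdivrMr ?mulr_gt0// -e mulrC ler_pM2l ?expR_gt0.
have cS : (fun n => n%:R^-1 * (birkhoff_sum f lamU n p + birkhoff_sum f lamL n p)) @ \oo
    --> \int[mu]_p lamU p + \int[mu]_p lamL p.
  rewrite (_ : (fun n => _) = (fun n => n%:R^-1 * birkhoff_sum f lamU n p) +
     (fun n => n%:R^-1 * birkhoff_sum f lamL n p)); first exact: cvgD.
  by apply/funext => n; rewrite mulrDr.
have c0 : (fun n : nat => n%:R^-1 * ln (D x / (2 * C))) @ \oo --> (0 : R).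
  apply: (@average_perturbation _ (fun=> 0) _ _ `|ln (D x / (2 * C))|).
    by under eq_fun do rewrite mulr0; exact: cvg_cst.
  by move=> n; rewrite subr0.
by apply: (ler_cvg_to c0 cS); apply: nearW => n; rewrite ler_wpM2l.
Qed.

End SystemIntegrals.

Section PlaneSubspaces.
Variable R : realType.

Lemma dim_plane : \dim {:plane R} = 2%N.
Proof. by rewrite dimvf. Qed.

Lemma line_neq0 (t : R) : ((1, t) : plane R) != 0.
Proof. by apply/eqP => -[/eqP]; rewrite oner_eq0. Qed.

Lemma memv_lineP (t : R) (v : plane R) :
  v \in (<[(1, t) : plane R]>)%VS -> v = v.1 *: ((1, t) : plane R).
Proof.
move=> /vlineP[k e]; have {}e : v = k *: ((1, t) : plane R) := e.
by rewrite e !scale_line.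
Qed.

Lemma two_lines_full (t u : R) : t != u ->
  (<[(1, t) : plane R]> + <[(1, u) : plane R]>)%VS = fullv.
Proof.
move=> tu; apply/eqP; rewrite eqEsubv subvf /=; apply/subvP => v _.
have d0 : u - t != 0 by rewrite subr_eq0 eq_sym.
pose k := (v.2 - t * v.1) / (u - t).
have -> : v = (v.1 - k) *: ((1, t) : plane R) + k *: ((1, u) : plane R).
  rewrite !scale_line [LHS]surjective_pairing; congr pair => /=.
    by rewrite subrK.
  by rewrite /k; field.
by rewrite memv_add// memvZ// memv_line.
Qed.

End PlaneSubspaces.

(** * The two cases given by ergodicity *)

Section Dichotomy.
Variables (R : realType) (f g : annulus R -> annulus R) (F G : plane R -> plane R).
Variables (H H' : R -> R) (K : set (plane R)) (C : R) (a b c d : plane R -> R).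
Variables (a' b' c' d' : plane R -> R).
Hypothesis TS : twist_system f F G H K C a b c d.
Hypothesis TS' : twist_system g G F H' K C a' b' c' d'.
Variable M : set (annulus R).
Hypothesis KM : forall x, K x <-> M (covering x).
Variable mu : probability (borel_annulus R) R.
Hypothesis mM : measurable (M : set (borel_annulus R)).
Hypothesis muM : mu (~` M) = 0%E.
Hypothesis fmu : invariant_measure mu f.
Hypothesis ergf : ergodic_measure mu f.
Hypothesis gmu : invariant_measure mu g.
Hypothesis ergg : ergodic_measure mu g.
Hypothesis b_gt0 : forall x, K x -> 0 < b x.
Hypothesis gE : inverse f = g.

Local Notation sU := (upper_slope K C).
Local Notation sL := (lower_slope K C).

Let aeK := ae_covering_K KM mM muM.
Let mU := measurable_upper_slope TS.
Let mL := measurable_lower_slope TS.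
Let boundedU := upper_slope_bounded TS.
Let boundedL := lower_slope_bounded TS.

Let inverse_U : \int[mu]_p line_growth g C sU p = - \int[mu]_p line_growth f C sU p.
Proof.
apply: (integral_inverse_growth TS TS' KM mM muM fmu mU boundedU).
- exact: (upper_slope_limit TS).
- exact: (upper_slope_image TS TS').
- exact: (bounded_measurable_growth TS' mU).
Qed.

Let inverse_L : \int[mu]_p line_growth g C sL p = - \int[mu]_p line_growth f C sL p.
Proof.
apply: (integral_inverse_growth TS TS' KM mM muM fmu mL boundedL).
- exact: (lower_slope_limit TS).
- exact: (lower_slope_image TS TS').
- exact: (bounded_measurable_growth TS' mL).
Qed.

Lemma regular_case : {ae mu, forall p : annulus R, sU p = sL p} ->
  zero_exponents mu f /\ {ae mu, forall p, C1_regular_at M p}.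
Proof.
move=> h; split; last first.
  move: h aeK; apply: ae_mono2 => p e [x Kx xp].
  by rewrite -xp; apply/(C1_regularP TS KM Kx); rewrite xp.
have l0 : \int[mu]_p line_growth f C sU p = 0.
  have h1 := integral_upper_growth_ge0 TS TS' KM mM muM fmu h.
  (* For the inverse, the growth along the same line field has the opposite integral. *)
  have h2 := integral_upper_growth_ge0 TS' TS KM mM muM gmu h.
  by apply/eqP; rewrite eq_le h1 andbT -oppr_ge0 -inverse_U.
have l0' : \int[mu]_p line_growth g C sU p = 0 by rewrite inverse_U l0 oppr0.
have hf := birkhoff_growth TS fmu ergf mU; rewrite l0 in hf.
have hg := birkhoff_growth TS' gmu ergg mU; rewrite l0' in hg.
split => //.
have hfg := ae_mono2 (fun p u v => conj u v) hf hg.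
move: hfg aeK; apply: ae_mono2 => p [cf cg] [x Kx xp].
exists (fun=> fullv); split.
- by move=> i; rewrite -dimv_eq0 dim_plane.
- by rewrite big_ord_recl big_ord0 addv0.
- by rewrite directvE /= !big_ord_recl !big_ord0 addv0 addn0.
move=> i v _ v0; have -> : [:: 0 : R]`_i = 0 by case: i => -[].
rewrite oppr0 gE -xp; rewrite -xp in cf cg; split.
  apply: (zero_exponent TS TS' boundedU (upper_slope_limit TS)
    (upper_slope_image TS TS') Kx v0 cf).
apply: (zero_exponent TS' TS boundedU (upper_slope_limit TS')
  (upper_slope_image TS' TS) Kx v0 cg).
Qed.

Lemma irregular_case : {ae mu, forall p : annulus R, sU p != sL p} ->
  hyperbolic_measure mu f /\ {ae mu, forall p, C1_irregular_at M p}.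
Proof.
move=> h; split; last first.
  move: h aeK; apply: ae_mono2 => p e [x Kx xp] reg.
  move: reg; rewrite -xp => /(C1_regularP TS KM Kx); rewrite xp => eqs.
  by rewrite eqs eqxx in e.
set l1 := \int[mu]_p line_growth f C sL p.
set l2 := \int[mu]_p line_growth f C sU p.
have bU := bounded_measurable_growth TS mU.
have bL := bounded_measurable_growth TS mL.
(* The growths along the two lines differ by b (U - L), positive since the twist b is and since the
   slopes differ almost everywhere. *)
have l12 : l1 < l2.
  rewrite -subr_gt0 /l1 /l2.
  rewrite -RintegralB//; try exact: bounded_measurable_integrable.
  apply: Rintegral_ae_gt0.
    exact: (bounded_measurableD bU (bounded_measurableN bL)).
  move: h aeK; apply: ae_mono2 => p e [x Kx xp]; rewrite -xp subr_gt0.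
  rewrite (line_growthE TS TS' (upper_slope_limit TS) Kx).
  rewrite (line_growthE TS TS' (lower_slope_limit TS) Kx).
  have [_ A0] := growth_bounds TS TS' (lower_slope_limit TS Kx).
  have [_ B0] := growth_bounds TS TS' (upper_slope_limit TS Kx).
  rewrite ltr_ln ?posrE// ltrD2l ltr_pM2l ?b_gt0//.
  rewrite lt_neqAle eq_sym (lower_le_upper_slope TS Kx) andbT.
  by rewrite xp.
have s1 := integral_growth_sum_ge0 TS TS' KM mM muM fmu ergf h.
(* Backward time turns the sum into its opposite, so l1 + l2 = 0, and l1 < l2 fixes the signs. *)
have s2 := integral_growth_sum_ge0 TS' TS KM mM muM gmu ergg h.
rewrite inverse_U inverse_L in s2.
have l1N : l1 < 0 by rewrite -/l1 -/l2 in s1 s2; lra.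
have l2P : 0 < l2 by rewrite -/l1 -/l2 in s1 s2; lra.
exists l1, l2; split => //; split.
  by rewrite /= inE andbT lt_eqF.
have hfU := birkhoff_growth TS fmu ergf mU.
have hgU := birkhoff_growth TS' gmu ergg mU; rewrite inverse_U in hgU.
have hfL := birkhoff_growth TS fmu ergf mL.
have hgL := birkhoff_growth TS' gmu ergg mL; rewrite inverse_L in hgL.
have hUU := ae_mono2 (fun p u v => conj u v) hfU hgU.
have hLL := ae_mono2 (fun p u v => conj u v) hfL hgL.
have hUL := ae_mono2 (fun p u v => conj u v) hUU hLL.
have hK := ae_mono2 (fun p u v => conj u v) h aeK.
move: hUL hK; apply: ae_mono2 => p [[cfU cgU] [cfL cgL]] [gap [x Kx xp]].
pose u : plane R := (1, sU p); pose v : plane R := (1, sL p).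
(* Index 0 carries the line of slope L, in accordance with the order of the list of exponents. *)
pose E (i : 'I_2) := if i == 0 :> nat then <[v]>%VS else <[u]>%VS.
have E0 i : \dim (E i) = 1%N.
  by rewrite /E; case: ifP => _; rewrite dim_vline line_neq0.
have sumE : (\sum_i E i)%VS = fullv.
  rewrite !big_ord_recl big_ord0 addv0 /E /=.
  by apply: two_lines_full; rewrite eq_sym.
exists E; split => //.
- by move=> i; rewrite -dimv_eq0 E0.
- by rewrite directvE /= sumE !big_ord_recl big_ord0 !E0 dim_plane.
rewrite gE -xp; rewrite -xp in cfU cgU cfL cgL.
move=> [[|[|//]] i2] w; rewrite /E /= /u /v => /memv_lineP -> w0.
  have k0 : w.1 != 0 by apply: contra w0 => /eqP ->; rewrite scale0r.
  rewrite -xp; split.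
    exact: (line_exponent TS TS' boundedL (lower_slope_limit TS)
      (lower_slope_image TS TS') Kx k0 cfL).
  exact: (line_exponent TS' TS boundedL (lower_slope_limit TS')
      (lower_slope_image TS' TS) Kx k0 cgL).
have k0 : w.1 != 0 by apply: contra w0 => /eqP ->; rewrite scale0r.
rewrite -xp; split.
  exact: (line_exponent TS TS' boundedU (upper_slope_limit TS)
    (upper_slope_image TS TS') Kx k0 cfU).
exact: (line_exponent TS' TS boundedU (upper_slope_limit TS')
    (upper_slope_image TS' TS) Kx k0 cgU).
Qed.

Lemma dichotomy :
  (zero_exponents mu f /\ {ae mu, forall p, C1_regular_at M p}) \/
  (hyperbolic_measure mu f /\ {ae mu, forall p, C1_irregular_at M p}).
Proof.
(* Intersecting with M restricts to points where F transports the slopes, which makes B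
   invariant. *)
pose B : set (borel_annulus R) := M `&` [set p | sU p = sL p].
have mB : measurable B.
  apply: measurableI => //.
  have md : measurable_fun setT ((fun p => sU p - sL p) : borel_annulus R -> R).
    exact: measurable_funB.
  have := md measurableT [set 0] (measurable_set1 0).
  rewrite setTI; congr measurable; apply/seteqP; split => p /=.
    by move/eqP; rewrite subr_eq0 => /eqP.
  by move=> ->; rewrite subrr.
have fM p : M (f p) <-> M p.
  have [x <-] := covering_surj p; rewrite -(ts_lift TS).2.
  split; last by move=> /KM Kx; apply/KM; exact: (ts_K_F TS).
  by move=> /KM KFx; apply/KM; rewrite -(ts_FK TS x); exact: (ts_K_F TS').
have fB : f @^-1` B = B.
  apply/seteqP; split => p; have [x xp] := covering_surj p; rewrite -xp.
    move=> [] /fM Mx; have Kx : K x by apply/KM.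
    rewrite /= -(ts_lift TS).2 => /(slope_gap_eq0_image TS TS' Kx) e.
    by split.
  move=> [Mx /= e]; have Kx : K x by apply/KM.
  split; first exact/fM.
  by rewrite /= -(ts_lift TS).2; apply/(slope_gap_eq0_image TS TS' Kx).
have [B0|B1] := ergf mB fB; [right; apply: irregular_case|left; apply: regular_case].
  have : {ae mu, forall p, ~ B p}.
    by exists B; split => // p /= /contrapT.
  move: aeK; apply: ae_mono2 => p [x Kx xp] nB; apply/eqP => e; apply: nB.
  by split => //; rewrite -xp; apply/KM.
exists (~` B); split; first exact: measurableC.
  have := probability_setC mu mB; rewrite B1 subee// => h; exact: h.
by apply: subsetC => p [].
Qed.

End Dichotomy.

(** * Conservative twist maps *)

Section Support.
Variables (R : realType) (mu : probability (borel_annulus R) R).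

Lemma rational_box (x : plane R) (e : R) : 0 < e -> exists (q : rat * rat) (n : nat),
  let y : plane R := (ratr q.1, ratr q.2) in
  box y n.+1%:R^-1 x /\ box y n.+1%:R^-1 `<=` box x e.
Proof.
move=> e0; have [n hn] := inv_nat_lt (divr_gt0 e0 (ltr0n _ 2)).
have n0 : 0 < n.+1%:R^-1 :> R by rewrite invr_gt0.
have rat_near (t : R) : exists q : rat, `|t - ratr q| < n.+1%:R^-1.
  have lt_t : t - n.+1%:R^-1 < t + n.+1%:R^-1.
    by move: n0; move: (n.+1%:R^-1) => w n0; lra.
  have [q] := rat_in_itvoo lt_t.
  rewrite in_itv /= => /andP[h1 h2]; exists q; rewrite ltr_norml.
  by move: h1 h2; move: (n.+1%:R^-1) (ratr q) => u v h1 h2; apply/andP; split; lra.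
have [q1 h1] := rat_near x.1; have [q2 h2] := rat_near x.2.
exists (q1, q2), n; split => //= y [/= y1 y2].
have tri (u v w : R) : `|u - w| < n.+1%:R^-1 -> `|v - w| < n.+1%:R^-1 -> `|u - v| < e.
  move: hn; move: (n.+1%:R^-1) => z hn; rewrite !ltr_norml => /andP[a1 a2] /andP[a3 a4].
  by apply/andP; split; lra.
by split; apply: tri; eauto.
Qed.

Lemma open_borel (U : set (annulus R)) : open U -> measurable (U : set (borel_annulus R)).
Proof. exact: sub_sigma_algebra. Qed.

Lemma open_compl_support : open (~` measure_support mu).
Proof.
apply/open_annulusP; rewrite openE => x /= /existsNP[U /not_implyP[oU /not_implyP[Ux nU]]].
have : nbhs (covering x) U by apply: open_nbhs_nbhs; split.
move=> /covering_continuous; apply: filterS => y Uy /(_ U oU Uy); exact: nU.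
Qed.

Lemma measurable_support : measurable (measure_support mu : set (borel_annulus R)).
Proof.
by rewrite -[measure_support mu]setCK; apply: measurableC; apply: open_borel open_compl_support.
Qed.

(** A point off the support has a null open neighborhood, which contains the projection of a
    rational box around a lift of the point; there are countably many such boxes. *)
Lemma support_full : mu (~` measure_support mu) = 0%E.
Proof.
pose W (i : rat * rat * nat) : set (borel_annulus R) :=
  @covering R @` box (ratr i.1.1, ratr i.1.2) i.2.+1%:R^-1.
have mW i : measurable (W i) by apply: open_borel; apply: open_covering; exact: open_box.
have [enc [dec encK]] : exists (enc : rat * rat * nat -> nat)
    (dec : nat -> option (rat * rat * nat)), forall i, dec (enc i) = Some i.
  by exists pickle, unpickle; exact: pickleK.
pose V n : set (borel_annulus R) := if dec n is Some i then
  (if mu (W i) == 0%E then W i else set0) else set0.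
have negV : mu.-negligible (\bigcup_n V n).
  apply: negligible_bigcup => n; rewrite /V; case: (dec n) => [i|]; last exact: negligible_set0.
  by case: eqP => h; [exists (W i); split => //; exact: mW|exact: negligible_set0].
have sub : (~` measure_support mu : set (borel_annulus R)) `<=` \bigcup_n V n.
  move=> p np; have [x xp] := covering_surj p; rewrite -xp in np *.
  move: np => /existsNP[U /not_implyP[oU /not_implyP[Ux nU]]].
  have : nbhs x (@covering R @^-1` U).
    by apply: covering_continuous; apply: open_nbhs_nbhs; split.
  move=> /nbhs_box[e e0 hU].
  have [q [n [h1 h2]]] := rational_box x e0.
  exists (enc (q, n)); first by [].
  rewrite /V encK.
  have -> : mu (W (q, n)) == 0%E.
    rewrite -measure_le0; apply: (@le_trans _ _ (mu U)); last by rewrite leNgt; exact/negP.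
    apply: le_measure; rewrite ?inE; [exact: mW|exact: open_borel|].
    by move=> _ [y hy <-]; apply: hU; exact: h2.
  by exists x.
have [N [mN N0 sN]] : mu.-negligible (~` measure_support mu : set (borel_annulus R)).
  exact: negligibleS sub negV.
apply/eqP; rewrite -measure_le0 -N0; apply: le_measure; rewrite ?inE//.
by apply: measurableC; exact: measurable_support.
Qed.

Lemma support_invariant (f g : annulus R -> annulus R) :
  continuous f -> cancel f g -> continuous g -> cancel g f -> invariant_measure mu f ->
  forall p, measure_support mu (f p) <-> measure_support mu p.
Proof.
move=> cf fK cg gK fmu p; split => h U oU Up.
  have og : open (g @^-1` U) by move/continuousP : cg; exact.
  have : (0 < mu (g @^-1` U))%E by apply: h => //=; rewrite /preimage/= fK.
  rewrite -(fmu _ (open_borel og)); congr (0 < mu _)%E.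
  by apply/seteqP; split => q; rewrite /preimage /= fK.
have of_ : open (f @^-1` U) by move/continuousP : cf; exact.
by rewrite -(fmu _ (open_borel oU)); exact: h.
Qed.

End Support.

Section PeriodicBounds.
Variable R : realType.

Lemma periodic_bounded (U : plane R -> R) (r : R) : continuous U ->
  (forall k x, U (deck k x) = U x) ->
  exists2 B, 0 <= B & forall x, `|x.2| <= r -> `|U x| <= B.
Proof.
move=> cU pU.
pose Q : set (plane R) := [set t | 0 <= t <= 1] `*` [set t | - r <= t <= r].
have cQ : compact Q.
  have seg (u v : R) : compact [set t | u <= t <= v].
    rewrite (_ : [set t | _] = `[u, v]%classic); first exact: segment_compact.
    by apply/seteqP; split => t /=; rewrite in_itv.
  by apply: compact_setX; exact: seg.
have [B [_ hB]] := compact_bounded (continuous_compact (continuous_subspaceT cU) cQ).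
exists (`|B| + 1); first by rewrite addr_ge0.
move=> x hx; rewrite -(pU (- Num.floor x.1)); apply: hB.
  by rewrite ltr_pwDr// ler_norm.
exists (deck (- Num.floor x.1) x) => //; split => /=; last by rewrite -ler_norml.
have /andP[h1 h2] := floor_itv x.1; move: h1 h2.
by rewrite intrN intrD; move: (_%:~R) => w h1 h2; apply/andP; split; lra.
Qed.

Lemma deckD k l (x : plane R) : deck k (deck l x) = deck (k + l) x.
Proof. by rewrite /deck /= intrD [k%:~R + _]addrC addrA. Qed.

Lemma deck0 (x : plane R) : deck 0 x = x.
Proof. by rewrite /deck addr0 -surjective_pairing. Qed.

Lemma deck_commute (F : plane R -> plane R) :
  (forall x, F (deck 1 x) = deck 1 (F x)) -> forall k x, F (deck k x) = deck k (F x).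
Proof.
move=> h1.
have nat_case (n : nat) x : F (deck n x) = deck n (F x).
  elim: n x => [|n ih] x; first by rewrite !deck0.
  by rewrite -addn1 PoszD -!deckD ih h1.
case=> n x; first exact: nat_case.
have := nat_case n.+1 (deck (Negz n) x).
by rewrite deckD NegzE subrr deck0 => ->; rewrite deckD addNr deck0.
Qed.

Lemma continuous_deck k : continuous (@deck R k).
Proof.
move=> x; have -> : @deck R k = (fun y => y + (k%:~R, 0)).
  by apply/funext => y; rewrite /deck; congr pair; rewrite /= addr0.
by apply: cvgD; [exact: cvg_id|exact: cvg_cst].
Qed.

End PeriodicBounds.

Section CircleRotation.
Variables (R : realType) (H : R -> R).
Hypothesis H1 : forall t, H (t + 1) = H t + 1.

(** If H^m t = t - k, then H^(nm) t = t - n k, and the limit along the nonzero multiples of m gives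
    the rational rotation number -k/m. *)
Lemma irrational_aperiodic (rho : R) : irrational rho ->
  (forall t, (fun n : nat => (iter n H t - t) / n%:R) @ \oo --> rho) ->
  forall m (k : int) t, (0 < m)%N -> iter m H t + k%:~R != t.
Proof.
move=> irr hrho m k t m0; apply/eqP => e; apply: irr; apply/rationalP.
exists (- k), m.
have m0' : m%:R != 0 :> R by rewrite pnatr_eq0 -lt0n.
have iterE n : iter (n * m) H t = t - (n%:R * k%:~R).
  elim: n => [|n ih]; first by rewrite mul0n mul0r subr0.
  rewrite mulSn iterD ih -mulrN.
  have -> : n%:R * - (k%:~R : R) = (n%:Z * - k)%:~R by rewrite intrM intrN.
  rewrite (iter_lift_int H1) intrM intrN -natr1; have -> : iter m H t = t - k%:~R by rewrite -[t in RHS]e addrK.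
  by ring.
have sub : (fun n => (n.+1 * m)%N) @ \oo --> \oo.
  move=> A [N _ hN]; exists N => // n /= Nn; apply: hN => /=.
  by apply: leq_trans (leq_pmulr _ m0); exact: leqW.
have : (fun n : nat => (iter (n.+1 * m) H t - t) / (n.+1 * m)%:R) @ \oo --> rho.
  exact: cvg_comp sub (hrho t).
have -> : (fun n : nat => (iter (n.+1 * m) H t - t) / (n.+1 * m)%:R) = fun=> (- k)%:~R / m%:R.
  apply/funext => n; rewrite iterE natrM intrN.
  have n0' : n.+1%:R != 0 :> R by rewrite pnatr_eq0.
  move: m0' n0'; move: (n.+1%:R : R) (m%:R : R) (k%:~R : R) => u v w u0 v0.
  by field; rewrite u0 v0.
by move=> h; rewrite -(cvg_lim (@Rhausdorff R) h) lim_cst.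
Qed.

End CircleRotation.

Section Lifts.
Variable R : realType.
Implicit Types (F G : plane R -> plane R) (f g : annulus R -> annulus R).

Lemma plane_C1_translate F F0 (c : plane R) :
  (forall x, F x = F0 x + c) -> plane_C1 F0 -> plane_C1 F.
Proof.
move=> FE [d0 c0].
have dF x : is_diff x F ('d F0 x).
  have -> : F = F0 + cst c by apply/funext => y; exact: FE.
  have d0x : is_diff x F0 ('d F0 x) by exact: DiffDef.
  have [e1 e2] := is_diffD d0x (is_diff_cst c x).
  apply: DiffDef; first exact: e1.
  by apply: etrans e2 _; apply/funext => v; exact: addr0.
split => [x|v]; first by have [] := dF x.
have e : (fun x => 'd F0 x v) = (fun x => 'd F x v).
  by apply/funext => x; exact: (congr1 (@^~ v) (esym (@diff_val _ _ _ _ _ _ _ (dF x)))).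
exact: (eq_ind _ (fun u => continuous u) (c0 v) _ e).
Qed.

Lemma is_lift_deck f F k : is_lift f F -> is_lift f (fun x => F (deck k x)).
Proof.
move=> [cF lF]; split; last by move=> x; rewrite lF covering_deck.
by move=> x; apply: (continuous_comp (@continuous_deck R k x)); exact: cF.
Qed.

(** A C^1 lift of g composed with F lifts the identity, hence is an integer translation; removing it
    from the lift gives the exact inverse of F. *)
Lemma lift_of_inverse f g F : cancel f g -> cancel g f -> is_lift f F -> annulus_C1 g ->
  exists2 G, is_lift g G /\ plane_C1 G & cancel F G /\ cancel G F.
Proof.
move=> fK gK lF [G0 lG0 C1G0].
have id_lift (u v : annulus R -> annulus R) (U V : plane R -> plane R) : is_lift u U -> is_lift v V -> cancel u v ->
    is_lift id (fun x => V (U x)).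
  move=> [cU lU] [cV lV] uK; split; last by move=> x; rewrite lV lU uK.
  by move=> x; apply: (continuous_comp (cU x)); exact: cV.
have lid : is_lift id (@id (plane R)) by split => // x; exact: cvg_id.
have [c hc] := lift_uniq (id_lift _ _ _ _ lF lG0 fK) lid.
have [k kc] : exists k, c = (k%:~R, 0).
  have e0 : covering c = covering (0 : plane R).
    have h0 : G0 (F 0) = c by rewrite hc add0r.
    by rewrite -h0 lG0.2 lF.2 fK.
  have [k ->] := covering_eq_deck e0; exists k.
  by rewrite /deck /= add0r.
pose G x := G0 x + - c.
have GE x : G x = deck (- k) (G0 x).
  by rewrite /G kc /deck; congr pair; rewrite /= ?intrN// oppr0 addr0.
have FG : cancel F G by move=> x; rewrite /G hc addrK.
have cG : continuous G by move=> x; apply: cvgB; [exact: lG0.1|exact: cvg_cst].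
have lG : is_lift g G.
  by split => // x; rewrite GE covering_deck lG0.2.
have C1G : plane_C1 G.
  by apply: (@plane_C1_translate G G0 (- c)); [move=> x|exact: C1G0].
exists G; first exact: conj lG C1G.
split; first exact: FG.
have [c' hc'] := lift_uniq (id_lift _ _ _ _ lG lF gK) lid.
have c'0 : c' = 0.
  by have := hc' (F 0); rewrite FG => /eqP; rewrite eq_sym addrC -subr_eq0 addrK => /eqP.
by move=> x; rewrite hc' c'0 addr0.
Qed.

End Lifts.

Section TwistEstimates.
Variables (R : realType) (F : plane R -> plane R) (a b c d : plane R -> R).
Hypothesis jF : jacobian_entries F a b c d.
Variables (K : set (plane R)) (rho A B eps sg : R).
Hypothesis A0 : 0 <= A.
Hypothesis K_bounded : forall x, K x -> `|x.2| <= rho.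
Hypothesis a_bounded : forall x, `|x.2| <= rho -> `|a x| <= A.
Hypothesis b_bounded : forall x, `|b x| <= B.
Hypothesis eps0 : 0 < eps.
Hypothesis twist : forall x, eps <= sg * b x.
Hypothesis sg1 : `|sg| = 1.
Hypothesis mono : forall x y, K x -> K y -> x.1 < y.1 -> (F x).1 < (F y).1.

(** Here [sg] is 1 for F and -1 for its inverse, whose twist is negative. If sg (z.2 - y.2) were too
    negative, the vertical leg would outweigh the horizontal one and reverse the order of the
    images. *)
Lemma twist_slope_bound y z : K y -> K z -> y.1 < z.1 ->
  - (A / eps * (z.1 - y.1)) <= sg * (z.2 - y.2).
Proof.
move=> Ky Kz yz; have zy : 0 < z.1 - y.1 by rewrite subr_gt0.
have [_ pF _] := jF.
have [s [t [_ _ e]]] := mvt_legs y z pF.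
set p := (_, y.2) in e; set q := (z.1, _) in e.
have Fyz : 0 < (F z).1 - (F y).1 by rewrite subr_gt0; exact: mono.
have ap : `|a p| <= A by apply: a_bounded; exact: (K_bounded Ky).
rewrite leNgt; apply/negP => lt.
have lt0 : sg * (z.2 - y.2) <= 0.
  apply: ltW; apply: lt_le_trans lt _; rewrite oppr_le0.
  have Ae : 0 <= A / eps by rewrite divr_ge0// ltW.
  by rewrite mulr_ge0// ltW.
have sg2 : sg * sg = 1 by rewrite -expr2 -real_normK ?num_real// sg1 expr1n.
have h1 : (z.2 - y.2) * b q <= sg * (z.2 - y.2) * eps.
  rewrite (_ : (z.2 - y.2) * b q = sg * (z.2 - y.2) * (sg * b q)).
    by rewrite ler_wnM2l.
  by rewrite -[LHS]mul1r -sg2; ring.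
have h2 : (z.1 - y.1) * a p <= A * (z.1 - y.1).
  by rewrite mulrC ler_pM2r// (le_trans (ler_norm _)).
have h3 : sg * (z.2 - y.2) * eps < - (A * (z.1 - y.1)).
  move: lt; rewrite -(ltr_pM2r eps0) mulNr.
  by rewrite (_ : A / eps * (z.1 - y.1) * eps = A * (z.1 - y.1)) //; field; rewrite gt_eqF.
move: e Fyz; rewrite /= => ->; move: h1 h2 h3.
move: (_ * b q) (_ * a p) (A * _) (sg * _ * eps) => X1 X2 X3 X4 *; lra.
Qed.

Lemma twist_lip (D : R) y z : K y -> K z -> `|z.2 - y.2| <= D * `|z.1 - y.1| ->
  `|(F z).1 - (F y).1| <= (A + B * D) * `|z.1 - y.1|.
Proof.
move=> Ky Kz hD; have [_ pF _] := jF.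
have [s [t [_ _ e]]] := mvt_legs y z pF.
set p := (_, y.2) in e; set q := (z.1, _) in e.
have ap : `|a p| <= A by apply: a_bounded; exact: (K_bounded Ky).
rewrite [X in `|X|]e; apply: le_trans (ler_normD _ _) _; rewrite !normrM mulrDl lerD//.
  by rewrite mulrC ler_wpM2r.
by rewrite mulrC -mulrA; apply: ler_pM.
Qed.

(** Along a fibre the first coordinate of F has derivative b, which never vanishes, so it is
    injective there. *)
Lemma twist_graph y z : K y -> K z -> (F y).1 = (F z).1 -> y.1 = z.1 -> y = z.
Proof.
move=> Ky Kz Fyz yz; have [_ pF _] := jF.
have [s [t [_ _ e]]] := mvt_legs y z pF.
move: e; rewrite /= Fyz yz !subrr mul0r add0r => /esym/eqP; rewrite mulf_eq0.
case/orP => [|/eqP b0].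
  rewrite subr_eq0 => /eqP e2.
  by rewrite [LHS]surjective_pairing yz -e2 -surjective_pairing.
by have := twist (z.1, y.2 + t * (z.2 - y.2)); rewrite b0 mulr0 leNgt eps0.
Qed.

End TwistEstimates.

Lemma tangent_jacobian (R : realType) (f : annulus R -> annulus R) F
    (a b c d : plane R -> R) x v : is_lift f F -> jacobian_entries F a b c d ->
  tangent f (covering x) v = (v.1 * a x + v.2 * b x, v.1 * c x + v.2 * d x).
Proof.
move=> lF jF; have dF : differentiable F x by case: jF.
by rewrite (tangentE lF dF) (jacobian_diff jF).
Qed.

Lemma jacobian_periodic (R : realType) (f : annulus R -> annulus R) F
    (a b c d : plane R -> R) k x : is_lift f F -> jacobian_entries F a b c d ->
  a (deck k x) = a x.
Proof.
move=> lF jF; have aE y : a y = (tangent f (covering y) (1, 0)).1.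
  by rewrite (tangent_jacobian _ _ lF jF) /= mul1r mul0r addr0.
by rewrite !aE covering_deck.
Qed.

Lemma inverseK (R : realType) (f : annulus R -> annulus R) : bijective f ->
  cancel f (inverse f) /\ cancel (inverse f) f.
Proof.
move=> bf; have fK : cancel f (inverse f).
  by move=> p; apply: pinvKV; rewrite ?inE// => u v _ _; exact: (bij_inj bf).
split => // p; have [h fh hf] := bf.
by rewrite -[p]hf fK.
Qed.

(** * The twist systems carried by the lifted support *)

Section SystemConstruction.
Variables (R : realType) (f g : annulus R -> annulus R).
Variable mu : probability (borel_annulus R) R.
Variables (F G : plane R -> plane R) (E : set (plane R)).
Variables (a b c d a' b' c' d' : plane R -> R) (H H' : R -> R) (eps rot : R).
Hypotheses (fK : cancel f g) (gK : cancel g f).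
Hypotheses (lF : is_lift f F) (lG : is_lift g G) (FK : cancel F G) (GK : cancel G F).
Hypotheses (jF : jacobian_entries F a b c d) (jG : jacobian_entries G a' b' c' d').
Hypothesis det : forall x, a x * d x - b x * c x = 1.
Hypothesis eps0 : 0 < eps.
Hypothesis twist : forall x, eps < b x < eps^-1.
Hypothesis fmu : invariant_measure mu f.
Hypotheses (E0 : E !=set0) (ordE : ordered_set F E).
Hypotheses (cH : continuous H) (cH' : continuous H').
Hypotheses (HK : cancel H H') (H'K : cancel H' H).
Hypothesis incH : {homo H : s t / s < t}.
Hypothesis H1 : forall t, H (t + 1) = H t + 1.
Hypothesis HE : forall x, E x -> H x.1 = (F x).1.
Hypothesis rotH : forall t, (fun n : nat => (iter n H t - t) / n%:R) @ \oo --> rot.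
Hypothesis irr : irrational rot.
Hypothesis supE : measure_support mu `<=` @covering R @` E.

Local Notation M := (measure_support mu).
(** The support is used rather than E because recurrence excludes isolated points in it, see
    [K_pairs], whereas E may contain some. *)
Local Notation K := (@covering R @^-1` M).

Let cf : continuous f := continuous_annulusP lF.
Let cg : continuous g := continuous_annulusP lG.

Let K_E x : K x -> E x.
Proof.
move=> /supE[y Ey yx]; have [k ->] := covering_eq_deck (esym yx).
by case: ordE => _ shE _; exact: shE.
Qed.

Let K_deck k x : K x -> K (deck k x).
Proof. by rewrite /preimage /= covering_deck. Qed.

Let M_f := support_invariant cf fK cg gK fmu.

Let K_F x : K x -> K (F x).
Proof. by rewrite /preimage /= lF.2 => h; apply/M_f. Qed.

Let K_G x : K x -> K (G x).
Proof. by rewrite /preimage /= lG.2 => h; apply/M_f; rewrite gK. Qed.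

Let H_F x : K x -> H x.1 = (F x).1.
Proof. by move=> /K_E; exact: HE. Qed.

Let H_G x : K x -> H' x.1 = (G x).1.
Proof. by move=> Kx; rewrite -{1}(GK x) -H_F ?HK//; exact: K_G. Qed.

(** F composed with a deck translation is another lift, hence a translate of F; the translation is
    identified at one point of E through H(t + 1) = H(t) + 1. *)
Let F_deck k x : F (deck k x) = deck k (F x).
Proof.
apply: deck_commute => {}x.
have [v hv] := lift_uniq (is_lift_deck 1 lF) lF.
have [x0 Ex0] := E0.
have Ex1 : E (deck 1 x0) by case: ordE => _ shE _; exact: (shE 1).
have v1 : v.1 = 1.
  have := congr1 fst (hv x0); rewrite /= -HE// -HE// /deck /= H1 => e.
  by apply: (addrI (H x0.1)).
have v2 : v.2 = 0.
  have := congr1 snd (hv x0); rewrite /= => e.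
  have := lF.2 (deck 1 x0); rewrite covering_deck -lF.2 => -[_ e2].
  by apply: (addrI (F x0).2); rewrite -e e2 addr0.
by rewrite hv /deck -v1; congr pair; rewrite /= v2 addr0.
Qed.

Let G_deck k x : G (deck k x) = deck k (G x).
Proof. by rewrite -{1}(GK x) -F_deck FK. Qed.

Let F_mono x y : K x -> K y -> x.1 < y.1 -> (F x).1 < (F y).1.
Proof. by move=> /K_E Ex /K_E Ey; case: ordE => _ _ h; exact: h. Qed.

Let G_mono x y : K x -> K y -> x.1 < y.1 -> (G x).1 < (G y).1.
Proof.
move=> Kx Ky xy; rewrite ltNge; apply/negP; rewrite le_eqVlt => /predU1P[e|l].
  have := H_F (K_G Kx); rewrite -e H_F ?GK; last exact: K_G.
  by move=> e'; rewrite e' ltxx in xy.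
have := incH l; rewrite !H_F ?GK; try exact: K_G.
by move=> yx; have := lt_trans xy yx; rewrite ltxx.
Qed.

Let inverse_b x : b' x = - b (G x).
Proof.
have [_ e _ _] := inverse_jacobian jF jG FK (det (G x)).
by rewrite GK in e.
Qed.

Let det' x : a' x * d' x - b' x * c' x = 1.
Proof.
have [] := inverse_jacobian jF jG FK (det (G x)).
by rewrite GK => -> -> -> ->; rewrite -[RHS](det (G x)); ring.
Qed.

(** Both H and the first coordinate of F on the zero section stay at bounded distance from the
    identity. On K they are compared along the vertical segment from (x.1, 0) to x, where the twist
    exceeds eps. *)
Let K_bounded : exists rho, forall x, K x -> `|x.2| <= rho.
Proof.
(* The functions depend on the first coordinate only, so [periodic_bounded] is taken with radius 0
   and evaluated at (x.1, 0). *)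
have [D0 D00 h0] : exists2 D, 0 <= D & forall x : plane R, `|x.2| <= 0 -> `|H x.1 - x.1| <= D.
  apply: periodic_bounded.
    move=> x; apply: cvgB; last exact: cvg_fst.
    by apply: (continuous_comp (@cvg_fst _ _ _ _ _)); exact: cH.
  by move=> k x; rewrite /deck /= (lift_int H1); ring.
have [D1 D10 h1] : exists2 D, 0 <= D &
    forall x : plane R, `|x.2| <= 0 -> `|(F (x.1, 0)).1 - x.1| <= D.
  apply: periodic_bounded.
    move=> x; apply: cvgB; last exact: cvg_fst.
    apply: (@continuous_comp _ _ _ (fun y : plane R => (y.1, 0) : plane R) (fun y => (F y).1)).
      exact: (@cvg_pair _ R R (nbhs x) (nbhs x.1) (nbhs (0 : R)) _ _ _ fst (fun=> 0)
        (@cvg_fst _ _ _ _ _) (@cvg_cst _ _ _ _ _)).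
    by apply: (continuous_comp (lF.1 _)); exact: cvg_fst.
  move=> k x; rewrite (_ : ((deck k x).1, 0) = deck k (x.1, 0))// F_deck /deck /=; ring.
exists ((D0 + D1) / eps) => x Kx.
have [_ pF _] := jF.
have [s [t [_ _]]] := mvt_legs (x.1, 0) x pF.
rewrite /= subrr mul0r add0r subr0; set q := (x.1, _ + _) => e.
have /andP[b1 b2] := twist q.
rewrite ler_pdivlMr//.
apply: (@le_trans _ _ `|x.2 * b q|).
  by rewrite normrM ler_wpM2l// (le_trans (ltW b1))// ler_norm.
rewrite -e -H_F//.
rewrite (_ : _ - _ = (H x.1 - x.1) - ((F (x.1, 0)).1 - x.1)); last by ring.
apply: le_trans (ler_normB _ _) _; apply: lerD.
  by have := h0 (x.1, 0); rewrite /= normr0; apply.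
by have := h1 (x.1, 0); rewrite /= normr0; apply.
Qed.

Let aperiodic := irrational_aperiodic H1 irr rotH.

Let iterK n : cancel (iter n H') (iter n H).
Proof.
elim: n => // n ih t; rewrite iterSr.
by rewrite [iter n.+1 H' t]iterS H'K ih.
Qed.

Let aperiodic' m (k : int) t : (0 < m)%N -> iter m H' t + k%:~R != t.
Proof.
move=> m0; apply/eqP => e; have := aperiodic (- k) (iter m H' t) m0.
by rewrite iterK intrN -{1}e addrK eqxx.
Qed.

Let H'1 t : H' (t + 1) = H' t + 1.
Proof. by rewrite -{1}(H'K t) -H1 HK. Qed.

Let graph_eq y z : K y -> K z -> y.1 = z.1 -> y = z.
Proof.
move=> Ky Kz yz.
have tw x : eps <= 1 * b x by rewrite mul1r ltW//; case/andP: (twist x).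
have Fyz : (F y).1 = (F z).1 by rewrite -!H_F// yz.
exact: (twist_graph jF eps0 tw Ky Kz Fyz yz).
Qed.

Let K_iter n x : K x -> K (iter n F x).
Proof. by move=> Kx; elim: n => //= n; exact: K_F. Qed.

(** A point of K isolated in K projects to a small set of positive measure meeting the support in
    that point only; by recurrence it returns to itself up to a deck translation, giving a periodic
    point of H. *)
Let K_pairs x e : K x -> 0 < e -> pairs_at K x e !=set0.
Proof.
move=> Kx e0; apply: contrapT => no.
have only y : K y -> box x e y -> y = x.
  move=> Ky by_; have [l|l|l] := ltgtP y.1 x.1; last exact: graph_eq.
    by exfalso; apply: no; exists (y, x); split => //; exact: box_center.
  by exfalso; apply: no; exists (x, y); split => //; exact: box_center.
pose U : set (borel_annulus R) := (@covering R @` box x e) `&` M.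
have oU : open (@covering R @` box x e) by apply: open_covering; exact: open_box.
have mU : measurable U by apply: measurableI; [exact: open_borel|exact: measurable_support].
have U0 : (0 < mu U)%E.
  have V0 : (0 < mu (@covering R @` box x e : set (borel_annulus R)))%E.
    by apply: Kx => //; exists x => //; exact: box_center.
  apply: lt_le_trans V0 _.
  rewrite (_ : (@covering R @` box x e : set (borel_annulus R)) =
    U `|` ((@covering R @` box x e) `&` ~` M)); last by rewrite -setIUr setUv setIT.
  have mN : measurable ((@covering R @` box x e) `&` ~` M : set (borel_annulus R)).
    apply: measurableI; first exact: open_borel.
    by apply: measurableC; exact: measurable_support.
  have le2 : (mu (U `|` ((@covering R @` box x e) `&` ~` M)) <=
      mu U + mu ((@covering R @` box x e) `&` ~` M))%E by exact: measureU2.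
  apply: le_trans le2 _.
  have -> : mu ((@covering R @` box x e) `&` ~` M) = 0%E.
    apply/eqP; rewrite -measure_le0 -(support_full mu); apply: le_measure; rewrite ?inE//.
    by apply: measurableC; exact: measurable_support.
  by rewrite adde0.
have [p [[y by_ yp] Mp] [m m0 [[z bz zp] Mq]]] :=
  poincare_recurrence (continuous_annulus_measurable cf) fmu mU U0.
have yx : y = x by apply: only => //; rewrite /preimage /= yp.
have zx : z = x by apply: only => //; rewrite /preimage /= zp.
have lift_iter n : covering (iter n F x) = iter n f (covering x).
  by elim: n => //= n <-; exact: lF.2.
have [k ek] : exists k, x = deck k (iter m F x).
  by apply: covering_eq_deck; rewrite lift_iter -{1}zx zp -yp yx.
have Hx : iter m H x.1 = (iter m F x).1.
  by elim: (m) => //= n ->; rewrite H_F//; exact: K_iter.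
have := aperiodic k x.1 m0; rewrite Hx.
by have := congr1 fst ek; rewrite /deck /= => <-; rewrite eqxx.
Qed.

Lemma exists_twist_systems : exists C,
  twist_system f F G H K C a b c d /\
  twist_system g G F H' K C a' b' c' d'.
Proof.
have [rho Krho] := K_bounded.
have [_ [_ ca _ _] _] := jF; have [_ [_ ca' _ _] _] := jG.
have [A A0 hA] := periodic_bounded rho ca (fun k x => jacobian_periodic k x lF jF).
have [A' A'0 hA'] := periodic_bounded rho ca' (fun k x => jacobian_periodic k x lG jG).
pose B := eps^-1.
have B0 : 0 < B by rewrite invr_gt0.
have bB x : `|b x| <= B.
  have /andP[b1 b2] := twist x.
  by rewrite gtr0_norm ?(lt_trans eps0)// ltW.
have b'B x : `|b' x| <= B by rewrite inverse_b normrN.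
have tw1 x : eps <= 1 * b x by rewrite mul1r ltW//; case/andP: (twist x).
have tw2 x : eps <= -1 * b' x.
  by rewrite inverse_b mulrNN mul1r ltW//; case/andP: (twist (G x)).
have n1 : `|1 : R| = 1 by exact: normr1.
have nN1 : `|-1 : R| = 1 by rewrite normrN normr1.
(* Monotonicity of F bounds the slopes of K below by -A / eps, and monotonicity of G, of negative
   twist, bounds them above by A' / eps. *)
pose D := A / eps + A' / eps.
have Ae : 0 <= A / eps by rewrite divr_ge0// ltW.
have A'e : 0 <= A' / eps by rewrite divr_ge0// ltW.
have D0 : 0 <= D by exact: addr_ge0.
have graph_lt y z : K y -> K z -> y.1 < z.1 -> `|z.2 - y.2| <= D * `|z.1 - y.1|.
  move=> Ky Kz yz.
  have h1 := twist_slope_bound jF A0 Krho hA eps0 tw1 n1 F_mono Ky Kz yz.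
  have h2 := twist_slope_bound jG A'0 Krho hA' eps0 tw2 nN1 G_mono Ky Kz yz.
  have zy : 0 < z.1 - y.1 by rewrite subr_gt0.
  rewrite (gtr0_norm zy) ler_norml /D mulrDl.
  have p1 : 0 <= A / eps * (z.1 - y.1) by rewrite mulr_ge0// ltW.
  have p2 : 0 <= A' / eps * (z.1 - y.1) by rewrite mulr_ge0// ltW.
  rewrite mul1r in h1; rewrite mulN1r in h2.
  by apply/andP; split; lra.
have graph y z : K y -> K z -> `|z.2 - y.2| <= D * `|z.1 - y.1|.
  move=> Ky Kz; have [l|l|l] := ltgtP y.1 z.1; first exact: graph_lt.
    by rewrite distrC [X in _ * X]distrC; exact: graph_lt.
  by rewrite (graph_eq Ky Kz l) !subrr normr0 mulr0.
(* One constant for both systems: it dominates 1, the slopes of K, the Lipschitz constants of F and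
   G on K, and the twist. *)
pose C := 1 + D + (A + B * D) + (A' + B * D) + B.
have BD : 0 <= B * D by rewrite mulr_ge0// ltW.
have C1 : 1 <= C by rewrite /C; lra.
have CD : D <= C by rewrite /C; lra.
have CA : A + B * D <= C by rewrite /C; lra.
have CA' : A' + B * D <= C by rewrite /C; lra.
have CB : B <= C by rewrite /C; lra.
have g1 x y : K x -> K y -> `|x.2 - y.2| <= C * `|x.1 - y.1|.
  by move=> Kx Ky; apply: le_trans (graph y x Ky Kx) _; rewrite ler_wpM2r.
have l1 x y : K x -> K y -> `|(F x).1 - (F y).1| <= C * `|x.1 - y.1|.
  move=> Kx Ky; apply: le_trans (twist_lip jF Krho hA bB Ky Kx (graph y x Ky Kx)) _.
  by rewrite ler_wpM2r.
have l2 x y : K x -> K y -> `|(G x).1 - (G y).1| <= C * `|x.1 - y.1|.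
  move=> Kx Ky; apply: le_trans (twist_lip jG Krho hA' b'B Ky Kx (graph y x Ky Kx)) _.
  by rewrite ler_wpM2r.
exists C; split; split => //.
- by move=> x _; exact: le_trans (bB x) CB.
- by move=> x _; exact: le_trans (b'B x) CB.
Qed.

End SystemConstruction.

Unset Implicit Arguments.
Set Strict Implicit.
Set Printing Implicit Defensive.

Theorem theorem9 (R : realType) (f : annulus R -> annulus R)
    (mu : probability (borel_annulus R) R) :
  conservative_twist_map f ->
  invariant_measure mu f -> ergodic_measure mu f ->
  (exists (F : plane R -> plane R) (E : set (plane R)),
    [/\ is_lift f F, irrational_aubry_mather F E &
        measure_support mu `<=` @covering R @` E]) ->
  (zero_exponents mu f /\
   {ae mu, forall a, C1_regular_at (measure_support mu) a})
  \/
  (hyperbolic_measure mu f /\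
   {ae mu, forall a, C1_irregular_at (measure_support mu) a}).
Proof.
move=> [[bf C1f C1g] _ [eps eps0 tw] [S dS]] fmu ergf.
move=> [F [E [lF [[E0 _ ordE] [rot [H [[cH [H' [cH' HK H'K]]] incH H1 HE rotH] irr]]] supE]]].
have [fK gK] := inverseK bf.
have [F0 lF0 C1F0] := C1f.
have [v hv] := lift_uniq lF lF0.
have C1F : plane_C1 F by exact: (plane_C1_translate hv C1F0).
have [G [lG C1G] [FK GK]] := lift_of_inverse fK gK lF C1g.
have [a [b [c [d jF]]]] := plane_C1_jacobian C1F.
have [a' [b' [c' [d' jG]]]] := plane_C1_jacobian C1G.
have tangentF x w := tangent_jacobian x w lF jF.
have twist x : eps < b x < eps^-1.
  by have := tw (covering x); rewrite tangentF /= mul0r add0r mul1r.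
have det : forall x, a x * d x - b x * c x = 1.
  apply: (exact_det1 (S := S \o @covering R) jF) => [x|x w]; first by have [] := dS x.
  by have [_ ->] := dS x; rewrite tangentF -lF.2.
have [C [TS TS']] := exists_twist_systems fK gK lF lG FK GK jF jG det eps0 twist fmu
  E0 ordE cH cH' HK H'K incH H1 HE rotH irr supE.
have cg : continuous (inverse f) by exact: continuous_annulusP lG.
(* Applied to the preimage of B under the inverse, this identity transfers invariance and ergodicity
   to the inverse. *)
have fgB B : f @^-1` (inverse f @^-1` B) = B.
  by apply/seteqP; split => p; rewrite /preimage /= fK.
have gmu : invariant_measure mu (inverse f).
  move=> B mB; rewrite -[in RHS](fgB B); symmetry; apply: fmu.
  by have := continuous_annulus_measurable cg measurableT mB; rewrite setTI.
have ergg : ergodic_measure mu (inverse f).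
  by move=> B mB gB; apply: ergf => //; rewrite -{1}gB fgB.
have b_gt0 x : (@covering R @^-1` measure_support mu) x -> 0 < b x.
  by move=> _; case/andP: (twist x) => h _; exact: lt_trans h.
exact: (dichotomy TS TS' (fun=> iff_refl _) (measurable_support mu) (support_full mu)
  fmu ergf gmu ergg b_gt0 erefl).
Qed.
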